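(* Let $T>0$, $d\ge1$, $b:[0,T]\times\mathbb{R}^d\to\mathbb{R}^d$, $\sigma:[0,T]\times\mathbb{R}^d\to\mathbb{R}^{d\times d}$, $a:=\sigma\sigma^\top$, $g:\mathbb{R}^d\to\mathbb{R}$, and let the switching times have the gamma density $f=f_\Gamma^{\kappa,\theta}$ with parameters $\kappa,\theta>0$. Assume: (i) there is $\epsilon_0>0$ with $a(t,x)\ge\epsilon_0\mathbb{I}$ for all $(t,x)\in[0,T]\times\mathbb{R}^d$; (ii) there is $L<\infty$ with $\|b(t,x)-b(t,x')\|+\|a(t,x)-a(t,x')\|\le L\|x-x'\|$ for all $t\in[0,T]$, $x,x'\in\mathbb{R}^d$; (iii) there are $\alpha\in(0,1]$ and $H<\infty$ with $\|b(t,x)-b(t',x)\|+\|a(t,x)-a(t',x)\|\le H|t-t'|^\alpha$ for all $t,t'\in[0,T]$, $x\in\mathbb{R}^d$; (iv) there is $M<\infty$ with $\|b(t,x)\|\le M$ and $\|a(t,x)\|\le M$ for all $(t,x)\in[0,T]\times\mathbb{R}^d$; (v) $g$ is Lipschitz and $g\in C^2$; (vi) $\kappa\le\alpha\wedge\frac12$. Then the estimator of $u(t_0,x_0)=\mathbb{E}[g(X_T^{t_0,x_0})]$ given by $$\beta\prod_{k=2}^{N_T}P_k\,\mathbf{1}_{N_T\ge1}+\frac{g(\bar X_1)}{1-F(\delta T_1)}\mathbf{1}_{N_T=0}$$ has finite variance, where $\beta$, $P_k$, $N_T$, $\bar X_k$, $\delta T_k$, $F$ are as defined in the context.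
   Context: $\|\cdot\|$ is the $L_\infty$ norm of a vector or matrix, $A:B:=\mathrm{tr}(AB^\top)$, empty products equal $1$, and $W$ is a $d$-dimensional Brownian motion. The coefficients of the SDE are assumed to satisfy the usual Lipschitz conditions, and $X^{t_0,x_0}$, for $(t_0,x_0)\in[0,T]\times\mathbb{R}^d$, is the unique strong solution of $dX_t=b(t,X_t)\,dt+\sigma(t,X_t)\,dW_t$ with $X_{t_0}=x_0$. Switching times: $(\tau_k)_{k\ge1}$ are i.i.d., independent of $W$, with common density $f(s)=f_\Gamma^{\kappa,\theta}(s)=\frac{s^{\kappa-1}e^{-s/\theta}}{\Gamma(\kappa)\theta^\kappa}$, $s>0$, where $\Gamma$ is the Euler gamma function; $F=F_\Gamma^{\kappa,\theta}$ is its cumulative distribution function. Set $T_0=t_0$, $\delta T_{k+1}=\tau_{k+1}\wedge(T-T_k)$, $T_{k+1}=T_k+\delta T_{k+1}$ for $k\ge0$, and $N_T:=\inf\{n\ge0: T_{n+1}\ge T\}$ (almost surely finite). Regime switching process: $\bar X_0=x_0$, $\bar X_{k+1}=\bar X_k+b(T_k,\bar X_k)\delta T_{k+1}+\sigma(T_k,\bar X_k)\delta W_{k+1}$, with $\delta W_{k+1}:=W_{T_{k+1}}-W_{T_k}$. Write $b_k=b(T_k,\bar X_k)$, $\sigma_k=\sigma(T_k,\bar X_k)$, $a_k=a(T_k,\bar X_k)$, $\delta b_k=b_k-b_{k-1}$, $\delta a_k=a_k-a_{k-1}$, and $\hat X_{n+1}=\bar X_n+b_n\delta T_{n+1}-\sigma_n\delta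 W_{n+1}$. Weights: for $k=1,\dots,N_T$, $$P_{k+1}=\frac{M_{k+1}+\frac12V_{k+1}}{f(\delta T_k)},\quad M_{k+1}=\delta b_k\cdot(\sigma_k^{-1})^\top\frac{\delta W_{k+1}}{\delta T_{k+1}},\quad V_{k+1}=\delta a_k:(\sigma_k^{-1})^\top\frac{\delta W_{k+1}\delta W_{k+1}^\top-\delta T_{k+1}\mathbb{I}}{(\delta T_{k+1})^2}\sigma_k^{-1}.$$ Terminal factor: $\beta:=\frac12(\beta_1+\beta_2)$ with $$\beta_1:=\frac{g(\bar X_{N_T+1})-g(\bar X_{N_T})}{1-F(\delta T_{N_T+1})}\,\frac{M_{N_T+1}+\frac12V_{N_T+1}}{f(\delta T_{N_T})},\qquad \beta_2:=\frac{g(\hat X_{N_T+1})-g(\bar X_{N_T})}{1-F(\delta T_{N_T+1})}\,\frac{-M_{N_T+1}+\frac12V_{N_T+1}}{f(\delta T_{N_T})}.$$ *)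

(* Defs.v *)
From HB Require Import structures.
From mathcomp Require Import all_boot all_order all_algebra.
From mathcomp Require Import all_classical all_reals all_analysis.

Set Implicit Arguments.
Unset Strict Implicit.
Unset Printing Implicit Defensive.

Import Order.TTheory GRing.Theory Num.Theory.
Import numFieldNormedType.Exports.

Local Open Scope classical_set_scope.
Local Open Scope ring_scope.

(* Coefficients on [0,T] x R^d are total functions of (t, x); every hypothesis
   on them is restricted to t in [0,T].  The library norm on matrices, hence on
   column vectors, is the largest absolute value of an entry. *)

Definition loewner_ge (R : realType) (d : nat) (A B : 'M[R]_d) : Prop :=
  forall v : 'cV[R]_d, 0 <= (v^T *m (A - B) *m v) 0 0.

Definition frob (R : realType) (d : nat) (A B : 'M[R]_d) : R :=
  \tr (A *m B^T).

Definition dotp (R : realType) (d : nat) (u v : 'cV[R]_d) : R :=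
  (u^T *m v) 0 0.

(* The Lipschitz conditions under which the SDE has a unique strong solution:
   Borel dependence on time, Lipschitz dependence on space (uniformly in time)
   and linear growth. *)
Definition usual_lipschitz (R : realType) (d : nat) (T : R)
    (b : R -> 'cV[R]_d -> 'cV[R]_d) (sigma : R -> 'cV[R]_d -> 'M[R]_d) : Prop :=
  [/\ forall x i, measurable_fun `[0, T] (fun t => b t x i 0),
      forall x i j, measurable_fun `[0, T] (fun t => sigma t x i j),
      exists K : R, forall t x x', 0 <= t <= T ->
        `|b t x - b t x'| + `|sigma t x - sigma t x'| <= K * `|x - x'| &
      exists K : R, forall t x, 0 <= t <= T ->
        `|b t x| + `|sigma t x| <= K * (1 + `|x|)].

(* All partial derivatives of order at most 2 exist and are continuous; no bound
   on the second derivatives is required. *)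
Definition C2 (R : realType) (d : nat) (g : 'cV[R]_d -> R) : Prop :=
  let e (i : 'I_d) : 'cV[R]_d := delta_mx i 0 in
  [/\ continuous g,
      forall i, (forall x, derivable g x (e i)) /\
                continuous (fun x => 'D_(e i) g x) &
      forall i j, (forall x, derivable (fun y => 'D_(e i) g y) x (e j)) /\
                  continuous (fun x => 'D_(e j) (fun y => 'D_(e i) g y) x)].

Section GammaLaw.
Context {R : realType}.

Definition Gamma_fun (k : R) : R :=
  \int[lebesgue_measure]_(x in `]0, +oo[) (x `^ (k - 1) * expR (- x)).

Definition gamma_pdf (k theta s : R) : R :=
  if 0 < s then
    s `^ (k - 1) * expR (- s / theta) / (Gamma_fun k * theta `^ k)
  else 0.

Definition gamma_cdf (k theta s : R) : R :=
  \int[lebesgue_measure]_(x in `]-oo, s]) gamma_pdf k theta x.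

End GammaLaw.

Section Probability.
Context {dd : measure_display} {Omega : measurableType dd} {R : realType}.
Variable P : probability Omega R.

(* sigma-algebra generated by the family of real functions (X i), i in D *)
Definition sigma_gen (I : Type) (D : set I) (X : I -> Omega -> R) :
    set (set Omega) :=
  <<s [set E | exists i A, [/\ D i, measurable A & E = X i @^-1` A]] >>.

Definition indep_sets (G H : set (set Omega)) : Prop :=
  forall A B, G A -> H B -> P (A `&` B) = (P A * P B)%E.

Definition mutually_independent (I : eqType) (X : I -> Omega -> R) : Prop :=
  forall (s : seq I) (A : I -> set R), uniq s -> (forall i, measurable (A i)) ->
    P (\big[setI/setT]_(i <- s) (X i @^-1` A i)) =
    (\prod_(i <- s) P (X i @^-1` A i))%E.

Definition is_brownian (d : nat) (W : R -> Omega -> 'cV[R]_d) : Prop :=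
  [/\ forall t i, 0 <= t -> measurable_fun setT (fun w => W t w i 0),
      {ae P, forall w, W 0 w = 0},
      forall w, {within `[0, +oo[, continuous (fun t => W t w)},
      forall s t, 0 <= s -> s <= t ->
        indep_sets
          (sigma_gen [set p : R * 'I_d | 0 <= p.1 <= s]
                     (fun p w => W p.1 w p.2 0))
          (sigma_gen [set: 'I_d] (fun i w => (W t w - W s w) i 0)) &
      forall s t, 0 <= s -> s < t ->
        mutually_independent (fun (i : 'I_d) w => (W t w - W s w) i 0) /\
        forall (i : 'I_d) (A : set R), measurable A ->
          P ((fun w => (W t w - W s w) i 0) @^-1` A) =
          normal_prob 0 (Num.sqrt (t - s)) A].

(* tau k stands for tau_{k+1}; waiting times take their values in ]0, +oo[. *)
Definition iid_gamma (kappa theta : R) (tau : nat -> Omega -> R) : Prop :=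
  [/\ forall k, measurable_fun setT (tau k),
      forall k w, 0 < tau k w,
      mutually_independent tau &
      forall k (A : set R), measurable A ->
        P (tau k @^-1` A) =
        (\int[lebesgue_measure]_(s in A) (gamma_pdf kappa theta s)%:E)%E].

Definition indep_process (d : nat) (W : R -> Omega -> 'cV[R]_d)
    (tau : nat -> Omega -> R) : Prop :=
  indep_sets
    (sigma_gen [set p : R * 'I_d | 0 <= p.1] (fun p w => W p.1 w p.2 0))
    (sigma_gen [set: nat] tau).

Definition finite_variance (Y : Omega -> R) : Prop :=
  [/\ measurable_fun setT Y,
      P.-integrable setT (EFin \o Y) &
      ('V_P[Y] < +oo)%E].

End Probability.

(* Pathwise construction: wp is a Brownian path, tau a sequence of waiting
   times (tau k is tau_{k+1}), f and F the density and c.d.f. of their law.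
   The definitions below that use k.-1 are meant for k >= 1 (k >= 2 for Mw, Vw
   and Pw). *)
Section Estimator.
Context {R : realType} {d : nat}.
Variables (b : R -> 'cV[R]_d -> 'cV[R]_d) (sigma : R -> 'cV[R]_d -> 'M[R]_d).
Variables (g : 'cV[R]_d -> R) (f F : R -> R).
Variables (T t0 : R) (x0 : 'cV[R]_d).
Variables (wp : R -> 'cV[R]_d) (tau : nat -> R).

Definition diffusion (t : R) (x : 'cV[R]_d) : 'M[R]_d :=
  sigma t x *m (sigma t x)^T.

Fixpoint Tsw (k : nat) : R :=
  if k is j.+1 then Tsw j + Num.min (tau j) (T - Tsw j) else t0.

Definition dT (k : nat) : R := Num.min (tau k.-1) (T - Tsw k.-1).

Definition dW (k : nat) : 'cV[R]_d := wp (Tsw k) - wp (Tsw k.-1).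

(* N_T; the value 0 on the null event {N_T = +oo} is a dummy. *)
Definition NT : nat :=
  if pselect (exists n, T <= Tsw n.+1) is left h then ex_minn h else 0%N.

Fixpoint Xbar (k : nat) : 'cV[R]_d :=
  if k is j.+1 then
    Xbar j + dT j.+1 *: b (Tsw j) (Xbar j)
           + sigma (Tsw j) (Xbar j) *m dW j.+1
  else x0.

Definition bk (k : nat) := b (Tsw k) (Xbar k).
Definition sk (k : nat) := sigma (Tsw k) (Xbar k).
Definition ak (k : nat) := diffusion (Tsw k) (Xbar k).
Definition dbk (k : nat) := bk k - bk k.-1.
Definition dak (k : nat) := ak k - ak k.-1.

Definition Xhat (k : nat) : 'cV[R]_d :=
  Xbar k.-1 + dT k *: bk k.-1 - sk k.-1 *m dW k.

Definition Mw (k : nat) : R :=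
  dotp (dbk k.-1) ((invmx (sk k.-1))^T *m ((dT k)^-1 *: dW k)).

Definition Vw (k : nat) : R :=
  frob (dak k.-1)
    ((invmx (sk k.-1))^T
       *m ((dT k ^+ 2)^-1 *: (dW k *m (dW k)^T - dT k *: 1%:M))
       *m invmx (sk k.-1)).

Definition Pw (k : nat) : R := (Mw k + 2^-1 * Vw k) / f (dT k.-1).

Definition beta1 : R :=
  (g (Xbar NT.+1) - g (Xbar NT)) / (1 - F (dT NT.+1))
  * ((Mw NT.+1 + 2^-1 * Vw NT.+1) / f (dT NT)).

Definition beta2 : R :=
  (g (Xhat NT.+1) - g (Xbar NT)) / (1 - F (dT NT.+1))
  * ((- Mw NT.+1 + 2^-1 * Vw NT.+1) / f (dT NT)).

Definition beta : R := 2^-1 * (beta1 + beta2).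

Definition estimator : R :=
  beta * (\prod_(2 <= k < NT.+1) Pw k) * (1 <= NT)%N%:R
  + g (Xbar 1%N) / (1 - F (dT 1%N)) * (NT == 0)%N%:R.

End Estimator.

(* Main.v *)
(**
Group the factors of the product of the weights by waiting time.  Since
2 kappa <= min (2 alpha, 1), the singularities of the weights and of 1 / f at small waiting
times cancel against the regularity of b and a, and the square of each group is at most a
constant times a polynomial in the normalised Brownian increment.  In the terminal factor the
antithetic pair leaves the second difference of g over the last increment, divided by the
length s of the last step.

The second derivatives of g may be unbounded, so the mean square of this second difference is
only known to be O(s), and s^-2 times it is not obviously integrable.  Averaging also over the
Gaussian increment of the step before makes it so: with
E(v) the integral over y of (G(y + v) - G(y))^2 and D(v) the same integral for second differences, the
parallelogram identity gives D(v) + E(2 v) <= 4 E(v), which telescopes along dyadic scales, so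
that the integral of s^-2 D(sqrt s v) over s is bounded by the Lipschitz constant alone.
Gaussian densities are replaced by Laplace kernels, which almost commute with translations.

Integrating the last waiting time before the end over a remaining time l thus costs at most
C l^(kappa - 1).  Convolution of f with this singular kernel, tilted by exp(lam l), is a
contraction of arbitrarily small ratio for large lam, which beats the geometric growth of the
constants and makes the sum over the number of switches finite.
*)
Require Import Defs.
From HB Require Import structures.
From mathcomp Require Import all_boot all_order all_algebra all_fingroup.
From mathcomp Require Import all_classical all_reals all_analysis.
From mathcomp Require Import measurable_realfun measurable_fun_approximation.
From mathcomp Require Import ring lra.

Set Implicit Arguments.
Unset Strict Implicit.
Unset Printing Implicit Defensive.

Import Order.TTheory GRing.Theory Num.Theory.
Import numFieldNormedType.Exports.

Local Open Scope classical_set_scope.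
Local Open Scope ring_scope.

(** * Independence and measurability *)

(** No conditional expectation is formed. Independence turns an integral over [Omega] into a double
    one, with the past read off one sample and the future off another, so that times, positions and
    coefficients are constants for the inner integral. The inner law is then the image of a Gaussian
    column under a fixed matrix, hence the linear changes of variables.

    The telescoping compares weighted mean squares at a point and at its translate. The ratio of a
    Gaussian density to its translate is unbounded; for a Laplace kernel it is at most the
    exponential of the shift measured in the scale of the kernel, which stays bounded at all smaller
    dyadic scales.

    Both the variance and the drift of the step before the last change with its length. The kernel
    is therefore taken at the fixed scale of the whole remaining time, which requires that step to
    be a sizeable part of it, and the drift is frozen at an error of order s, harmless against s^-2
    after squaring. If that step is short, the last one is long and the Lipschitz bound suffices. *)

Lemma le_integral_ge0 (d : measure_display) (T : measurableType d) (R : realType)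
    (mu : {measure set T -> \bar R}) (D : set T) (f1 f2 : T -> \bar R) :
  (forall x, D x -> 0 <= f1 x)%E -> (forall x, D x -> f1 x <= f2 x)%E ->
  (\int[mu]_(x in D) f1 x <= \int[mu]_(x in D) f2 x)%E.
Proof.
move=> f10 f12.
have f20 x : D x -> (0 <= f2 x)%E by move=> Dx; exact: le_trans (f10 _ Dx) (f12 _ Dx).
(* The integral of a nonnegative function is a supremum over the simple functions below it, which
   grows with the function whether or not the latter is measurable. *)
rewrite !ge0_integralE//; apply: ereal_sup_le => _ [h hf <-]; exists h => // x.
apply: (le_trans (hf x)); exact: lee_restrict.
Qed.

Section indep_copies.
Context (d d1 d2 : measure_display) (Om : measurableType d) (T1 : measurableType d1)
  (T2 : measurableType d2) (R : realType) (P : probability Om R).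
Variables (X1 : Om -> T1) (X2 : Om -> T2).
Hypotheses (mX1 : measurable_fun setT X1) (mX2 : measurable_fun setT X2).
Hypothesis indX : forall A B, measurable A -> measurable B ->
  (P (X1 @^-1` A `&` X2 @^-1` B) = P (X1 @^-1` A) * P (X2 @^-1` B))%E.

(** The joint law of [X1] and [X2] is the product of their laws; Tonelli on the product, pulled back
    to [Om], gives two independent samples [w1] and [w2]. This plays the part of conditioning on
    [X1]. *)
Lemma indep_integral (Phi : T1 * T2 -> \bar R) :
  measurable_fun setT Phi -> (forall x, 0 <= Phi x)%E ->
  (\int[P]_w Phi (X1 w, X2 w) = \int[P]_w1 \int[P]_w2 Phi (X1 w1, X2 w2))%E.
Proof.
move=> mPhi Phi0.
pose pk1 : {mfun Om >-> T1} := HB.pack X1 (isMeasurableFun.Build _ _ _ _ _ mX1).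
pose pk2 : {mfun Om >-> T2} := HB.pack X2 (isMeasurableFun.Build _ _ _ _ _ mX2).
pose P1 : probability T1 R := distribution P pk1.
pose P2 : probability T2 R := distribution P pk2.
have mX : measurable_fun setT (fun w => (X1 w, X2 w)) by exact: measurable_fun_pair.
pose pkX : {mfun Om >-> (T1 * T2)%type} :=
  HB.pack (fun w => (X1 w, X2 w)) (isMeasurableFun.Build _ _ _ _ _ mX).
pose PX : probability (T1 * T2)%type R := distribution P pkX.
have E1 : (\int[PX]_z Phi z = \int[P]_w Phi (X1 w, X2 w))%E.
  by rewrite ge0_integral_pushforward// preimage_setT.
rewrite -E1.
have E2 : (\int[PX]_z Phi z = \int[P1 \x P2]_z Phi z)%E.
  apply: eq_measure_integral => A mA _.
  rewrite -(product_measure_unique (m1 := P1) (m2 := P2) (m' := PX))//.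
rewrite E2 fubini_tonelli1// /fubini_F.
rewrite ge0_integral_pushforward//=; last 2 first.
- exact: measurable_fun_fubini_tonelli_F.
- by move=> x _; apply: integral_ge0.
rewrite preimage_setT; apply: eq_integral => w _ /=.
rewrite ge0_integral_pushforward//=.
by apply: measurableT_comp => //; exact: measurable_fun_pair.
Qed.

End indep_copies.

Section matrix_norm.
Context (R : realType) (m n : nat).
Implicit Types (x : 'M[R]_(m, n)) (e : R).

Lemma mx_norm_ub x e : 0 <= e -> (forall i j, `|x i j| <= e) -> `|x| <= e.
Proof.
by move=> e0 xe; rewrite [`|x|]mx_normrE; apply: bigmax_le => // -[i j] _; exact: xe.
Qed.

Lemma mx_norm_entry x i j : `|x i j| <= `|x|.
Proof.
by rewrite [leRHS]mx_normrE; apply: (le_bigmax _ (fun ij => `|x ij.1 ij.2|) (i, j)).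
Qed.

End matrix_norm.

Section indep_pi_system.
Context (d : measure_display) (Om : measurableType d) (R : realType)
  (P : probability Om R).

(** In [A], the two sides are finite measures: [P] restricted to [B], and [P] scaled by [P B]. They
    agree on a generating pi-system that contains the whole space. *)
Lemma indep_pi_system (G : set (set Om)) (B : set Om) :
  setI_closed G -> G setT -> G `<=` measurable -> measurable B ->
  (forall A, G A -> P (A `&` B) = (P A * P B)%E) ->
  forall A, <<s G >> A -> P (A `&` B) = (P A * P B)%E.
Proof.
move=> GI GT Gm mB GB A sA.
have PBfin : P B \is a fin_num by exact: fin_num_measure.
have PB0 : 0 <= fine (P B) by rewrite fine_ge0.
pose r := NngNum PB0.
pose m1 : {measure set Om -> \bar R} := mrestr P mB.
pose m2 : {measure set Om -> \bar R} := mscale r P.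
have -> : P (A `&` B) = m1 A by [].
have -> : (P A * P B)%E = m2 A by rewrite /m2 /= /mscale/= fineK// muleC.
apply: (g_sigma_algebra_measure_unique G Gm (fun=> setT)) => //.
- by rewrite bigcup_const//; exists 0%N.
- by move=> C GC; rewrite /m1 /m2 /= /mrestr /mscale /= fineK// muleC GB.
- move=> _; rewrite /m1 /= /mrestr setTI (le_lt_trans (probability_le1 _ _))//.
  exact: ltry.
Qed.

(** The events that prescribe a set for every variable of [s] form a pi-system generating the past;
    the product formula for [k :: s] separates each of them from [X k]. *)
Lemma mutual_indep_past (I : eqType) (X : I -> Om -> R) (s : seq I) (k : I)
    (A : set Om) (B : set R) :
  (forall i, measurable_fun setT (X i)) -> mutually_independent P X ->
  k \notin s -> measurable B -> sigma_gen [set i | i \in s] X A ->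
  P (A `&` X k @^-1` B) = (P A * P (X k @^-1` B))%E.
Proof.
move=> mX indX ks mB sA.
pose G := [set E | exists C : I -> set R, (forall i, measurable (C i)) /\
  E = \big[setI/setT]_(i <- undup s) (X i @^-1` C i)].
have mXA i C : measurable C -> measurable (X i @^-1` C).
  by move=> mC; rewrite -[X in measurable X]setTI; exact: mX.
have {}sA : <<s G >> A.
  move: A sA; apply: sub_sigma_algebra2 => _ [i [C [/= si mC ->]]].
  exists (fun j => if j == i then C else setT); split.
    by move=> j; case: ifP.
  have su : uniq (undup s) by exact: undup_uniq.
  rewrite (bigD1_seq i) ?mem_undup//= eqxx big1 ?setIT// => j /negbTE ->.
  by rewrite preimage_setT.
apply: (@indep_pi_system G) => //.
- move=> _ _ [C1 [m1 ->]] [C2 [m2 ->]]; exists (fun i => C1 i `&` C2 i); split.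
    by move=> i; exact: measurableI.
  by rewrite -big_split/=.
- exists (fun=> setT); split => //.
  by rewrite big1// => i _; rewrite preimage_setT.
- move=> _ [C [mC ->]]; apply: bigsetI_measurable => i _; exact: mXA.
- exact: mXA.
- move=> _ [C [mC ->]].
  (* As [k] does not occur in [s], one family of sets describes both the past event and the event on
     [X k]. *)
  pose C' i := if i == k then B else C i.
  have kus : k \notin undup s by rewrite mem_undup.
  have EC : \big[setI/setT]_(i <- undup s) (X i @^-1` C i) =
            \big[setI/setT]_(i <- undup s) (X i @^-1` C' i).
    rewrite big_seq_cond [RHS]big_seq_cond; apply: eq_bigr => i /andP[si _].
    by rewrite /C'; case: eqP => // ik; rewrite -ik si in kus.
  have mC' i : measurable (C' i) by rewrite /C'; case: ifP.
  rewrite EC (indX _ C')//; last exact: undup_uniq.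
  have := indX (k :: undup s) C'.
  rewrite /= kus undup_uniq => /(_ isT mC').
  rewrite !big_cons {1 3}/C' eqxx => E; rewrite setIC muleC; exact: E.
Qed.

End indep_pi_system.

Section column_measurable.
Context (R : realType) (n : nat).

(* The library puts no sigma-algebra on matrices: columns get the one generated by their entries. *)
Definition col_gen : set (set 'cV[R]_n) :=
  [set E | exists i (A : set R), measurable A /\ E = (fun v : 'cV[R]_n => v i 0) @^-1` A].

Definition mcol := g_sigma_algebraType col_gen.
HB.instance Definition _ := Measurable.on mcol.

End column_measurable.

Lemma measurable_colP (d : measure_display) (S : measurableType d) (R : realType)
    (n : nat) (X : S -> 'cV[R]_n) :
  measurable_fun setT (X : S -> mcol R n) <->
  forall i, measurable_fun setT (fun s => X s i 0).
Proof.
split.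
- move=> mX i _ A mA; rewrite setTI.
  have -> : (fun s => X s i 0) @^-1` A = X @^-1` ((fun v : 'cV[R]_n => v i 0) @^-1` A) by [].
  rewrite -[X in measurable X]setTI; apply: mX => //.
  by apply: sub_sigma_algebra; exists i, A.
- move=> mX; apply: (@measurability _ _ S (mcol R n) setT X (@col_gen R n)) => // _ [_ [i [A [mA ->]]] <-].
  exact: mX.
Qed.

(** * Composition of a random function with a random argument *)

Section countable_composition.
Context (d : measure_display) (S : measurableType d) (R : realType).

Lemma measurable_countable_case (I : countType) (enc : S -> I) (h : I -> S -> R) :
  (forall i, measurable (enc @^-1` [set i])) ->
  (forall i, measurable_fun setT (h i)) ->
  measurable_fun setT (fun s => h (enc s) s).
Proof.
move=> me mh _ A mA; rewrite setTI.
have -> : (fun s => h (enc s) s) @^-1` A =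
    \bigcup_(i in [set: I]) (enc @^-1` [set i] `&` h i @^-1` A).
  apply/seteqP; split => [s As|s [i _ [/= <-//]]].
  by exists (enc s).
apply: countable_bigcupT_measurable => // i; apply: measurableI => //.
by rewrite -[X in measurable X]setTI; exact: mh.
Qed.

(** Only [Phi s e] for fixed [e] is known to be measurable, and [E] carries no sigma-algebra. The
    argument is rounded to countably many values, where the composition is measurable fibre by
    fibre, and the limit is taken pointwise. *)
Lemma measurable_countable_approx (E : Type) (I : countType) (enc : nat -> S -> I)
    (dec : nat -> I -> E) (Phi : S -> E -> R) (X : S -> E) :
  (forall k i, measurable (enc k @^-1` [set i])) ->
  (forall k i, measurable_fun setT (fun s => Phi s (dec k i))) ->
  (forall s, Phi s (dec k (enc k s)) @[k --> \oo] --> Phi s (X s)) ->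
  measurable_fun setT (fun s => Phi s (X s)).
Proof.
move=> me mPhi cv.
apply: (@measurable_fun_cvg _ _ _ _ (fun k s => Phi s (dec k (enc k s)))) => //.
by move=> k; apply: (measurable_countable_case (h := fun i s => Phi s (dec k i))).
Qed.

Lemma measurable_floor_fiber (f : S -> R) (z : int) : measurable_fun setT f ->
  measurable ((fun s => Num.floor (f s)) @^-1` [set z]).
Proof.
move=> mf.
have -> : (fun s => Num.floor (f s)) @^-1` [set z] = f @^-1` `[z%:~R, (z + 1)%:~R[%classic.
  apply/seteqP; split => s /=; rewrite in_itv/=; last by move/floor_def.
  by move=> <-; exact: floor_itv.
by rewrite -[X in measurable X]setTI; exact: mf.
Qed.

Definition grid (k : nat) (x : R) : int := Num.floor (k.+1%:R * x).

Lemma grid_near (k : nat) (x : R) :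
  `| x - (grid k x)%:~R / k.+1%:R | <= k.+1%:R^-1.
Proof.
have k0 : (0 : R) < k.+1%:R by [].
rewrite /grid; set z := Num.floor _.
have := floor_itv (k.+1%:R * x); rewrite -/z intrD => /andP[zl zu].
have -> : x - z%:~R / k.+1%:R = (k.+1%:R * x - z%:~R) * k.+1%:R^-1.
  by field; rewrite gt_eqF.
have k0' : 0 <= k.+1%:R^-1 :> R by rewrite invr_ge0 ltW.
rewrite normrM [X in _ * X]ger0_norm// ler_piMl//.
rewrite ler_norml; apply/andP; split; lra.
Qed.

Lemma cvg_grid (x : R) : (grid k x)%:~R / k.+1%:R @[k --> \oo] --> x.
Proof.
apply/cvgrPdist_le => e e0; near=> k.
apply: (le_trans (grid_near k x)).
by apply: ltW; near: k; exact: (near_infty_natSinv_lt (PosNum e0)).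
Unshelve. all: by end_near. Qed.

Lemma measurable_comp_time (Phi : S -> R -> R) (X : S -> R) :
  (forall t, 0 <= t -> measurable_fun setT (fun s => Phi s t)) ->
  (forall s, {within `[0, +oo[, continuous (Phi s)}) ->
  measurable_fun setT X -> (forall s, 0 <= X s) ->
  measurable_fun setT (fun s => Phi s (X s)).
Proof.
move=> mPhi cPhi mX X0.
(* The maximum with 0 keeps every decoded value in the half-line where [Phi] is controlled; on codes
   of nonnegative numbers it changes nothing. *)
pose dec k (z : int) : R := Num.max 0 (z%:~R / k.+1%:R).
apply: (@measurable_countable_approx _ _ (fun k s => grid k (X s)) dec).
- move=> k i; apply: measurable_floor_fiber; exact: measurable_funM.
- by move=> k i; apply: mPhi; rewrite /dec le_max lexx.
- move=> s.
  have dE k : dec k (grid k (X s)) = (grid k (X s))%:~R / k.+1%:R.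
    rewrite /dec max_r// divr_ge0// ler0z floor_ge0 mulr_ge0//.
  have cvx : dec k (grid k (X s)) @[k --> \oo] --> X s.
    by under eq_fun do rewrite dE; exact: cvg_grid.
  have := cPhi s; move/continuous_within_itvcyP => [cin cr].
  (* At 0 continuity is only one-sided, but rounding 0 returns 0 exactly, so the sequence is
     constant there. *)
  have [x0|x0] := eqVneq (X s) 0; last first.
    apply: (cvg_comp _ _ cvx); apply: cin.
    by rewrite in_itv/= andbT lt_neqAle eq_sym x0 X0.
  under eq_fun do rewrite x0 /dec /grid mulr0 floor0 mul0r maxxx.
  rewrite x0; exact: cvg_cst.
Qed.

Lemma measurable_comp_col n (Phi : S -> 'cV[R]_n -> R) (X : S -> 'cV[R]_n) :
  (forall x, measurable_fun setT (fun s => Phi s x)) ->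
  (forall s, continuous (Phi s)) ->
  (forall i, measurable_fun setT (fun s => X s i 0)) ->
  measurable_fun setT (fun s => Phi s (X s)).
Proof.
move=> mPhi cPhi mX.
pose enc k s : 'cV[int]_n := \col_i grid k (X s i 0).
pose dec k (z : 'cV[int]_n) : 'cV[R]_n := \col_i ((z i 0)%:~R / k.+1%:R).
apply: (@measurable_countable_approx _ _ enc dec).
- move=> k z.
  have -> : enc k @^-1` [set z] =
      \big[setI/setT]_(i <- enum 'I_n) ((fun s => grid k (X s i 0)) @^-1` [set z i 0]).
    apply/seteqP; split => s /=.
      move=> <-; rewrite -bigcap_seq => i _ /=; by rewrite mxE.
    rewrite -bigcap_seq => H; apply/matrixP => i j; rewrite ord1 mxE.
    by apply: H; rewrite /= mem_enum.
  apply: bigsetI_measurable => i _; apply: measurable_floor_fiber.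
  exact: measurable_funM.
- by move=> k i; exact: mPhi.
- move=> s; apply: (cvg_comp (fun k => dec k (enc k s)) (Phi s)); last exact: cPhi.
  apply/cvgrPdist_le => e e0; near=> k.
  have ke : k.+1%:R^-1 <= e.
    by apply: ltW; near: k; exact: (near_infty_natSinv_lt (PosNum e0)).
  apply: mx_norm_ub; first exact: ltW.
  move=> i j; rewrite ord1 !mxE; exact: le_trans (grid_near _ _) ke.
Unshelve. all: by end_near. Qed.

End countable_composition.

(** * Iterated integrals and linear changes of variables *)

Section affine_change.
Context (R : realType).
Local Notation mu := (@lebesgue_measure R).

(** The image of Lebesgue measure under the affine map, multiplied by [|a|], gives half-open
    intervals their length, which characterises Lebesgue measure. *)
Lemma lebesgue_affine (a b : R) (A : set R) : a != 0 -> measurable A ->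
  (mu ((fun u => a * u + b)%R @^-1` A) = (`|a|^-1)%:E * mu A)%E.
Proof.
move=> a0 mA.
have na0 : 0 < `|a| by rewrite normr_gt0.
have mf : measurable_fun setT (fun u : measurableTypeR R => a * u + b : measurableTypeR R).
  by apply: measurable_funD => //; exact: measurable_funM.
have r0 : 0 <= `|a| by exact: ltW.
pose m0' mf : {measure set (measurableTypeR R) -> \bar R} :=
  mscale (NngNum r0) (measure_function_pushforward__canonical__measure_function_Measure
    mu (f := fun u : measurableTypeR R => a * u + b : measurableTypeR R) mf).
pose m' := m0' mf.
have H : mu A = m' A.
  apply: lebesgue_measure_unique => // _ [[x y]] _ <-.
  change (mu `]x, y] = (`|a|%:E * mu ((fun u : R => a * u + b)%R @^-1` `]x, y]))%E).
  have [xy|yx] := ltP x y; last first.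
    by rewrite set_itv_ge ?bnd_simp -?leNgt// preimage_set0 !measure0 mule0.
  have -> : (fun u => a * u + b) @^-1` `]x, y] =
     if 0 < a then `](x - b) / a, (y - b) / a]%classic
     else `[(y - b) / a, (x - b) / a[%classic.
    case: ifPn => [ap|an]; apply/seteqP; split => u /=; rewrite !in_itv/=.
    - by rewrite ltr_pdivrMr// ler_pdivlMr// mulrC => /andP[? ?]; apply/andP; split; lra.
    - by rewrite ltr_pdivrMr// ler_pdivlMr// mulrC => /andP[? ?]; apply/andP; split; lra.
    - have ap : a < 0 by rewrite lt_neqAle a0 leNgt.
      by rewrite ler_ndivrMr// ltr_ndivlMr// mulrC => /andP[? ?]; apply/andP; split; lra.
    - have ap : a < 0 by rewrite lt_neqAle a0 leNgt.
      by rewrite ler_ndivrMr// ltr_ndivlMr// mulrC => /andP[? ?]; apply/andP; split; lra.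
  rewrite lebesgue_measure_itv/= lte_fin xy.
  case: ifPn => [ap|an]; rewrite lebesgue_measure_itv/= lte_fin.
    rewrite ltr_pM2r ?invr_gt0// ltrD2r xy -!EFinD -EFinM gtr0_norm//; congr EFin.
    by field; rewrite gt_eqF.
  have ap : a < 0 by rewrite lt_neqAle a0 leNgt.
  rewrite ltr_nM2r ?invr_lt0// ltrD2r xy -!EFinD -EFinM ltr0_norm//; congr EFin.
  by field; rewrite lt_eqF.
rewrite H /m' /= /mscale /pushforward /= muleA -EFinM mulVf ?mul1e//.
by rewrite gt_eqF.
Qed.

Lemma integral_affine (f : R -> \bar R) (a b : R) : a != 0 ->
  measurable_fun setT f -> (forall u, 0 <= f u)%E ->
  (\int[mu]_u f (a * u + b)%R = (`|a|^-1)%:E * \int[mu]_u f u)%E.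
Proof.
move=> a0 mf f0.
have r0 : 0 <= `|a|^-1 by rewrite invr_ge0.
have mg : measurable_fun setT (fun u : measurableTypeR R => a * u + b : measurableTypeR R).
  by apply: measurable_funD => //; exact: measurable_funM.
have -> : ((`|a|^-1)%:E = (NngNum r0)%:num%:E)%E by [].
rewrite -ge0_integral_mscale//.
have := @ge0_integral_pushforward _ _ _ _ R _ mg mu setT f measurableT mf (fun y _ => f0 y).
rewrite preimage_setT => <-.
apply: eq_measure_integral => A mA _.
exact: lebesgue_affine.
Qed.

Lemma integral_translate (f : R -> \bar R) (b : R) :
  measurable_fun setT f -> (forall u, 0 <= f u)%E ->
  (\int[mu]_u f (u + b)%R = \int[mu]_u f u)%E.
Proof.
move=> mf f0; rewrite -[RHS]mul1e -invr1 -[X in X^-1]normr1 -(@integral_affine f 1 b)//.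
  by apply: eq_integral => u _; rewrite mul1r.
Qed.

End affine_change.

Section column_operations.
Context (d : measure_display) (S : measurableType d) (R : realType) (n : nat).

Lemma measurable_col_add (X Y : S -> mcol R n) :
  measurable_fun setT X -> measurable_fun setT Y ->
  measurable_fun setT (fun s => (X s + Y s : 'cV[R]_n) : mcol R n).
Proof.
move=> /measurable_colP mX /measurable_colP mY; apply/measurable_colP => i.
by under eq_fun do rewrite mxE; exact: measurable_funD.
Qed.

Lemma measurable_col_scale (c : S -> R) (X : S -> mcol R n) :
  measurable_fun setT c -> measurable_fun setT X ->
  measurable_fun setT (fun s => (c s *: (X s : 'cV[R]_n)) : mcol R n).
Proof.
move=> mc /measurable_colP mX; apply/measurable_colP => i.
by under eq_fun do rewrite mxE; exact: measurable_funM.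
Qed.

End column_operations.

Section iterated_integral.
Context (R : realType) (n : nat).
Local Notation mu := (@lebesgue_measure R).
Implicit Types (vs : seq 'cV[R]_n) (v w x : 'cV[R]_n).

(* Integrating over R^n along a list of directions reduces a linear change of variables to
   elementary operations on the list. *)
Fixpoint Jint vs (F : 'cV[R]_n -> \bar R) x : \bar R :=
  if vs is v :: vs' then (\int[mu]_u Jint vs' F (x + u *: v)%R)%E else F x.

Lemma Jint_ge0 vs F x : (forall y, 0 <= F y)%E -> (0 <= Jint vs F x)%E.
Proof.
by move=> F0; elim: vs x => //= v vs IH x; apply: integral_ge0 => u _; exact: IH.
Qed.

Lemma eq_Jint vs F G x : F =1 G -> Jint vs F x = Jint vs G x.
Proof. by move=> /funext ->. Qed.

Lemma le_Jint vs F G x : (forall y, 0 <= F y)%E -> (forall y, F y <= G y)%E ->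
  (Jint vs F x <= Jint vs G x)%E.
Proof.
move=> F0 FG; elim: vs x => //= v vs IH x; apply: le_integral_ge0 => u _ //.
exact: Jint_ge0.
Qed.

(** The parameter space [S] is carried through the induction to obtain joint measurability in the
    parameter and the base point, as needed when the integrand itself depends on a time, a sample or
    another column. *)
Lemma measurable_Jint (d : measure_display) (S : measurableType d) vs
    (F : S -> 'cV[R]_n -> \bar R) :
  measurable_fun setT (fun p : S * mcol R n => F p.1 p.2) ->
  (forall s y, 0 <= F s y)%E ->
  measurable_fun setT (fun p : S * mcol R n => Jint vs (F p.1) p.2).
Proof.
move=> mF F0; elim: vs => //= v vs IH.
pose h (q : (S * mcol R n) * measurableTypeR R) :=
  Jint vs (F q.1.1) ((q.1.2 : 'cV[R]_n) + (q.2 : R) *: v).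
apply: (measurable_fun_fubini_tonelli_F (m2 := mu) h).
  apply: (measurableT_comp IH (g := fun q : (S * mcol R n) * measurableTypeR R =>
    (q.1.1, ((q.1.2 : 'cV[R]_n) + (q.2 : R) *: v) : mcol R n))).
  apply: measurable_fun_pair; first exact: measurableT_comp.
  apply: measurable_col_add; first exact: measurableT_comp.
  by apply: measurable_col_scale => //; exact: measurable_snd.
by move=> q; exact: Jint_ge0.
Qed.

Lemma measurable_Jint1 vs (F : 'cV[R]_n -> \bar R) :
  measurable_fun setT (F : mcol R n -> \bar R) -> (forall y, 0 <= F y)%E ->
  measurable_fun setT (Jint vs F : mcol R n -> \bar R).
Proof.
move=> mF F0.
have := @measurable_Jint _ unit vs (fun=> F) (measurableT_comp mF measurable_snd) (fun=> F0).
move=> H.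
apply: (measurableT_comp H (g := fun x : mcol R n => (tt, x))).
exact: measurable_fun_pair.
Qed.

Lemma measurable_Jint_line vs (F : 'cV[R]_n -> \bar R) x v :
  measurable_fun setT (F : mcol R n -> \bar R) -> (forall y, 0 <= F y)%E ->
  measurable_fun setT (fun u : R => Jint vs F (x + u *: v)).
Proof.
move=> mF F0.
apply: (measurableT_comp (measurable_Jint1 vs mF F0) (g := fun u : R => (x + u *: v) : mcol R n)).
apply: measurable_col_add => //.
exact: measurable_col_scale.
Qed.

Section with_integrand.
Variable F : 'cV[R]_n -> \bar R.
Hypotheses (mF : measurable_fun setT (F : mcol R n -> \bar R))
  (F0 : forall y, (0 <= F y)%E).

Lemma measurable_Jint_plane vs x v w :
  measurable_fun setT (fun p : measurableTypeR R * measurableTypeR R =>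
    Jint vs F (x + (p.1 : R) *: v + (p.2 : R) *: w)).
Proof.
apply: (measurableT_comp (measurable_Jint1 vs mF F0)
  (g := fun p : measurableTypeR R * measurableTypeR R =>
    (x + (p.1 : R) *: v + (p.2 : R) *: w) : mcol R n)).
apply: measurable_col_add; last first.
  by apply: measurable_col_scale => //; exact: measurable_snd.
apply: measurable_col_add => //.
by apply: measurable_col_scale => //; exact: measurable_fst.
Qed.

Lemma Jint_swap vs v w x : Jint (v :: w :: vs) F x = Jint (w :: v :: vs) F x.
Proof.
rewrite /=.
have := @fubini_tonelli _ _ _ _ R mu mu _ (measurable_Jint_plane vs x v w) (fun=> Jint_ge0 _ _ F0).
rewrite /= => ->; apply: eq_integral => u _; apply: eq_integral => u' _.
by rewrite addrAC.
Qed.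

Lemma Jint_move vs ws v x : Jint (v :: vs ++ ws) F x = Jint (vs ++ v :: ws) F x.
Proof.
elim: vs x => [//|w vs IH] x.
rewrite [LHS]Jint_swap /=; apply: eq_integral => u _; exact: IH.
Qed.

Lemma Jint_perm vs ws x : perm_eq vs ws -> Jint vs F x = Jint ws F x.
Proof.
elim: vs ws x => [|v vs IH] ws x.
  by rewrite perm_sym => /perm_nilP ->.
move=> /[dup] pe; have vw : v \in ws by rewrite -(perm_mem pe) mem_head.
have [ws1 ws2] := splitPr vw => pe'.
rewrite -Jint_move /=; apply: eq_integral => u _; apply: IH.
by rewrite -(perm_cons v) (perm_trans pe')// perm_catC /= perm_cons perm_catC.
Qed.

(** For a fixed coordinate [u] along [w], the shear translates the coordinate along [v] by [c u],
    and one-dimensional translation invariance removes it. *)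
Lemma Jint_shear vs v w (c : R) x :
  Jint (v :: (w + c *: v) :: vs) F x = Jint (v :: w :: vs) F x.
Proof.
rewrite (Jint_swap vs v (w + c *: v)) (Jint_swap vs v w) /=; apply: eq_integral => u _.
transitivity (\int[mu]_u0 (fun t => Jint vs F (x + u *: w + t *: v)%R) (u0 + u * c)%R)%E.
  apply: eq_integral => u0 _; congr Jint.
  by rewrite scalerDr scalerDl scalerA -!addrA; do 2 congr (_ + _); exact: addrC.
rewrite (integral_translate (f := fun t => Jint vs F (x + u *: w + t *: v)))//.
  exact: measurable_Jint_line.
by move=> t; exact: Jint_ge0.
Qed.

Lemma Jint_scale vs v (c : R) x : c != 0 ->
  Jint (c *: v :: vs) F x = ((`|c|^-1)%:E * Jint (v :: vs) F x)%E.
Proof.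
move=> c0 /=.
rewrite -(@integral_affine _ (fun t => Jint vs F (x + t *: v)) c 0)//.
- by apply: eq_integral => u _; rewrite scalerA addr0 mulrC.
- exact: measurable_Jint_line.
- by move=> t; exact: Jint_ge0.
Qed.

Lemma Jint_shift vs v x (c : R) : v \in vs -> Jint vs F (x + c *: v) = Jint vs F x.
Proof.
move=> vvs; have [vs1 vs2] := splitPr vvs.
rewrite -!Jint_move /=.
rewrite -(@integral_translate _ (fun t => Jint (vs1 ++ vs2) F (x + t *: v)) c)//.
- by apply: eq_integral => u _; rewrite scalerDl -addrA [X in _ + X]addrC.
- exact: measurable_Jint_line.
- by move=> t; exact: Jint_ge0.
Qed.

Lemma Jint_comp_add vs x a : Jint vs (fun y => F (y + a)) x = Jint vs F (x + a).
Proof.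
by elim: vs x => //= v vs IH x; apply: eq_integral => u _; rewrite IH addrAC.
Qed.

Lemma Jint_mull vs (c : R) x : 0 <= c ->
  Jint vs (fun y => c%:E * F y)%E x = (c%:E * Jint vs F x)%E.
Proof.
move=> c0; elim: vs x => //= v vs IH x.
rewrite -ge0_integralZl//; last 2 first.
- exact: measurable_Jint_line.
- by move=> u _; exact: Jint_ge0.
by apply: eq_integral => u _; exact: IH.
Qed.

End with_integrand.

Lemma Jint_add vs F G x :
  measurable_fun setT (F : mcol R n -> \bar R) -> (forall y, 0 <= F y)%E ->
  measurable_fun setT (G : mcol R n -> \bar R) -> (forall y, 0 <= G y)%E ->
  Jint vs (fun y => F y + G y)%E x = (Jint vs F x + Jint vs G x)%E.
Proof.
move=> mF F0 mG G0; elim: vs x => //= v vs IH x.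
rewrite -ge0_integralD//; last 4 first.
- by move=> u _; exact: Jint_ge0.
- exact: measurable_Jint_line.
- by move=> u _; exact: Jint_ge0.
- exact: measurable_Jint_line.
by apply: eq_integral => u _; exact: IH.
Qed.

Lemma Jint_tonelli (d : measure_display) (S : measurableType d)
    (m : {sigma_finite_measure set S -> \bar R}) vs (F : S -> 'cV[R]_n -> \bar R) x :
  measurable_fun setT (fun p : S * mcol R n => F p.1 p.2) ->
  (forall s y, 0 <= F s y)%E ->
  (\int[m]_s Jint vs (F s) x)%E = Jint vs (fun y => \int[m]_s F s y)%E x.
Proof.
move=> mF F0; elim: vs x => //= v vs IH x.
pose h (q : S * measurableTypeR R) := Jint vs (F q.1) (x + (q.2 : R) *: v).
have mh : measurable_fun setT h.
  apply: (measurableT_comp (measurable_Jint vs mF F0) (g := fun q : S * measurableTypeR R =>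
    (q.1, (x + (q.2 : R) *: v) : mcol R n))).
  apply: measurable_fun_pair; first exact: measurable_fst.
  apply: measurable_col_add => //.
  by apply: measurable_col_scale => //; exact: measurable_snd.
rewrite (fubini_tonelli h mh); last by move=> q; exact: Jint_ge0.
by apply: eq_integral => u _; rewrite /h /= IH.
Qed.

End iterated_integral.

(** * Change of variables by an invertible matrix *)

Section linear_change.
Context (R : realType) (n : nat).
Variable F : 'cV[R]_n -> \bar R.
Hypotheses (mF : measurable_fun setT (F : mcol R n -> \bar R))
  (F0 : forall y, (0 <= F y)%E).

Lemma Jint_shear_mem vs w v (c : R) x : v \in vs ->
  Jint ((w + c *: v) :: vs) F x = Jint (w :: vs) F x.
Proof.
move=> vvs.
have perm_swap u : perm_eq (u :: vs) (v :: u :: rem v vs).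
  have := perm_catCA [:: u] [:: v] (rem v vs) => /permPl H.
  by rewrite -(permPr H) perm_cons; exact: perm_to_rem.
rewrite (@Jint_perm _ _ _ mF F0 _ (v :: (w + c *: v) :: rem v vs)); last first.
  exact: perm_swap.
rewrite Jint_shear//; apply: (Jint_perm mF F0).
by rewrite perm_sym; exact: perm_swap.
Qed.

Lemma Jint_shear_sum (I : Type) (r : seq I) (P : pred I) (v : I -> 'cV[R]_n) (c : I -> R) vs w x :
  (forall i, P i -> v i \in vs) ->
  Jint ((w + \sum_(i <- r | P i) c i *: v i) :: vs) F x = Jint (w :: vs) F x.
Proof.
move=> vvs; elim: r w => [|i r IH] w; first by rewrite big_nil addr0.
rewrite big_cons; case: ifP => Pi; last exact: IH.
by rewrite addrA IH Jint_shear_mem// vvs.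
Qed.

Definition Jfam (B : 'I_n -> 'cV[R]_n) := Jint [seq B i | i <- enum 'I_n] F.

(** Column operation: the components of [B k] along the other directions are shears and leave the
    integral unchanged, so only the scaling by [c k] is felt. *)
Lemma Jfam_replace (B B' : 'I_n -> 'cV[R]_n) k (c : 'I_n -> R) x :
  (forall i, i != k -> B i = B' i) -> c k != 0 ->
  B k = \sum_i c i *: B' i ->
  Jfam B x = ((`|c k|^-1)%:E * Jfam B' x)%E.
Proof.
move=> BB' ck Bk.
have kin : k \in enum 'I_n by rewrite mem_enum.
pose r := rem k (enum 'I_n).
have nkr i : i \in r -> i != k by rewrite /r mem_rem_uniq ?enum_uniq// inE => /andP[].
have pm (C : 'I_n -> 'cV[R]_n) : Jfam C x = Jint (C k :: [seq C i | i <- r]) F x.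
  by apply: (Jint_perm mF F0); rewrite -map_cons; apply: perm_map; exact: perm_to_rem.
rewrite !pm Bk (bigD1 k)//.
have -> : [seq B i | i <- r] = [seq B' i | i <- r].
  by apply/eq_in_map => i /nkr; exact: BB'.
rewrite Jint_shear_sum ?Jint_scale// => i /= ik.
by apply: map_f; rewrite /r mem_rem_uniq ?enum_uniq// inE ik mem_enum.
Qed.

Lemma Jfam_upper (M U : 'M[R]_n) x :
  (forall i j : 'I_n, (j < i)%N -> U i j = 0) -> (forall i, U i i != 0) ->
  Jfam (fun j => col j (M *m U)) x =
  ((\prod_i `|U i i|^-1)%:E * Jfam (fun j => col j M) x)%E.
Proof.
move=> Ulow Ud.
(* The columns of [M *m U] are replaced from left to right: column [k] combines columns of [M] of
   index at most [k], and those on its left have already been restored. *)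
pose B k (j : 'I_n) := if (j < k)%N then col j M else col j (M *m U).
have H k : (k <= n)%N -> Jfam (B 0%N) x =
    ((\prod_(i < n | (i < k)%N) `|U i i|^-1)%:E * Jfam (B k) x)%E.
  elim: k => [|k IH] kn; first by rewrite big1 ?mul1e// => i.
  rewrite IH; last exact: ltnW.
  pose kk := Ordinal kn.
  rewrite (@Jfam_replace (B k) (B k.+1) kk (fun i => U i kk)).
  - rewrite muleA -EFinM; congr (_%:E * _)%E.
    rewrite [in RHS](bigD1 kk)//= mulrC; congr (_ * _); apply: eq_bigl => i.
    by rewrite ltnS ltn_neqAle andbC.
  - move=> i ik; rewrite /B ltnS [in RHS]leq_eqVlt.
    by have -> : (i == k :> nat) = false by apply/negbTE.
  - exact: Ud.
  - rewrite /B ltnn; apply/matrixP => i j; rewrite !mxE summxE; apply: eq_bigr => l _.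
    rewrite !mxE ltnS; case: leqP => [lk|kl]; first by rewrite mxE mulrC.
    by rewrite Ulow// mul0r mulr0.
have := H n (leqnn n).
have -> : Jfam (B 0%N) x = Jfam (fun j => col j (M *m U)) x by [].
move=> ->; congr (_%:E * _)%E; first by apply: eq_bigl => i; rewrite ltn_ord.
by congr Jint; apply/eq_in_map => j _; rewrite /B ltn_ord.
Qed.

Lemma Jfam_lower (M L : 'M[R]_n) x :
  (forall i j : 'I_n, (i <= j)%N -> L i j = (i == j)%:R) ->
  Jfam (fun j => col j (M *m L)) x = Jfam (fun j => col j M) x.
Proof.
move=> Lup.
(* For a lower triangular factor the replacement runs from right to left; the unit diagonal produces
   no Jacobian. *)
pose B k (j : 'I_n) := if (k <= j)%N then col j M else col j (M *m L).
have H k : (k <= n)%N -> Jfam (B n) x = Jfam (B (n - k)%N) x.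
  elim: k => [|k IH] kn; first by rewrite subn0.
  rewrite IH; last exact: ltnW.
  have nk : (n - k.+1 < n)%N by rewrite ltn_subrL; case: n kn.
  have nkE : (n - k)%N = (n - k.+1).+1 by rewrite -subSn.
  pose kk := Ordinal nk.
  rewrite (@Jfam_replace (B (n - k)%N) (B (n - k.+1)%N) kk (fun i => L i kk)).
  - by rewrite Lup// eqxx normr1 invr1 mul1e.
  - move=> i ik; rewrite /B nkE [in RHS]leq_eqVlt.
    by have -> : ((n - k.+1)%N == i) = false by rewrite eq_sym; apply/negbTE.
  - by rewrite Lup// eqxx oner_neq0.
  - rewrite /B nkE ltnn; apply/matrixP => i j; rewrite !mxE summxE; apply: eq_bigr => l _.
    rewrite !mxE; case: leqP => [lk|kl]; first by rewrite mxE mulrC.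
    rewrite Lup; last exact: ltnW.
    have -> : (l == kk) = false by apply/negbTE; rewrite -val_eqE/= ltn_eqF.
    by rewrite mul0r mulr0.
have := H n (leqnn n).
rewrite subnn => E; transitivity (Jfam (B n) x).
  by congr Jint; apply/eq_in_map => j _; rewrite /B leqNgt ltn_ord.
by rewrite E; congr Jint; apply/eq_in_map => j _.
Qed.

Definition std_basis : seq 'cV[R]_n := [seq delta_mx i 0 | i <- enum 'I_n].

Lemma Jint_mulmx (A : 'M[R]_n) (G : 'cV[R]_n -> \bar R) vs x :
  Jint [seq A *m v | v <- vs] G (A *m x) = Jint vs (fun y => G (A *m y)) x.
Proof.
elim: vs x => //= v vs IH x; apply: eq_integral => u _.
by rewrite -IH mulmxDr scalemxAr.
Qed.

Lemma Jfam_perm (s : 'S_n) x :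
  Jfam (fun j => col j (perm_mx s)) x = Jint std_basis F x.
Proof.
pose t i : 'I_n := (s^-1)%g i.
have E : [seq col i (perm_mx s) | i <- enum 'I_n] =
    [seq (delta_mx (t i) 0 : 'cV[R]_n) | i <- enum 'I_n].
  apply/eq_in_map => j _ /=; apply/matrixP => i k.
  rewrite !mxE ord1 eqxx andbT; congr (_%:R).
  by congr nat_of_bool; apply/eqP/eqP => [<-|->]; rewrite /t ?permK ?permKV.
rewrite /Jfam E (map_comp (fun i => delta_mx i 0) t).
apply: (Jint_perm mF F0); apply: perm_map; apply: uniq_perm.
- by rewrite map_inj_uniq ?enum_uniq//; exact: perm_inj.
- exact: enum_uniq.
- move=> i; rewrite mem_enum inE; apply/mapP; exists (s i); rewrite ?mem_enum//.
  by rewrite /t permK.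
Qed.

End linear_change.

(** The LUP factorisation reduces [A] to a permutation, a unit lower triangular and an upper
    triangular matrix. Only the diagonal of the last one contributes, and its product is [det A] up
    to sign. *)
Lemma Jint_linear (R : realType) (n : nat) (F : 'cV[R]_n.+1 -> \bar R) (A : 'M[R]_n.+1) :
  measurable_fun setT (F : mcol R n.+1 -> \bar R) -> (forall y, (0 <= F y)%E) ->
  A \in unitmx ->
  Jint (std_basis R n.+1) (fun y => F (A *m y)) 0 =
  ((`|\det A|^-1)%:E * Jint (std_basis R n.+1) F 0)%E.
Proof.
move=> mF F0 uA.
rewrite -Jint_mulmx mulmx0.
have -> : [seq A *m v | v <- std_basis R n.+1] = [seq col j A | j <- enum 'I_n.+1].
  by rewrite -map_comp; apply/eq_in_map => j _ /=; rewrite colE.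
have := cormen_lup_correct A; have := cormen_lup_detL A; have := cormen_lup_lower A.
have := cormen_lup_upper A; have := cormen_lup_perm A.
case: cormen_lup => [[P L] U] /= /is_perm_mxP[s Ps] Uup Llow dL PA.
have AE : A = perm_mx (s^-1)%g *m L *m U.
  have PA' : P *m A = L *m U by [].
  by rewrite -mulmxA -PA' Ps mulmxA -perm_mxM mulVg perm_mx1 mul1mx.
have dU : \det U = \prod_i U i i.
  rewrite -det_tr det_trig; first by apply: eq_bigr => i _; rewrite mxE.
  by apply/is_trig_mxP => i j ij; rewrite mxE Uup.
have dA : `|\det A| = \prod_i `|U i i|.
  rewrite AE !det_mulmx dL mulr1 det_perm normrM normr_sign mul1r dU.
  by rewrite normr_prod.
have dA0 : \det A != 0 by rewrite -unitfE -unitmxE.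
have Ud i : U i i != 0.
  have : \prod_i `|U i i| != 0 by rewrite -dA normr_eq0.
  by rewrite (bigD1 i)//= mulf_eq0 negb_or normr_eq0 => /andP[].
have := @Jfam_upper _ _ F mF F0 (perm_mx (s^-1)%g *m L) U 0 (fun i j => Uup i j) Ud.
rewrite -AE /Jfam => ->.
have := @Jfam_lower _ _ F mF F0 (perm_mx (s^-1)%g) L 0 (fun i j => Llow i j).
rewrite /Jfam => ->.
have := @Jfam_perm _ _ F mF F0 (s^-1)%g 0; rewrite /Jfam => ->.
by rewrite dA prodfV.
Qed.

(** * Square function estimate *)

Section measurable_inverse.
Context (d : measure_display) (S : measurableType d) (R : realType).

Lemma measurable_invr (f : S -> R) : measurable_fun setT f ->
  measurable_fun setT (fun s => (f s)^-1).
Proof.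
move=> mf.
(* Writes the inverse through the measurable [powR]; the convention [0^-1 = 0] covers the zeros of
   [f]. *)
have -> : (fun s => (f s)^-1) = (fun s => f s * ((`|f s| `^ (-1)) ^+ 2)).
  apply/funext => s; rewrite powR_inv1// exprVn real_normK ?num_real//.
  have [->|f0] := eqVneq (f s) 0; first by rewrite invr0 mul0r.
  by field.
apply: measurable_funM => //; apply: measurable_funX.
apply: (@measurableT_comp _ _ _ _ _ _ (@powR R ^~ (-1)) setT (fun s => `|f s|)).
  exact: measurable_powR.
exact: measurableT_comp.
Qed.

End measurable_inverse.

(* With [k s] and [q s] the mean squares of the first and second differences at scale [sqrt s],
   divided by [s ^ 2], [qk] is the parallelogram inequality between the scales [sqrt s] and
   [2 sqrt s]; the integrals of [k] telescope and only the top scale survives. *)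
Section dyadic_telescope.
Context (R : realType).
Local Notation mu := (@lebesgue_measure R).
Local Open Scope ereal_scope.
Variables (k q : R -> \bar R) (b C : R).
Hypotheses (b0 : (0 < b)%R) (mk : measurable_fun setT k) (mq : measurable_fun setT q).
Hypotheses (k0 : forall s, 0 <= k s) (q0 : forall s, 0 <= q s).
Hypothesis kC : forall s, (0 < s)%R -> k s <= (C / s)%:E.
Hypothesis qk : forall s, (0 < s <= b)%R -> q s + 16%:E * k (4 * s)%R <= 4%:E * k s.

(** The 16 is the ratio of the weights [s ^- 2] at [s] and [4 s]. The Jacobian takes a factor 4 of
    it and leaves the 4 standing on the right of [qk]; this equality is what makes the integrals
    cancel. *)
Let int_scale4 (a c : R) :
  16%:E * (\int[mu]_(s in `]a, c]) k (4 * s)%R) = 4%:E * (\int[mu]_(s in `](4 * a)%R, (4 * c)%R]) k s).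
Proof.
rewrite integral_mkcond [in RHS]integral_mkcond.
have -> : ((fun s => k (4 * s)%R) \_ `]a, c]) =
    (fun s => (k \_ `](4 * a)%R, (4 * c)%R]) (4 * s + 0)%R).
  apply/funext => s; rewrite /patch !mem_setE !in_itv/= addr0.
  by rewrite !ltr_pM2l// !ler_pM2l.
rewrite (@integral_affine _ (k \_ `](4 * a)%R, (4 * c)%R])).
- by rewrite muleA -EFinM; congr (_%:E * _); rewrite normr_nat; field.
- by rewrite pnatr_eq0.
- by apply/(measurable_restrictT _ _).1 => //; exact: measurable_funTS.
- by move=> u; exact: erestrict_ge0.
Qed.

Let int_ub (a c : R) : (0 < a)%R -> (a <= c)%R ->
  \int[mu]_(s in `]a, c]) k s <= (C / a * (c - a))%:E.
Proof.
move=> a0 ac.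
have C0 : (0 <= C)%R.
  have := le_trans (k0 1%R) (kC ltr01); by rewrite lee_fin divr1.
apply: (@le_trans _ _ (\int[mu]_(s in `]a, c]) (cst (C / a)%:E) s)).
  apply: le_integral_ge0 => // s; rewrite /= in_itv/= => /andP[as_ _].
  have s0 : (0 < s)%R by exact: lt_trans as_.
  apply: (le_trans (kC s0)); rewrite lee_fin ler_wpM2l// lef_pV2 ?posrE//.
  exact: ltW.
rewrite integral_cst//= lebesgue_measure_itv/= lte_fin.
case: ltP => [_|ca]; first by rewrite -EFinD -EFinM.
by rewrite mule0 lee_fin mulr_ge0 ?subr_ge0// divr_ge0// ltW.
Qed.

Lemma dyadic_telescope : \int[mu]_(s in `]0%R, b]) q s <= (12 * C)%:E.
Proof.
have C0 : (0 <= C)%R.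
  have := le_trans (k0 1%R) (kC ltr01); by rewrite lee_fin divr1.
(* Away from 0 the integrals of [k] are finite and may be cancelled on both sides; the resulting
   bound does not depend on [a]. *)
have H (a : R) : (0 < a)%R -> (4 * a <= b)%R -> \int[mu]_(s in `]a, b]) q s <= (12 * C)%:E.
  move=> a0 ab.
  have mkD D : measurable D -> measurable_fun D k by move=> mD; exact: measurable_funTS.
  have m4 : measurable_fun setT (fun s : R => k (4 * s)%R).
    by apply: (@measurableT_comp _ _ _ _ _ _ k setT (fun s : R => 4 * s)%R) => //; exact: measurable_funM.
  have I1 : \int[mu]_(s in `]a, b]) q s + 16%:E * (\int[mu]_(s in `]a, b]) k (4 * s)%R) <=
      4%:E * (\int[mu]_(s in `]a, b]) k s).
    rewrite -!ge0_integralZl//; last 2 first.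
    - exact: mkD.
    - exact: measurable_funTS.
    rewrite -ge0_integralD//; last 3 first.
    - exact: measurable_funTS.
    - by move=> s _; rewrite mule_ge0.
    - by apply: measurable_funTS; exact: measurable_funeM.
    apply: le_integral_ge0 => s; rewrite /= in_itv/= => /andP[as_ sb].
      by rewrite adde_ge0// mule_ge0.
    by apply: qk; rewrite sb (lt_trans a0).
  rewrite int_scale4 in I1.
  have a4 : (a <= 4 * a)%R by lra.
  (* Only the scales in []a, 4 a]] are not matched by a scale four times as large; there
     [k <= C / a], and the length [3 a] gives [3 C]. *)
  have I2 : \int[mu]_(s in `]a, b]) k s <= (3 * C)%:E + \int[mu]_(s in `](4 * a)%R, (4 * b)%R]) k s.
    rewrite (@itv_bndbnd_setU _ _ (BRight a) (BRight (4 * a)%R) (BRight b))//; last first.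
    rewrite ge0_integral_setU//; last 2 first.
    - by apply: measurable_funTS.
    - rewrite disj_set2E; apply/eqP/seteqP; split => // s /=; rewrite !in_itv/=.
      by move=> [/andP[_ h1] /andP[h2 _]]; move: (lt_le_trans h2 h1); rewrite ltxx.
    apply: leeD.
      apply: (le_trans (int_ub a0 a4)); rewrite lee_fin.
      by rewrite le_eqVlt; apply/orP; left; apply/eqP; field; rewrite gt_eqF.
    apply: ge0_subset_integral => //; first exact: mkD.
    move=> s /=; rewrite !in_itv/= => /andP[-> sb]/=; lra.
  have fin : \int[mu]_(s in `](4 * a)%R, (4 * b)%R]) k s \is a fin_num.
    rewrite ge0_fin_numE; last exact: integral_ge0.
    apply: (le_lt_trans (int_ub (a := 4 * a) (c := 4 * b) _ _)); [lra|lra|exact: ltry].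
  move: I1 I2 fin; set X := \int[mu]_(s in `]a, b]) k s; set Y := \int[mu]_(s in `](4 * a)%R, (4 * b)%R]) k s.
  set Q := \int[mu]_(s in `]a, b]) q s.
  move=> I1 I2 fin; have I3 : Q + 4%:E * Y <= (12 * C)%:E + 4%:E * Y.
    apply: (le_trans I1); apply: (@le_trans _ _ (4%:E * ((3 * C)%:E + Y))).
      by apply: lee_wpmul2l.
    rewrite muleDr ?fin_num_adde_defr//.
    by rewrite -EFinM leeD2r// lee_fin; lra.
  by move: I3; rewrite leeD2rE// fin_numM.
pose F m := `](b / 4 ^+ m.+1)%R, b]%classic.
have bp m : (0 < b / 4 ^+ m.+1)%R by rewrite divr_gt0// exprn_gt0.
have UF : \bigcup_m F m = `]0%R, b]%classic.
  apply/seteqP; split => s /=.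
    by move=> [m _]; rewrite /F /= !in_itv/= => /andP[h ->]; rewrite (lt_trans (bp m)).
  rewrite in_itv/= => /andP[s0 sb].
  have [m hm] : exists m, (b / 4 ^+ m.+1 < s)%R.
    exists (Num.truncn (b / s)).
    rewrite ltr_pdivrMr ?exprn_gt0// mulrC -ltr_pdivrMr//.
    apply: (lt_trans (truncnS_gt _)).
    rewrite -natrX ltr_nat; exact: ltn_expl.
  by exists m => //; rewrite /F /= in_itv/= hm sb.
have ndF : nondecreasing_seq F.
  apply/nondecreasing_seqP => m; apply/subsetPset => s; rewrite /F /= !in_itv/= => /andP[h ->].
  rewrite andbT; apply: le_lt_trans h.
  by rewrite ler_pM2l// lef_pV2 ?posrE ?exprn_gt0// ler_eXn2l// ltr1n.
have cv : \int[mu]_(x in F i) q x @[i --> \oo] --> \int[mu]_(x in \bigcup_i F i) q x.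
  apply: ge0_nondecreasing_set_cvg_integral => // i; first exact: measurable_itv.
  exact: measurable_funTS.
rewrite -UF -(cvg_lim _ cv)//; apply: lime_le; first by apply/cvg_ex; eexists; exact: cv.
apply: nearW => m; apply: H => //.
have -> : (4 * (b / 4 ^+ m.+1) = b / 4 ^+ m)%R.
  by rewrite exprS; field; rewrite expf_neq0.
rewrite ler_pdivrMr ?exprn_gt0// ler_peMr ?(ltW b0)//.
by apply: exprn_ege1; rewrite ler1n.
Qed.

End dyadic_telescope.

Section standard_basis.
Context (R : realType) (n : nat).
Local Notation mu := (@lebesgue_measure R).
Implicit Types (F : 'cV[R]_n -> \bar R).

Lemma Jint_pull (vs : seq 'cV[R]_n) (phi : 'cV[R]_n -> R) F x :
  measurable_fun setT (F : mcol R n -> \bar R) -> (forall y, 0 <= F y)%E ->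
  (forall y, 0 <= phi y) ->
  (forall y v (u : R), v \in vs -> phi (y + u *: v) = phi y) ->
  Jint vs (fun y => (phi y)%:E * F y)%E x = ((phi x)%:E * Jint vs F x)%E.
Proof.
move=> mF F0 phi0; elim: vs x => //= v vs IH x phiE.
rewrite -ge0_integralZl//.
- apply: eq_integral => u _; rewrite IH; first by rewrite phiE ?mem_head.
  by move=> y w t wvs; apply: phiE; rewrite in_cons wvs orbT.
- exact: measurable_Jint_line.
- by move=> u _; exact: Jint_ge0.
- by rewrite lee_fin.
Qed.

Lemma Jint_std_shift F (a : 'cV[R]_n) :
  measurable_fun setT (F : mcol R n -> \bar R) -> (forall y, 0 <= F y)%E ->
  Jint (std_basis R n) F a = Jint (std_basis R n) F 0.
Proof.
move=> mF F0.
have -> : a = \sum_(i <- enum 'I_n) a i 0 *: (delta_mx i 0 : 'cV[R]_n).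
  apply/matrixP => i j; rewrite ord1 summxE big_enum/= (bigD1 i)//= big1 ?addr0.
    by rewrite !mxE !eqxx mulr1.
  by move=> k /negbTE ki; rewrite !mxE eq_sym ki mulr0.
elim: (enum 'I_n) => [|i r IH]; first by rewrite big_nil.
rewrite big_cons addrC Jint_shift//.
by apply: map_f; rewrite mem_enum.
Qed.

Lemma Jint_std_comp_add F (a : 'cV[R]_n) :
  measurable_fun setT (F : mcol R n -> \bar R) -> (forall y, 0 <= F y)%E ->
  Jint (std_basis R n) (fun y => F (y + a)) 0 = Jint (std_basis R n) F 0.
Proof. by move=> mF F0; rewrite Jint_comp_add// add0r Jint_std_shift. Qed.

Lemma measurable_coord i : measurable_fun setT (fun y : mcol R n => (y : 'cV[R]_n) i 0).
Proof. by have /measurable_colP := @measurable_id _ (mcol R n) setT; exact. Qed.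

Lemma measurable_prod_coord (s : seq 'I_n) (f : R -> R) : measurable_fun setT f ->
  measurable_fun setT (fun y : mcol R n => \prod_(i <- s) f ((y : 'cV[R]_n) i 0)).
Proof.
move=> mf; apply: measurable_prod => i _.
exact: (measurableT_comp mf (measurable_coord i)).
Qed.

Lemma Jint_basis_pull (s : seq 'I_n) (i : 'I_n) (f : R -> R) F x : i \notin s ->
  measurable_fun setT (F : mcol R n -> \bar R) -> (forall y, 0 <= F y)%E ->
  (forall t, 0 <= f t) ->
  Jint [seq (delta_mx j 0 : 'cV[R]_n) | j <- s] (fun y => (f (y i 0))%:E * F y)%E x =
  ((f (x i 0)%R)%:E * Jint [seq (delta_mx j 0%R : 'cV[R]_n) | j <- s] F x)%E.
Proof.
move=> is_ mF F0 f0; apply: (Jint_pull (phi := fun y => f (y i 0))) => // y v u.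
move=> /mapP[j js ->]; rewrite !mxE andbT.
suff /negbTE -> : i != j by rewrite mulr0 addr0.
by apply: contraNneq is_ => ->.
Qed.

Lemma Jint_prod (f : R -> R) : measurable_fun setT f -> (forall t, 0 <= f t) ->
  Jint (std_basis R n) (fun y => (\prod_i f (y i 0))%:E) 0 =
  ((\int[mu]_u (f u)%:E) ^+ n)%E.
Proof.
move=> mf f0.
have I0 : (0 <= \int[mu]_u (f u)%:E)%E by apply: integral_ge0 => u _; rewrite lee_fin.
suff H (s : seq 'I_n) (x : 'cV[R]_n) : uniq s -> (forall i, i \in s -> x i 0 = 0) ->
    Jint [seq (delta_mx j 0 : 'cV[R]_n) | j <- s] (fun y => (\prod_(i <- s) f (y i 0))%:E) x =
    ((\int[mu]_u (f u)%:E) ^+ size s)%E.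
  rewrite /std_basis.
  have := H (enum 'I_n) 0 (enum_uniq _); rewrite size_enum_ord => <-.
    by apply: eq_Jint => y; rewrite big_enum.
  by move=> i _; rewrite mxE.
elim: s x => [|i s IH] x; first by move=> _ _ /=; rewrite big_nil.
move=> /= /andP[is_ us] x0.
have -> : (fun y : 'cV[R]_n => (\prod_(j <- i :: s) f (y j 0))%:E) =
    (fun y => (f (y i 0))%:E * (\prod_(j <- s) f (y j 0))%:E)%E.
  by apply/funext => y; rewrite big_cons EFinM.
transitivity (\int[mu]_u ((f u)%:E * (\int[mu]_u (f u)%:E) ^+ size s)%E)%E.
  apply: eq_integral => u _; rewrite Jint_basis_pull//; last 2 first.
  - by apply/measurable_EFinP; exact: measurable_prod_coord.
  - by move=> y; rewrite lee_fin prodr_ge0.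
  rewrite IH//.
    by rewrite !mxE !eqxx mulr1 x0 ?mem_head// add0r.
  move=> j js; rewrite !mxE x0 ?in_cons ?js ?orbT// andbT.
  suff /negbTE -> : j != i by rewrite mulr0 addr0.
  by apply: contraNneq is_ => <-.
rewrite ge0_integralZr//; first exact/esym/expeS.
- by apply/measurable_EFinP.
- by move=> u _; rewrite lee_fin.
- exact: expe_ge0.
Qed.

End standard_basis.

Section square_function.
Context (R : realType) (n : nat).
Local Notation mu := (@lebesgue_measure R).
Implicit Types (y v : 'cV[R]_n).

Lemma measurable_sqrtr : measurable_fun setT (@Num.sqrt R).
Proof. by apply: continuous_measurable_fun => x; exact: sqrt_continuous. Qed.

Definition l1norm y : R := \sum_i `|y i 0|.

Lemma l1norm_ge0 y : 0 <= l1norm y. Proof. exact: sumr_ge0. Qed.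

Lemma ler_l1normD y v : l1norm (y + v) <= l1norm y + l1norm v.
Proof.
by rewrite /l1norm -big_split/=; apply: ler_sum => i _; rewrite mxE ler_normD.
Qed.

Lemma l1normZ (c : R) y : l1norm (c *: y) = `|c| * l1norm y.
Proof. by rewrite /l1norm mulr_sumr; apply: eq_bigr => i _; rewrite mxE normrM. Qed.

Lemma l1norm_le y : l1norm y <= n%:R * `|y|.
Proof.
apply: (le_trans (ler_sum _ (fun i _ => mx_norm_entry y i 0))).
by rewrite sumr_const cardT size_enum_ord mulr_natl.
Qed.

Lemma le_l1norm y : `|y| <= l1norm y.
Proof.
apply: mx_norm_ub; first exact: l1norm_ge0.
by move=> i j; rewrite ord1 /l1norm (bigD1 i)//= lerDl sumr_ge0.
Qed.

Lemma measurable_l1norm : measurable_fun setT (l1norm : mcol R n -> R).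
Proof.
apply: measurable_sum => i; apply: measurableT_comp => //; exact: measurable_coord.
Qed.

Definition laplace (L : R) y : R := expR (- (l1norm y / L)).

Lemma measurable_laplace L : measurable_fun setT (laplace L : mcol R n -> R).
Proof.
apply: (measurableT_comp (@measurable_expR R)).
apply: measurableT_comp => //; apply: measurable_funM => //; exact: measurable_l1norm.
Qed.

Lemma laplace_shift (L : R) y a : 0 < L ->
  laplace L (y + a) <= expR (l1norm a / L) * laplace L y.
Proof.
move=> L0; rewrite -expRD ler_expR -!mulNr -mulrDl ler_pM2r ?invr_gt0//.
have := ler_l1normD (y + a) (- a); rewrite addrK -scaleN1r l1normZ normrN1 mul1r.
lra.
Qed.

Variables (G : 'cV[R]_n -> R) (K : R).
Hypotheses (mG : measurable_fun setT (G : mcol R n -> R)) (K0 : 0 <= K)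
  (lipG : forall y y', `|G y - G y'| <= K * `|y - y'|).

Definition diff2 y v : R := G (y + v) + G (y - v) - 2 * G y.

Lemma measurable_diff2 (d : measure_display) (S : measurableType d) (Y V : S -> mcol R n) :
  measurable_fun setT Y -> measurable_fun setT V ->
  measurable_fun setT (fun s => diff2 (Y s) (V s)).
Proof.
move=> mY mV.
have mN : measurable_fun setT (fun s => - (V s : 'cV[R]_n) : mcol R n).
  have -> : (fun s => - (V s : 'cV[R]_n) : mcol R n) = (fun s => (-1) *: (V s : 'cV[R]_n) : mcol R n).
    by apply/funext => s; rewrite scaleN1r.
  exact: measurable_col_scale.
apply: measurable_funB; last by apply: measurable_funM => //; exact: (measurableT_comp mG).
apply: measurable_funD; apply: (measurableT_comp mG); exact: measurable_col_add.
Qed.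

Variables (L : R) (v : 'cV[R]_n).
Hypothesis L0 : 0 < L.

Let std := std_basis R n.
Let th (u : R) := u * l1norm v / L.
Let dG (u : R) y := G (y + u *: v) - G y.
Let e (u : R) : \bar R := Jint std (fun y => (laplace L y * dG u y ^+ 2)%:E) 0.
Let Z : \bar R := Jint std (fun y => (laplace L y)%:E) 0.

Let lap0 y : 0 <= laplace L y. Proof. exact: expR_ge0. Qed.

Let m_line (u : R) : measurable_fun setT (fun y : mcol R n => (y : 'cV[R]_n) + u *: v : mcol R n).
Proof. exact: measurable_col_add. Qed.

Let mdG u : measurable_fun setT (dG u : mcol R n -> R).
Proof. by apply: measurable_funB => //; exact: (measurableT_comp mG (m_line u)). Qed.

Let e_ub u : 0 <= u -> (e u <= (K ^+ 2 * u ^+ 2 * `|v| ^+ 2)%:E * Z)%E.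
Proof.
move=> u0; rewrite -Jint_mull//; last 2 first.
- by apply/measurable_EFinP; exact: measurable_laplace.
- by rewrite !mulr_ge0// sqr_ge0.
apply: le_Jint => y; first by rewrite lee_fin mulr_ge0// sqr_ge0.
rewrite -EFinM lee_fin mulrC ler_wpM2r// -!exprMn -real_normK ?num_real//.
rewrite ler_sqr ?nnegrE ?mulr_ge0//.
by have := lipG (y + u *: v) y; rewrite addrAC subrr add0r normrZ (ger0_norm u0) mulrA.
Qed.

(** For two consecutive increments [p] and [r] of [G] along [u v], the second difference is [p - r],
    the increment over [2 u] is [p + r], and the squares add up to [2 p^2 + 2 r^2]. Each recentring
    by [u v] costs a factor [expR (th u)]. The tilts are distributed so that the same quantity
    [expR (- th u) * e u] appears at the scales [u] and [2 u], ready for telescoping. *)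
Lemma diff2_parallelogram (u : R) : 0 <= u ->
  ((expR (- 3 * th u))%:E * Jint std (fun y => (laplace L y * diff2 y (u *: v) ^+ 2)%:E) 0
   + (expR (- th (2 * u)))%:E * e (2 * u)%R <= 4%:E * ((expR (- th u))%:E * e u))%E.
Proof.
move=> u0.
have th0 : 0 <= th u by rewrite /th divr_ge0 ?(ltW L0)// mulr_ge0// l1norm_ge0.
have n1u : l1norm (u *: v) / L = th u by rewrite l1normZ ger0_norm.
have n1Nu : l1norm (- (u *: v)) / L = th u.
  by rewrite -scaleNr l1normZ normrN ger0_norm.
pose S' := Jint std (fun y => (laplace L y * (dG u (y + u *: v) - dG u y) ^+ 2)%:E) 0.
pose eA := Jint std (fun y => (laplace L y * dG u (y + u *: v) ^+ 2)%:E) 0.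
have mdG2 : measurable_fun setT (fun y : mcol R n => dG u ((y : 'cV[R]_n) + u *: v)).
  exact: (measurableT_comp (mdG u) (m_line u)).
have mlap := measurable_laplace L.
have S1 : (Jint std (fun y => (laplace L y * diff2 y (u *: v) ^+ 2)%:E) 0 <= (expR (th u))%:E * S')%E.
  rewrite -(@Jint_std_comp_add _ _ _ (u *: v)); last 2 first.
  - apply/measurable_EFinP; apply: measurable_funM => //; apply: measurable_funX.
    exact: measurable_diff2.
  - by move=> y; rewrite lee_fin mulr_ge0// sqr_ge0.
  rewrite -Jint_mull ?expR_ge0//; last 2 first.
  - apply/measurable_EFinP; apply: measurable_funM => //; apply: measurable_funX.
    exact: measurable_funB.
  - by move=> y; rewrite lee_fin mulr_ge0// sqr_ge0.
  apply: le_Jint => y; first by rewrite lee_fin mulr_ge0// sqr_ge0.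
  rewrite -EFinM lee_fin [leRHS]mulrA.
  have -> : diff2 (y + u *: v) (u *: v) = dG u (y + u *: v) - dG u y.
    by rewrite /diff2 /dG addrK; ring.
  by rewrite ler_wpM2r ?sqr_ge0// -n1u laplace_shift.
have A1 : (eA <= (expR (th u))%:E * e u)%E.
  rewrite /eA -(@Jint_std_comp_add _ _ _ (- (u *: v))); last 2 first.
  - by apply/measurable_EFinP; apply: measurable_funM => //; apply: measurable_funX.
  - by move=> y; rewrite lee_fin mulr_ge0// sqr_ge0.
  rewrite -Jint_mull ?expR_ge0//; last 2 first.
  - by apply/measurable_EFinP; apply: measurable_funM => //; apply: measurable_funX.
  - by move=> y; rewrite lee_fin mulr_ge0// sqr_ge0.
  apply: le_Jint => y; first by rewrite lee_fin mulr_ge0// sqr_ge0.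
  rewrite -EFinM lee_fin [leRHS]mulrA subrK.
  by rewrite ler_wpM2r ?sqr_ge0// -n1Nu laplace_shift.
have PL : (S' + e (2 * u)%R = 2%:E * eA + 2%:E * e u)%E.
  rewrite /S' /e /eA -!Jint_mull ?ler0n//; last 4 first.
  - by apply/measurable_EFinP; apply: measurable_funM => //; apply: measurable_funX.
  - by move=> y; rewrite lee_fin mulr_ge0// sqr_ge0.
  - by apply/measurable_EFinP; apply: measurable_funM => //; apply: measurable_funX.
  - by move=> y; rewrite lee_fin mulr_ge0// sqr_ge0.
  rewrite -!Jint_add//; last 8 first.
  - by apply: measurable_funeM; apply/measurable_EFinP; apply: measurable_funM => //; apply: measurable_funX.
  - by move=> y; rewrite -EFinM lee_fin mulr_ge0// mulr_ge0// sqr_ge0.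
  - by apply: measurable_funeM; apply/measurable_EFinP; apply: measurable_funM => //; apply: measurable_funX.
  - by move=> y; rewrite -EFinM lee_fin mulr_ge0// mulr_ge0// sqr_ge0.
  - apply/measurable_EFinP; apply: measurable_funM => //; apply: measurable_funX.
    exact: measurable_funB.
  - by move=> y; rewrite lee_fin mulr_ge0// sqr_ge0.
  - by apply/measurable_EFinP; apply: measurable_funM => //; apply: measurable_funX.
  - by move=> y; rewrite lee_fin mulr_ge0// sqr_ge0.
  apply: eq_Jint => y; rewrite -!EFinM -!EFinD; congr EFin.
  have -> : dG (2 * u) y = dG u (y + u *: v) + dG u y.
    by rewrite /dG mulrDl mul1r scalerDl addrA; ring.
  ring.
have th2 : th (2 * u) = 2 * th u by rewrite /th; ring.
have e0 w : (0 <= e w)%E by apply: Jint_ge0 => y; rewrite lee_fin mulr_ge0// sqr_ge0.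
apply: (@le_trans _ _ ((expR (- 2 * th u))%:E * (S' + e (2 * u)%R))%E).
  rewrite ge0_muleDr//; last first.
    by apply: Jint_ge0 => y; rewrite lee_fin mulr_ge0// sqr_ge0.
  apply: leeD; last by rewrite th2 mulNr.
  have -> : (- 2 * th u) = - 3 * th u + th u by ring.
  by rewrite expRD EFinM -muleA lee_wpmul2l ?lee_fin ?expR_ge0.
rewrite PL.
apply: (@le_trans _ _ ((expR (- 2 * th u))%:E * ((2 * expR (th u) + 2)%:E * e u))%E).
  rewrite lee_wpmul2l ?lee_fin ?expR_ge0// [(2 * expR (th u) + 2)%:E]EFinD.
  rewrite (@ge0_muleDl R (e u) (2 * expR (th u))%:E 2%:E) ?lee_fin ?mulr_ge0 ?expR_ge0//.
  by apply: leeD => //; rewrite EFinM -muleA; apply: lee_wpmul2l.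
rewrite !muleA -!EFinM lee_wpmul2r// lee_fin.
have -> : - 2 * th u = - th u + - th u by ring.
rewrite expRD -mulrA (mulrC 4) ler_wpM2l ?expR_ge0// mulrDr mulrCA -expRD addNr expR0.
have : expR (- th u) <= 1 by rewrite -expR0 ler_expR oppr_le0.
lra.
Qed.

Let m_sq (S : R -> 'cV[R]_n -> R) :
  measurable_fun setT (fun p : R * mcol R n => S p.1 p.2) ->
  measurable_fun setT (fun s => Jint std (fun y => (laplace L y * S s y ^+ 2)%:E) 0).
Proof.
move=> mS.
pose F s (y : 'cV[R]_n) : \bar R := (laplace L y * S s y ^+ 2)%:E.
have mF : measurable_fun setT (fun p : R * mcol R n => F p.1 p.2).
  apply/measurable_EFinP; apply: measurable_funM; last exact: measurable_funX.
  exact: (measurableT_comp (measurable_laplace L) measurable_snd).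
have F0 s y : (0 <= F s y)%E by rewrite lee_fin mulr_ge0// sqr_ge0.
apply: (@measurableT_comp _ _ _ _ _ _ _ setT (fun s : R => (s, 0 : mcol R n)) (measurable_Jint std mF F0)).
exact: measurable_fun_pair.
Qed.

Let m_dir : measurable_fun setT (fun p : R * mcol R n => Num.sqrt p.1 *: v : mcol R n).
Proof.
apply: measurable_col_scale => //.
exact: (measurableT_comp measurable_sqrtr measurable_fst).
Qed.

(** Dyadic telescoping in [s], with displacement [Num.sqrt s *: v]. The condition [b <= L ^+ 2]
    keeps displacements within the scale of the kernel, so that [th (Num.sqrt s) <= l1norm v] and
    all tilts are controlled by the single constant [expR (3 * l1norm v)]. *)
Lemma square_function (b : R) : 0 < b -> b <= L ^+ 2 -> Z \is a fin_num ->
  (\int[mu]_(s in `]0%R, b])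
     ((s ^+ 2)^-1%:E * Jint std (fun y => (laplace L y * diff2 y (Num.sqrt s *: v) ^+ 2)%:E) 0)
   <= (12 * expR (3 * l1norm v) * K ^+ 2 * `|v| ^+ 2)%:E * Z)%E.
Proof.
move=> b0 bL Zfin.
have Z0 : (0 <= Z)%E by apply: Jint_ge0 => y; rewrite lee_fin.
pose Sq s := Jint std (fun y => (laplace L y * diff2 y (Num.sqrt s *: v) ^+ 2)%:E) 0.
pose c := expR (- 3 * l1norm v).
pose k s := (((s ^+ 2)^-1 * expR (- th (Num.sqrt s)))%:E * e (Num.sqrt s))%E.
pose q s := (((s ^+ 2)^-1 * c)%:E * Sq s)%E.
have e0 w : (0 <= e w)%E by apply: Jint_ge0 => y; rewrite lee_fin mulr_ge0// sqr_ge0.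
have Sq0 s : (0 <= Sq s)%E by apply: Jint_ge0 => y; rewrite lee_fin mulr_ge0// sqr_ge0.
have minv2 : measurable_fun setT (fun s : R => (s ^+ 2)^-1).
  by apply: measurable_invr; exact: measurable_funX.
have mSq : measurable_fun setT Sq.
  apply: (m_sq (S := fun s y => diff2 y (Num.sqrt s *: v))).
  by apply: measurable_diff2 => //; exact: measurable_snd.
have me : measurable_fun setT (fun s : R => e (Num.sqrt s)).
  apply: (m_sq (S := fun s y => dG (Num.sqrt s) y)).
  apply: measurable_funB; last exact: (measurableT_comp mG measurable_snd).
  by apply: (measurableT_comp mG); apply: measurable_col_add => //; exact: measurable_snd.
have mth : measurable_fun setT (fun s : R => expR (- th (Num.sqrt s))).
  apply: (measurableT_comp (@measurable_expR R)); apply: measurableT_comp => //.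
  by do 2 apply: measurable_funM => //; exact: measurable_sqrtr.
have i20 (s : R) : 0 <= (s ^+ 2)^-1 by rewrite invr_ge0 sqr_ge0.
have := @dyadic_telescope R k q b (K ^+ 2 * `|v| ^+ 2 * fine Z) b0.
have mk : measurable_fun setT k.
  by apply: emeasurable_funM => //; apply/measurable_EFinP; exact: measurable_funM.
have mq : measurable_fun setT q.
  by apply: emeasurable_funM => //; apply/measurable_EFinP; exact: measurable_funM.
have k0 s : (0 <= k s)%E by rewrite mule_ge0// lee_fin mulr_ge0// expR_ge0.
have q0 s : (0 <= q s)%E by rewrite mule_ge0// lee_fin mulr_ge0// expR_ge0.
move=> /(_ mk mq k0 q0) H.
have kC s : 0 < s -> (k s <= (K ^+ 2 * `|v| ^+ 2 * fine Z / s)%:E)%E.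
  move=> s0; rewrite /k.
  apply: (@le_trans _ _ (((s ^+ 2)^-1)%:E * ((K ^+ 2 * Num.sqrt s ^+ 2 * `|v| ^+ 2)%:E * Z))%E).
    apply: lee_pmul => //; last exact: e_ub.
    - by rewrite lee_fin mulr_ge0// expR_ge0.
    - rewrite lee_fin ler_piMr// -expR0 ler_expR oppr_le0.
      by rewrite /th divr_ge0 ?(ltW L0)// mulr_ge0// l1norm_ge0.
  rewrite -(fineK Zfin) -!EFinM lee_fin sqr_sqrtr ?(ltW s0)//=.
  by rewrite le_eqVlt; apply/orP; left; apply/eqP; field; rewrite gt_eqF.
have qk s : 0 < s <= b -> (q s + 16%:E * k (4 * s)%R <= 4%:E * k s)%E.
  move=> /andP[s0 sb].
  have := diff2_parallelogram (sqrtr_ge0 s).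
  have r4 : Num.sqrt (4 * s) = 2 * Num.sqrt s.
    rewrite sqrtrM//; congr (_ * _).
    by rewrite (_ : 4 = 2 ^+ 2) ?sqrtr_sqr ?normr_nat//; ring.
  rewrite /q /k r4 => PL.
  apply: (@le_trans _ _ (((s ^+ 2)^-1)%:E * ((expR (- 3 * th (Num.sqrt s)))%:E * Sq s +
     (expR (- th (2 * Num.sqrt s)))%:E * e (2 * Num.sqrt s)%R))%E); last first.
    apply: (le_trans (lee_wpmul2l _ PL)); first by rewrite lee_fin.
    by rewrite [X in (X <= _)%E]muleCA [((s ^+ 2)^-1 * expR _)%:E]EFinM -[(_ * _ * e _)%E]muleA.
  rewrite ge0_muleDr//; try by rewrite mule_ge0// lee_fin expR_ge0.
  rewrite !muleA -!EFinM; apply: leeD.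
    apply: lee_wpmul2r => //; rewrite lee_fin ler_wpM2l// ler_expR.
    rewrite !mulNr lerN2 ler_wpM2l// /th mulrAC ler_piMl ?l1norm_ge0//.
    rewrite ler_pdivrMr// mul1r -[leRHS]gtr0_norm// -sqrtr_sqr.
    by rewrite ler_wsqrtr// (le_trans sb).
  apply: lee_wpmul2r => //; rewrite lee_fin le_eqVlt; apply/orP; left; apply/eqP.
  by field; rewrite gt_eqF.
have {}H := H kC qk.
rewrite -(@lee_pmul2l _ c%:E) ?lte_fin ?expR_gt0//.
rewrite -ge0_integralZl//; last 3 first.
- apply: measurable_funTS; apply: emeasurable_funM => //.
  exact/measurable_EFinP.
- by move=> s _; apply: mule_ge0; rewrite ?lee_fin ?i20//; exact: Sq0.
- by rewrite lee_fin expR_ge0.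
apply: (@le_trans _ _ (\int[mu]_(s in `]0%R, b]) q s)%E).
  rewrite le_eqVlt; apply/orP; left; apply/eqP; apply: eq_integral => s _.
  by rewrite /q muleA -EFinM mulrC.
apply: (le_trans H).
rewrite -(fineK Zfin) -!EFinM lee_fin /c.
have E1 : expR (- 3 * l1norm v) * expR (3 * l1norm v) = 1.
  by rewrite -expRD mulNr addNr expR0.
rewrite le_eqVlt; apply/orP; left; apply/eqP.
rewrite [RHS](_ : _ = 12 * (expR (- 3 * l1norm v) * expR (3 * l1norm v)) * K ^+ 2 * `|v| ^+ 2 * fine Z).
  by rewrite E1; ring.
by ring.
Qed.

End square_function.

(** * Gaussian vectors and Laplace kernels *)

Section density.
Context (d : measure_display) (Om : measurableType d) (R : realType) (P : probability Om R).
Local Notation mu := (@lebesgue_measure R).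
Variables (X : Om -> R) (p : R -> R).
Hypotheses (mX : measurable_fun setT X) (mp : measurable_fun setT p) (p0 : forall u, 0 <= p u).
Hypothesis lawX : forall A : set R, measurable A ->
  P (X @^-1` A) = (\int[mu]_(u in A) (p u)%:E)%E.
Import HBNNSimple.

Let pkX : {mfun Om >-> R} := HB.pack X (isMeasurableFun.Build _ _ _ _ _ mX).
Let nu : probability R R := distribution P pkX.

Let nu_sfun (f : {nnsfun R >-> R}) :
  (\int[nu]_u (f u)%:E = \int[mu]_u ((f u)%:E * (p u)%:E))%E.
Proof.
have mfR (h : R -> R) : measurable_fun [set: R] h -> measurable_fun [set: measurableTypeR R] h by [].
have mE r : measurable (f @^-1` [set r] : set R) by [].
have m1 r : measurable_fun [set: measurableTypeR R] (fun x => r * \1_(f @^-1` [set r]) x).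
  by apply: mfR; apply: measurable_funM => //; exact: measurable_indic.
have m2 r : measurable_fun [set: measurableTypeR R] (fun x => \1_(f @^-1` [set r]) x : R).
  by apply: mfR; exact: measurable_indic.
under [LHS]eq_integral do rewrite fimfunE -fsumEFin//.
rewrite [LHS]ge0_integral_fsum//; last 2 first.
- by move=> r; apply/measurable_EFinP; exact: m1.
- by move=> r u _; rewrite EFinM nnfun_muleindic_ge0.
under [RHS]eq_integral.
  move=> u _; rewrite fimfunE -fsumEFin// ge0_mule_fsuml; last first.
    by move=> r; rewrite EFinM nnfun_muleindic_ge0.
  over.
rewrite [RHS]ge0_integral_fsum//; last 2 first.
- move=> r; apply: emeasurable_funM; last exact/measurable_EFinP.
  by apply/measurable_EFinP; exact: m1.
- move=> r u _; rewrite mule_ge0//; last by rewrite lee_fin.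
  by rewrite EFinM nnfun_muleindic_ge0.
apply: eq_fsbigr => r _.
have [r0|r0] := ltP r 0.
  have -> : f @^-1` [set r] = set0.
    apply/seteqP; split => // u /= fr; have : 0 <= f u by [].
    by rewrite fr leNgt r0.
  under eq_integral do rewrite indic0 mulr0.
  rewrite integral0; under eq_integral do rewrite indic0 mulr0 mul0e.
  by rewrite integral0.
under eq_integral do rewrite EFinM.
rewrite ge0_integralZl//; last by apply/measurable_EFinP; exact: m2.
rewrite integral_indic// setIT.
under [RHS]eq_integral do rewrite EFinM -muleA.
rewrite ge0_integralZl//; last 2 first.
- apply: emeasurable_funM; last exact/measurable_EFinP.
  by apply/measurable_EFinP; exact: m2.
- by move=> u _; rewrite mule_ge0// lee_fin.
congr (_ * _)%E.
transitivity (P (X @^-1` (f @^-1` [set r])) : \bar R); first by [].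
rewrite lawX// [LHS]integral_mkcond; apply: eq_integral => u _.
by rewrite patchE indicE; case: ifP => _; rewrite ?mul1e ?mul0e.
Qed.

(** The law is prescribed on sets only; it extends to simple functions by linearity and to [F] by
    monotone convergence. *)
Lemma density_integral (F : R -> \bar R) :
  measurable_fun setT F -> (forall u, 0 <= F u)%E ->
  (\int[P]_w F (X w) = \int[mu]_u ((p u)%:E * F u))%E.
Proof.
move=> mF F0.
have -> : (\int[P]_w F (X w) = \int[nu]_u F u)%E.
  by rewrite ge0_integral_pushforward// preimage_setT.
pose f_ := nnsfun_approx measurableT mF.
have cvf u : (f_ n u)%:E @[n --> \oo] --> F u by exact: cvg_nnsfun_approx.
transitivity (limn (fun n => \int[nu]_u (f_ n u)%:E)%E).
  rewrite -monotone_convergence//.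
  - by apply: eq_integral => u _; apply/esym/cvg_lim => //; exact: cvf.
  - by move=> n; exact/measurable_EFinP.
  - by move=> n u _; rewrite lee_fin.
  - by move=> u _ m n mn; rewrite lee_fin; exact/lefP/nd_nnsfun_approx.
under eq_fun do rewrite nu_sfun.
rewrite -monotone_convergence//.
- apply: eq_integral => u _; apply/cvg_lim => //; rewrite muleC.
  by apply: cvgeZr => //; exact: cvf.
- move=> n; apply: emeasurable_funM; last exact/measurable_EFinP.
  have mfn : measurable_fun [set: R] (f_ n) by [].
  by apply/measurable_EFinP; exact: mfn.
- by move=> n u _; rewrite mule_ge0// lee_fin.
- move=> u _ m n mn; rewrite lee_wpmul2r ?lee_fin//.
  by have /lefP H := nd_nnsfun_approx measurableT mF mn; exact: H.
Qed.

End density.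

Section family_type.
Context (d : measure_display) (Om : measurableType d) (R : realType).
Variables (I : Type) (D : set I) (X : I -> Om -> R).

Definition fam_gen : set (set Om) :=
  [set E | exists i A, [/\ D i, measurable A & E = X i @^-1` A]].

(* On this type every measurable map depends on the family only, so that independence from the
   family becomes independence of two random elements. *)
Definition famT := g_sigma_algebraType fam_gen.
HB.instance Definition _ := Measurable.on famT.

Lemma measurable_famT (i : I) : D i -> measurable_fun setT (X i : famT -> R).
Proof.
by move=> Di _ A mA; rewrite setTI; apply: sub_sigma_algebra; exists i, A.
Qed.

Lemma fam_sub : (forall i, D i -> measurable_fun setT (X i)) ->
  forall A, sigma_gen D X A -> measurable A.
Proof.
move=> mX; apply: smallest_sub; first exact: sigma_algebra_measurable.
by move=> _ [i [A [Di mA ->]]]; rewrite -[X in measurable X]setTI; exact: mX.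
Qed.

Lemma measurable_id_famT : (forall i, D i -> measurable_fun setT (X i)) ->
  measurable_fun setT (fun w : Om => w : famT).
Proof. by move=> mX _ A mA; rewrite setTI; exact: fam_sub. Qed.

End family_type.

Section column_law.
Context (d : measure_display) (Om : measurableType d) (R : realType) (P : probability Om R)
  (n : nat).
Local Notation mu := (@lebesgue_measure R).
Variables (X : 'I_n -> Om -> R) (p : R -> R).
Hypotheses (mX : forall i, measurable_fun setT (X i)) (indX : mutually_independent P X).
Hypotheses (mp : measurable_fun setT p) (p0 : forall u, 0 <= p u).
Hypothesis lawX : forall i (A : set R), measurable A ->
  P (X i @^-1` A) = (\int[mu]_(u in A) (p u)%:E)%E.

Let e (i : 'I_n) : 'cV[R]_n := delta_mx i 0.

(** Induction on the coordinates: the first variable is independent of the others, so its density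
    can be integrated separately along its basis vector. Since [x] vanishes on [s], the coordinates
    of the moving point are the integration variables themselves, and the densities can be evaluated
    at it. *)
Lemma column_law_seq (s : seq 'I_n) (F : 'cV[R]_n -> \bar R) (x : 'cV[R]_n) :
  uniq s -> measurable_fun setT (F : mcol R n -> \bar R) -> (forall y, 0 <= F y)%E ->
  (forall i, i \in s -> x i 0 = 0) ->
  (\int[P]_w F (x + \sum_(i <- s) X i w *: e i)%R)%E =
  Jint [seq e i | i <- s] (fun y => (\prod_(i <- s) p (y i 0))%:E * F y)%E x.
Proof.
move=> + mF F0; elim: s x => [|k s IH] x /=.
  move=> _ _; under eq_integral do rewrite big_nil addr0.
  transitivity (F x * P setT)%E; first exact: integral_cst.
  by rewrite probability_setT mule1 big_nil mul1e.
move=> /andP[ks us] x0.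
pose Om1 := famT [set i | i \in s] X.
pose Phi (z : Om1 * R) := F (x + z.2 *: e k + \sum_(i <- s) X i z.1 *: e i).
have msum (S : measurableType _) (Y : S -> Om1) : measurable_fun setT Y ->
    measurable_fun setT (fun z : S => \sum_(i <- s) X i (Y z) *: e i : mcol R n).
  move=> mY; apply/measurable_colP => j.
  under eq_fun do rewrite summxE big_seq_cond.
  (* The test [i \in s] is inserted in the summand because on [Om1] only the variables of index in
     [s] are measurable, whereas the sum rule asks for every [i]. *)
  rewrite (_ : (fun _ => _) = (fun z => \sum_(i <- s) (if i \in s then X i (Y z) * (e i) j 0 else 0))); last first.
    apply/funext => z; rewrite -big_mkcondr/= big_seq_cond; apply: eq_big => [i|i _].
      by rewrite andbT andbb.
    by rewrite mxE.
  apply: (@measurable_sum _ S R setT _ s (fun i z => if i \in s then X i (Y z) * (e i) j 0 else 0)) => i.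
  have [si|_] := boolP (i \in s); last exact: measurable_cst.
  apply: (@measurable_funM _ S R setT (fun z => X i (Y z)) (fun=> (e i) j 0)) => //.
  apply: (@measurableT_comp _ _ _ _ _ _ (X i : Om1 -> R) setT Y) => //.
  exact: measurable_famT.
have mPhi : measurable_fun setT Phi.
  apply: (measurableT_comp mF); apply: measurable_col_add; last exact: msum.
  apply: measurable_col_add => //; apply: measurable_col_scale => //.
have mid : measurable_fun setT (fun w : Om => w : Om1).
  by apply: measurable_id_famT => i _; exact: mX.
have ind A B : measurable (A : set Om1) -> measurable (B : set R) ->
    P ((fun w => w : Om1) @^-1` A `&` X k @^-1` B) =
    (P ((fun w => w : Om1) @^-1` A) * P (X k @^-1` B))%E.
  move=> mA mB; exact: (mutual_indep_past mX indX ks mB mA).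
have := @indep_integral _ _ _ Om Om1 R R P _ _ mid (mX k) ind Phi mPhi (fun=> F0 _).
rewrite /Phi /= => E.
transitivity (\int[P]_w F (x + X k w *: e k + \sum_(i <- s) X i w *: e i)%R)%E.
  by apply: eq_integral => w _; rewrite big_cons addrA.
rewrite E.
have mFw w1 : measurable_fun setT (fun u : R => F (x + u *: e k + \sum_(i <- s) X i w1 *: e i)).
  apply: (measurableT_comp mF (g := fun u : R => x + u *: e k + \sum_(i <- s) X i w1 *: e i : mcol R n)).
  by apply: measurable_col_add => //; apply: measurable_col_add => //; exact: measurable_col_scale.
under eq_integral => w1 _.
  rewrite (density_integral (mX k) mp p0 (lawX k) (mFw w1)); last by move=> u; exact: F0.
  over.
pose h (z : Om * measurableTypeR R) :=
  ((p z.2)%:E * F (x + (z.2 : R) *: e k + \sum_(i <- s) X i z.1 *: e i)%R)%E.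
have mh : measurable_fun setT h.
  apply: emeasurable_funM.
    apply/measurable_EFinP; apply: (measurableT_comp mp (g := fun z : Om * measurableTypeR R => (z.2 : R))).
    exact: measurable_snd.
  apply: (measurableT_comp mPhi (g := fun z : Om * measurableTypeR R => (z.1 : Om1, z.2 : R))).
  apply: measurable_fun_pair; last exact: measurable_snd.
  exact: (measurableT_comp mid measurable_fst).
rewrite (fubini_tonelli (m1 := P) (m2 := mu) h mh); last first.
  by move=> z; rewrite mule_ge0// lee_fin.
have mprod : measurable_fun setT (fun y : mcol R n => ((\prod_(i <- s) p ((y : 'cV[R]_n) i 0))%:E * F y)%E).
  by apply: emeasurable_funM => //; apply/measurable_EFinP; exact: measurable_prod_coord.
apply: eq_integral => u _; rewrite /h /=.
rewrite ge0_integralZl//; last 2 first.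
- apply: (measurableT_comp mPhi (g := fun w : Om => (w : Om1, u : R))).
  exact: measurable_fun_pair.
- by rewrite lee_fin.
rewrite IH//; last first.
  move=> j js; rewrite !mxE x0 ?in_cons ?js ?orbT// andbT.
  suff /negbTE -> : j != k by rewrite mulr0 addr0.
  by apply: contraNneq ks => <-.
have -> : (p u = p ((x + u *: e k) k 0))%R.
  by rewrite !mxE !eqxx mulr1 x0 ?mem_head// add0r.
rewrite -Jint_basis_pull//; last by move=> y; rewrite mule_ge0// lee_fin prodr_ge0.
by apply: eq_Jint => y; rewrite big_cons EFinM muleA.
Qed.

Lemma column_law (F : 'cV[R]_n -> \bar R) :
  measurable_fun setT (F : mcol R n -> \bar R) -> (forall y, 0 <= F y)%E ->
  (\int[P]_w F (\col_i X i w)%R)%E =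
  Jint (std_basis R n) (fun y => (\prod_i p (y i 0))%:E * F y)%E 0.
Proof.
move=> mF F0.
have := @column_law_seq (enum 'I_n) F 0 (enum_uniq _) mF F0 (fun i _ => mxE _ _ _ _).
rewrite /std_basis => E.
transitivity (Jint [seq e i | i <- enum 'I_n]
    (fun y : 'cV_n => ((\prod_(i <- enum 'I_n) p (y i 0))%:E * F y)%E) 0).
  rewrite -E; apply: eq_integral => w _; congr F; apply/matrixP => i j.
  rewrite ord1 mxE add0r summxE big_enum/= (bigD1 i)//= big1 ?addr0.
    by rewrite !mxE !eqxx mulr1.
  by move=> k /negbTE ki; rewrite !mxE eq_sym ki mulr0.
by apply: eq_Jint => y; rewrite big_enum.
Qed.

End column_law.

(** * Domination of Gaussian densities by Laplace kernels *)

Section gaussian_bounds.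
Context (R : realType).
Local Notation mu := (@lebesgue_measure R).

(** Cube of [1 + v^2 <= 12 * (1 + v^2 / 12)]. Half of the Gaussian exponent is spent on the
    polynomial. *)
Lemma cube_le_expR (v : R) : (1 + v ^+ 2) ^+ 3 <= 12 ^+ 3 * expR (v ^+ 2 / 4).
Proof.
have v0 := sqr_ge0 v.
have H : 1 + v ^+ 2 / 4 / 3 <= expR (v ^+ 2 / 4 / 3) by exact: expR_ge1Dx.
have -> : expR (v ^+ 2 / 4) = expR (v ^+ 2 / 4 / 3) ^+ 3.
  by rewrite -expRM_natl; congr expR; field.
rewrite -exprMn.
rewrite ler_pXn2r// ?nnegrE; [|lra|by rewrite mulr_ge0// expR_ge0].
lra.
Qed.

(** The remaining exponent [v^2 / 4] yields any exponential rate, by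
    [lam |v| <= v^2 / 4 + lam^2]. *)
Lemma gauss_le_exp (lam v : R) :
  (1 + v ^+ 2) ^+ 3 * expR (- (v ^+ 2 / 2)) <= 12 ^+ 3 * expR (lam ^+ 2) * expR (- (lam * `|v|)).
Proof.
apply: (@le_trans _ _ (12 ^+ 3 * expR (v ^+ 2 / 4) * expR (- (v ^+ 2 / 2)))).
  by rewrite ler_wpM2r ?expR_ge0// cube_le_expR.
rewrite -mulrA -[leRHS]mulrA; apply: ler_wpM2l; first by rewrite exprn_ge0.
rewrite -!expRD ler_expR.
have := sqr_ge0 (`|v| / 2 - lam); rewrite sqrrB exprMn real_normK ?num_real//.
have -> : (2^-1 : R) ^+ 2 = 4^-1 by field.
have -> : `|v| / 2 * lam *+ 2 = lam * `|v| by rewrite -mulr_natr; field.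
lra.
Qed.

Lemma normal_pdf_le (r lam u : R) : 0 < r ->
  (1 + u ^+ 2 / r) ^+ 3 * normal_pdf 0 (Num.sqrt r) u <=
  12 ^+ 3 * expR (lam ^+ 2) * ((Num.sqrt r)^-1 * expR (- (`|u| * lam / Num.sqrt r))).
Proof.
move=> r0; have sr0 : 0 < Num.sqrt r by rewrite sqrtr_gt0.
have rE : r = Num.sqrt r ^+ 2 by rewrite sqr_sqrtr// ltW.
rewrite normal_pdfE ?gt_eqF// /normal_fun /normal_peak subr0.
have pk : (Num.sqrt (Num.sqrt r ^+ 2 * pi *+ 2))^-1 <= (Num.sqrt r)^-1.
  rewrite lef_pV2 ?posrE ?sqrtr_gt0//.
    apply: ler_wsqrtr; rewrite {1}rE -mulr_natr -mulrA ler_peMr ?sqr_ge0//.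
    have := pi_ge2 R; lra.
  by rewrite mulrn_wgt0// mulr_gt0 ?pi_gt0// exprn_gt0.
pose v := u / Num.sqrt r.
have vE : u ^+ 2 / r = v ^+ 2 by rewrite /v exprMn exprVn -rE.
have v2E : - u ^+ 2 / (Num.sqrt r ^+ 2 *+ 2) = - (v ^+ 2 / 2).
  by rewrite -rE -vE -mulr_natr; field; rewrite gt_eqF.
have vN : `|u| * lam / Num.sqrt r = lam * `|v|.
  by rewrite /v normrM normfV (gtr0_norm sr0) mulrAC mulrC.
rewrite vE v2E vN mulrCA [leRHS]mulrCA; apply: ler_pM => //.
- by rewrite mulr_ge0 ?expR_ge0// exprn_ge0// addr_ge0// sqr_ge0.
- exact: gauss_le_exp.
Qed.

Lemma integral_exp_norm_fin : (\int[mu]_u (expR (- `|u|))%:E)%E \is a fin_num.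
Proof.
have e0 (u : R) : (0 <= (expR (- `|u|))%:E :> \bar R)%E by rewrite lee_fin expR_ge0.
have mpdf := @measurable_exponential_pdf R 1.
have mpdfN : measurable_fun setT (fun u : R => exponential_pdf 1 (-1 * u + 0)).
  apply: (measurableT_comp mpdf (g := fun u : R => -1 * u + 0)).
  by apply: measurable_funD => //; exact: measurable_funM.
rewrite ge0_fin_numE; last by apply: integral_ge0 => u _.
apply: (@le_lt_trans _ _ (\int[mu]_u ((exponential_pdf 1 u)%:E + (exponential_pdf 1 (-1 * u + 0))%:E))%E).
  apply: le_integral_ge0 => u _ //; rewrite -EFinD lee_fin.
  have pg w : 0 <= exponential_pdf 1 w :> R by apply: exponential_pdf_ge0.
  have [u0|u0] := leP 0 u.
    rewrite ger0_norm// (@exponential_pdfE _ _ u)// mul1r mulN1r lerDl//.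
  rewrite ltr0_norm// (@exponential_pdfE _ _ (-1 * u + 0)); last by rewrite addr0 mulN1r oppr_ge0 ltW.
  by rewrite addr0 mul1r !mulN1r !opprK lerDr.
rewrite ge0_integralD//=; last 4 first.
- by move=> u _; rewrite lee_fin exponential_pdf_ge0.
- exact/measurable_EFinP.
- by move=> u _; rewrite lee_fin exponential_pdf_ge0.
- exact/measurable_EFinP.
rewrite (@integral_affine R (fun u => (exponential_pdf 1 u)%:E) (-1) 0)//; last 2 first.
- exact/measurable_EFinP.
- by move=> u; rewrite lee_fin exponential_pdf_ge0.
by rewrite integral_exponential_pdf// mule1 -EFinD ltry.
Qed.

End gaussian_bounds.

Section laplace_mass.
Context (R : realType) (n : nat).
Local Notation std := (std_basis R n.+1).

Lemma Jint_scale_std (F : 'cV[R]_n.+1 -> \bar R) (c : R) : c != 0 ->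
  measurable_fun setT (F : mcol R n.+1 -> \bar R) -> (forall y, 0 <= F y)%E ->
  Jint std (fun y => F (c *: y)) 0 = ((`|c| ^- n.+1)%:E * Jint std F 0)%E.
Proof.
move=> c0 mF F0.
have uc : (c%:M : 'M[R]_n.+1) \in unitmx by rewrite unitmxE det_scalar unitrX// unitfE.
have := Jint_linear mF F0 uc; rewrite det_scalar normrX => <-.
by apply: eq_Jint => y; rewrite mul_scalar_mx.
Qed.

(* Unlike a Gaussian density, this kernel is comparable to its translates. *)
Definition gl (L : R) (y : 'cV[R]_n.+1) : R := L ^- n.+1 * laplace L y.

Lemma gl_ge0 L y : 0 < L -> 0 <= gl L y.
Proof. by move=> L0; rewrite mulr_ge0 ?expR_ge0// invr_ge0 exprn_ge0// ltW. Qed.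

Lemma measurable_gl L : measurable_fun setT (gl L : mcol R n.+1 -> R).
Proof. apply: measurable_funM => //; exact: measurable_laplace. Qed.

Lemma laplaceE (y : 'cV[R]_n.+1) : laplace 1 y = \prod_i expR (- `|y i 0|).
Proof. by rewrite /laplace divr1 /l1norm -sumrN expR_sum. Qed.

Lemma laplaceZ (L c : R) (y : 'cV[R]_n.+1) : 0 < c -> laplace L (c *: y) = laplace (L / c) y.
Proof.
move=> c0; rewrite /laplace l1normZ gtr0_norm//; congr (expR (- _)).
by rewrite invfM invrK mulrA [RHS]mulrC mulrA.
Qed.

(** The number [2 ^ n.+1], a power of the integral of [exp (- |u|)]. *)
Definition lap_mass : R := fine (Jint std (fun y => (laplace 1 y)%:E) 0).

Lemma Jint_laplace1 : Jint std (fun y => (laplace 1 y)%:E) 0 = lap_mass%:E.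
Proof.
rewrite /lap_mass fineK//.
under eq_Jint do rewrite laplaceE.
rewrite (@Jint_prod R n.+1 (fun u => expR (- `|u|))).
- elim: n.+1 => [//|k IH]; rewrite expeS fin_numM//; exact: integral_exp_norm_fin.
- by apply: (measurableT_comp (@measurable_expR R)); apply: measurableT_comp => //.
- by move=> t; exact: expR_ge0.
Qed.

Lemma lap_mass_ge0 : 0 <= lap_mass.
Proof. by rewrite -lee_fin -Jint_laplace1; apply: Jint_ge0 => y; rewrite lee_fin expR_ge0. Qed.

Lemma Jint_laplace L : 0 < L -> Jint std (fun y => (laplace L y)%:E) 0 = (L ^+ n.+1 * lap_mass)%:E.
Proof.
move=> L0.
have E (y : 'cV[R]_n.+1) : laplace L y = laplace 1 (L^-1 *: y) by rewrite laplaceZ ?invr_gt0// invrK mul1r.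
under eq_Jint do rewrite E.
rewrite (@Jint_scale_std (fun y => (laplace 1 y)%:E)) ?invr_eq0 ?gt_eqF//.
- rewrite Jint_laplace1 -EFinM normfV (gtr0_norm L0); congr (_ * _)%:E.
  by rewrite exprVn invrK.
- by apply/measurable_EFinP; exact: measurable_laplace.
- by move=> y; rewrite lee_fin expR_ge0.
Qed.

Lemma Jint_gl L : 0 < L -> Jint std (fun y => (gl L y)%:E) 0 = lap_mass%:E.
Proof.
move=> L0; under eq_Jint do rewrite EFinM.
rewrite Jint_mull//.
- rewrite Jint_laplace// -EFinM mulrA mulVf ?mul1r//.
  by rewrite expf_neq0// gt_eqF.
- by apply/measurable_EFinP; exact: measurable_laplace.
- by move=> y; rewrite lee_fin expR_ge0.
- by rewrite invr_ge0 exprn_ge0// ltW.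
Qed.

End laplace_mass.

Section gaussian_column.
Context (d : measure_display) (Om : measurableType d) (R : realType) (P : probability Om R)
  (n : nat).
Local Notation std := (std_basis R n.+1).

(** Centred Gaussian column with independent coordinates of variance [r]. The law is encoded by the
    integrals of nonnegative functions, ready for comparison of densities under [Jint]. *)
Definition is_gauss (X : Om -> 'cV[R]_n.+1) (r : R) : Prop :=
  measurable_fun setT (X : Om -> mcol R n.+1) /\
  forall F : 'cV[R]_n.+1 -> \bar R,
    measurable_fun setT (F : mcol R n.+1 -> \bar R) -> (forall y, 0 <= F y)%E ->
    (\int[P]_w F (X w))%E =
    Jint std (fun y => (\prod_i normal_pdf 0 (Num.sqrt r) (y i 0))%:E * F y)%E 0.

Lemma measurable_norm_col : measurable_fun setT (fun y : mcol R n.+1 => `|y : 'cV[R]_n.+1|).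
Proof.
have -> : (fun y : mcol R n.+1 => `|y : 'cV[R]_n.+1|) =
    (fun y : mcol R n.+1 => \big[Order.max/0]_i `|(y : 'cV[R]_n.+1) i 0|).
  apply/funext => y; apply/eqP; rewrite eq_le; apply/andP; split.
    apply: mx_norm_ub; first by apply: bigmax_ge_id.
    by move=> i j; rewrite ord1; apply: (le_bigmax _ (fun i => `|(y : 'cV[R]_n.+1) i 0|) i).
  by apply: bigmax_le => // i _; exact: mx_norm_entry.
rewrite -[X in measurable_fun _ X]/(fun y : mcol R n.+1 => \big[Order.max/0]_(i <- index_enum 'I_n.+1) `|(y : 'cV[R]_n.+1) i 0|).
elim: (index_enum _) => [|i s IH].
  by under eq_fun do rewrite big_nil; exact: measurable_cst.
under eq_fun do rewrite big_cons.
apply: measurable_maxr => //; apply: measurableT_comp => //; exact: measurable_coord.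
Qed.

(** The sup norm is attained at one coordinate and the other factors are at least 1. The polynomial
    weight thus splits over coordinates, like the Gaussian density. *)
Lemma one_norm_prod (r : R) (y : 'cV[R]_n.+1) : 0 < r ->
  1 + `|y| ^+ 2 / r <= \prod_i (1 + y i 0 ^+ 2 / r).
Proof.
move=> r0.
have p1 i : 1 <= 1 + y i 0 ^+ 2 / r by rewrite lerDl divr_ge0 ?sqr_ge0// ltW.
have pp (Q : pred 'I_n.+1) : 1 <= \prod_(i | Q i) (1 + y i 0 ^+ 2 / r).
  by elim/big_ind: _ => // a b a1 b1; rewrite -[1]mulr1 ler_pM.
have [y0|/mx_norm_neq0 [[i j]/= yij]] := eqVneq (mx_norm y) 0.
  by have -> : `|y| = 0 by []; rewrite expr0n/= mul0r addr0.
have -> : `|y| = `|y i j| by [].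
rewrite ord1 real_normK ?num_real// (bigD1 i)//= ler_peMr//.
by rewrite (le_trans _ (p1 i)).
Qed.

(** The comparison is made one coordinate at a time, where every rate [lam] is available; the rate
    is left free because a matrix may still dilate the kernel. *)
Lemma gauss_dominate (X : Om -> 'cV[R]_n.+1) (r lam : R) (F : 'cV[R]_n.+1 -> \bar R) :
  is_gauss X r -> 0 < r -> 0 < lam ->
  measurable_fun setT (F : mcol R n.+1 -> \bar R) -> (forall y, 0 <= F y)%E ->
  (\int[P]_w (((1 + `|X w| ^+ 2 / r) ^+ 3)%:E * F (X w)) <=
   ((12 ^+ 3 * expR (lam ^+ 2) / lam) ^+ n.+1)%:E *
   Jint std (fun y => (gl (Num.sqrt r / lam) y)%:E * F y) 0)%E.
Proof.
move=> [mX gX] r0 l0 mF F0.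
have sr0 : 0 < Num.sqrt r by rewrite sqrtr_gt0.
have c0 : 0 <= 12 ^+ 3 * expR (lam ^+ 2) by rewrite mulr_ge0 ?expR_ge0 ?exprn_ge0.
pose H (y : 'cV[R]_n.+1) := (((1 + `|y| ^+ 2 / r) ^+ 3)%:E * F y)%E.
have H0 (y : 'cV[R]_n.+1) : 0 <= (1 + `|y| ^+ 2 / r) ^+ 3.
  by rewrite exprn_ge0// addr_ge0// divr_ge0 ?sqr_ge0// ltW.
rewrite (gX H); last 2 first.
- apply: emeasurable_funM => //; apply/measurable_EFinP.
  apply: measurable_funX; apply: measurable_funD => //; apply: measurable_funM => //.
  by apply: measurable_funX; exact: measurable_norm_col.
- by move=> y; rewrite mule_ge0// lee_fin.
rewrite -Jint_mull; last 3 first.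
- apply: emeasurable_funM => //; apply/measurable_EFinP; exact: measurable_gl.
- by move=> y; rewrite mule_ge0// lee_fin gl_ge0// divr_gt0.
- by rewrite exprn_ge0// divr_ge0// ltW.
apply: le_Jint => y.
  by rewrite mule_ge0 ?mule_ge0// lee_fin// prodr_ge0// => i _; exact: normal_pdf_ge0.
rewrite /H !muleA -!EFinM lee_wpmul2r// lee_fin.
apply: (@le_trans _ _ (\prod_(i < n.+1) (12 ^+ 3 * expR (lam ^+ 2) * ((Num.sqrt r)^-1 * expR (- (`|y i 0| * lam / Num.sqrt r)))))).
  apply: (@le_trans _ _ (\prod_i ((1 + y i 0 ^+ 2 / r) ^+ 3 * normal_pdf 0 (Num.sqrt r) (y i 0)))).
    rewrite big_split/= mulrC ler_wpM2r//.
      by rewrite prodr_ge0// => i _; exact: normal_pdf_ge0.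
    rewrite prodrXl lerXn2r ?nnegrE//; last exact: one_norm_prod.
      by rewrite addr_ge0// divr_ge0 ?sqr_ge0// ltW.
    by rewrite prodr_ge0// => i _; rewrite addr_ge0// divr_ge0 ?sqr_ge0// ltW.
  apply: ler_prod => i _; rewrite normal_pdf_le// andbT mulr_ge0 ?normal_pdf_ge0//.
  by rewrite exprn_ge0// addr_ge0// divr_ge0 ?sqr_ge0// ltW.
rewrite big_split/= prodr_const card_ord big_split/= prodr_const card_ord -expR_sum /gl /laplace.
have -> : \sum_(i < n.+1) - (`|y i 0| * lam / Num.sqrt r) = - (l1norm y / (Num.sqrt r / lam)).
  rewrite sumrN /l1norm -!mulr_suml; congr (- _).
  by rewrite invfM invrK mulrA mulrAC.
rewrite le_eqVlt; apply/orP; left; apply/eqP.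
rewrite !mulrA -exprVn -!exprMn; congr (_ ^+ _ * _).
by field; rewrite !gt_eqF.
Qed.

End gaussian_column.

Section linear_bounds.
Context (R : realType) (n : nat).

Lemma norm_det_le (B : 'M[R]_n) (c : R) : (forall i j, `|B i j| <= c) ->
  `|\det B| <= n`!%:R * c ^+ n.
Proof.
move=> Bc; apply: (le_trans (ler_norm_sum _ _ _)).
apply: (@le_trans _ _ (\sum_(s : 'S_n) c ^+ n)).
  apply: ler_sum => s _; rewrite normrM normrX normrN1 expr1n mul1r normr_prod.
  apply: (@le_trans _ _ (\prod_(i < n) c)); last by rewrite prodr_const card_ord.
  by apply: ler_prod => i _; rewrite normr_ge0 Bc.
by rewrite sumr_const card_Sn mulr_natl.
Qed.

Lemma l1norm_mulmx (B : 'M[R]_n) (c : R) (y : 'cV[R]_n) : (forall i j, `|B i j| <= c) ->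
  l1norm (B *m y) <= n%:R * c * l1norm y.
Proof.
move=> Bc; rewrite /l1norm.
apply: (@le_trans _ _ (\sum_(i < n) c * l1norm y)); last first.
  by rewrite sumr_const cardT size_enum_ord -mulrA mulr_natl.
apply: ler_sum => i _; rewrite mxE.
apply: (le_trans (ler_norm_sum _ _ _)).
rewrite /l1norm mulr_sumr; apply: ler_sum => j _.
by rewrite normrM ler_wpM2r.
Qed.

End linear_bounds.

Section gaussian_linear.
Context (d : measure_display) (Om : measurableType d) (R : realType) (P : probability Om R)
  (n : nat).
Local Notation std := (std_basis R n.+1).

Lemma measurable_mulmx (B : 'M[R]_n.+1) :
  measurable_fun setT (fun y : mcol R n.+1 => B *m (y : 'cV[R]_n.+1) : mcol R n.+1).
Proof.
apply/measurable_colP => i; under eq_fun do rewrite mxE.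
apply: measurable_sum => j; apply: measurable_funM => //; exact: measurable_coord.
Qed.

(** The Gaussian is dominated at the rate [lam * (n.+1%:R * c)]: the l1 norm of [A y] is at most
    [n.+1%:R * c] times that of [y], so the kernel has rate [lam] in the variable [A y]. The
    Jacobian is the determinant of the inverse, bounded through its entries. *)
Lemma gauss_linear (lam c : R) : 0 < lam -> 0 < c -> exists2 C : R, 0 <= C &
  forall (X : Om -> 'cV[R]_n.+1) (r : R) (A : 'M[R]_n.+1) (F : 'cV[R]_n.+1 -> \bar R),
  is_gauss P X r -> 0 < r -> A \in unitmx -> (forall i j, `|A i j| <= c) ->
  (forall i j, `|invmx A i j| <= c) ->
  measurable_fun setT (F : mcol R n.+1 -> \bar R) -> (forall y, 0 <= F y)%E ->
  (\int[P]_w (((1 + `|X w| ^+ 2 / r) ^+ 3)%:E * F (A *m X w)) <=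
   C%:E * Jint std (fun y => (gl (Num.sqrt r / lam) y)%:E * F y) 0)%E.
Proof.
move=> l0 c0; pose k : R := n.+1%:R * c; pose lam' := lam * k.
have k0 : 0 < k by rewrite mulr_gt0.
have l'0 : 0 < lam' by rewrite mulr_gt0.
pose C1 := (12 ^+ 3 * expR (lam' ^+ 2) / lam') ^+ n.+1.
have C10 : 0 <= C1.
  by rewrite exprn_ge0// divr_ge0 ?(ltW l'0)// mulr_ge0 ?expR_ge0// exprn_ge0.
exists (C1 * (k ^+ n.+1 * (n.+1`!%:R * c ^+ n.+1))).
  by rewrite mulr_ge0// mulr_ge0// ?exprn_ge0 ?(ltW k0)// mulr_ge0// exprn_ge0 ?ltW.
move=> X r A F gX r0 uA Ac iAc mF F0.
have sr0 : 0 < Num.sqrt r by rewrite sqrtr_gt0.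
have L0 : 0 < Num.sqrt r / lam by rewrite divr_gt0.
have mFA : measurable_fun setT ((fun y : 'cV[R]_n.+1 => F (A *m y)) : mcol R n.+1 -> \bar R).
  exact: (measurableT_comp mF (measurable_mulmx A)).
apply: (le_trans (gauss_dominate gX r0 l'0 mFA (fun=> F0 _))).
rewrite EFinM -muleA lee_wpmul2l// ?lee_fin//.
pose H (y : 'cV[R]_n.+1) := ((gl (Num.sqrt r / lam) y)%:E * F y)%E.
have mH : measurable_fun setT (H : mcol R n.+1 -> \bar R).
  by apply: emeasurable_funM => //; apply/measurable_EFinP; exact: measurable_gl.
have H0 y : (0 <= H y)%E by rewrite mule_ge0// lee_fin gl_ge0.
apply: (@le_trans _ _ ((k ^+ n.+1)%:E * Jint std (fun y => H (A *m y)) 0)%E).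
  rewrite -Jint_mull//; last 2 first.
  - exact: (measurableT_comp mH (measurable_mulmx A)).
  - by rewrite exprn_ge0// ltW.
  apply: le_Jint => y; first by rewrite mule_ge0// lee_fin gl_ge0// divr_gt0.
  rewrite /H muleA -EFinM lee_wpmul2r// lee_fin /gl mulrA.
  apply: ler_pM; rewrite ?expR_ge0 ?invr_ge0 ?exprn_ge0 ?divr_ge0 ?sqrtr_ge0 ?(ltW l'0)//.
    rewrite -!exprVn -exprMn le_eqVlt; apply/orP; left; apply/eqP; congr (_ ^+ _).
    by rewrite /lam'; field; rewrite !gt_eqF.
  rewrite /laplace ler_expR lerN2 ler_pdivrMr//.
  apply: (le_trans (l1norm_mulmx y Ac)); rewrite -/k.
  rewrite le_eqVlt; apply/orP; left; apply/eqP.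
  by rewrite /lam'; field; rewrite !gt_eqF.
rewrite (Jint_linear mH H0 uA) EFinM -muleA lee_wpmul2l ?lee_fin ?exprn_ge0 ?(ltW k0)//.
apply: lee_wpmul2r; first exact: Jint_ge0.
rewrite lee_fin -normfV -det_inv; exact: norm_det_le.
Qed.

Lemma gauss_moment : exists2 C : R, 0 <= C &
  forall (X : Om -> 'cV[R]_n.+1) (r : R), is_gauss P X r -> 0 < r ->
  (\int[P]_w ((1 + `|X w| ^+ 2 / r) ^+ 3)%:E <= C%:E)%E.
Proof.
exists ((12 ^+ 3 * expR (1 ^+ 2) / 1) ^+ n.+1 * lap_mass R n).
  by rewrite mulr_ge0 ?lap_mass_ge0// exprn_ge0// divr_ge0// mulr_ge0 ?expR_ge0// exprn_ge0.
move=> X r gX r0.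
have sr0 : 0 < Num.sqrt r / 1 by rewrite divr1 sqrtr_gt0.
have := @gauss_dominate _ _ _ P n X r 1 (fun=> 1%E) gX r0 ltr01 (measurable_cst _) (fun=> lee01).
under eq_integral do rewrite mule1.
under [X in (_ <= _ * X)%E -> _]eq_Jint do rewrite mule1.
by rewrite Jint_gl// EFinM.
Qed.

End gaussian_linear.

Section exchange.
Context (R : realType) (n : nat).
Local Notation mu := (@lebesgue_measure R).

Lemma Jint_tonelli_in (d : measure_display) (S : measurableType d)
    (m : {sigma_finite_measure set S -> \bar R}) (D : set S) (vs : seq 'cV[R]_n)
    (F : S -> 'cV[R]_n -> \bar R) x : measurable D ->
  measurable_fun setT (fun p : S * mcol R n => F p.1 p.2) ->
  (forall s y, 0 <= F s y)%E ->
  (\int[m]_(s in D) Jint vs (F s) x)%E = Jint vs (fun y => \int[m]_(s in D) F s y)%E x.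
Proof.
move=> mD mF F0.
pose F' s y := ((\1_D s : R)%:E * F s y)%E.
have mF' : measurable_fun setT (fun p : S * mcol R n => F' p.1 p.2).
  apply: emeasurable_funM => //; apply/measurable_EFinP.
  have mI : measurable_fun setT (\1_D : S -> R) by exact: measurable_indic.
  exact: (measurableT_comp mI measurable_fst).
have F'0 s y : (0 <= F' s y)%E by rewrite mule_ge0// lee_fin.
have ite (f : S -> \bar R) : (\int[m]_(s in D) f s = \int[m]_s ((\1_D s : R)%:E * f s))%E.
  rewrite integral_mkcond; apply: eq_integral => s _.
  by rewrite patchE indicE; case: ifP => _; rewrite ?mul1e ?mul0e.
rewrite ite; transitivity (\int[m]_s Jint vs (F' s) x)%E.
  apply: eq_integral => s _; rewrite /F' Jint_mull//.
  by apply: (measurableT_comp mF (g := fun y : mcol R n => (s, y))); exact: measurable_fun_pair.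
rewrite Jint_tonelli//; apply: eq_Jint => y; exact/esym/ite.
Qed.

Lemma Jint_exchange (vs ws : seq 'cV[R]_n) (F : 'cV[R]_n -> 'cV[R]_n -> \bar R) x x' :
  measurable_fun setT (fun p : mcol R n * mcol R n => F p.1 p.2) ->
  (forall y v, 0 <= F y v)%E ->
  Jint vs (fun y => Jint ws (F y) x') x = Jint ws (fun v => Jint vs (fun y => F y v) x) x'.
Proof.
move=> mF F0; elim: vs x => //= v0 vs IH x.
under eq_integral do rewrite IH.
have mswap : measurable_fun setT (fun p : mcol R n * mcol R n => F p.2 p.1).
  apply: (measurableT_comp mF (g := fun p : mcol R n * mcol R n => (p.2, p.1))).
  by apply: measurable_fun_pair; [exact: measurable_snd|exact: measurable_fst].
have mJ := measurable_Jint vs mswap (fun v y => F0 y v).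
rewrite (@Jint_tonelli _ _ _ _ mu ws (fun (u : measurableTypeR R) v => Jint vs (fun y => F y v) (x + (u : R) *: v0)))//.
- apply: (measurableT_comp mJ (g := fun p : measurableTypeR R * mcol R n =>
    (p.2, (x + (p.1 : R) *: v0) : mcol R n))).
  apply: measurable_fun_pair; first exact: measurable_snd.
  apply: measurable_col_add => //; apply: measurable_col_scale => //; exact: measurable_fst.
- by move=> u v; exact: Jint_ge0.
Qed.

End exchange.

Section gaussian_square_function.
Context (R : realType) (n : nat).
Local Notation mu := (@lebesgue_measure R).
Local Notation N := n.+1.
Local Notation std := (std_basis R n.+1).

Lemma Jint_gl_scale (s lam : R) (F : 'cV[R]_N -> \bar R) : 0 < s -> 0 < lam ->
  measurable_fun setT (F : mcol R N -> \bar R) -> (forall y, 0 <= F y)%E ->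
  Jint std (fun h => (gl (s / lam) h)%:E * F h)%E 0 =
  Jint std (fun v => (gl lam^-1 v)%:E * F (s *: v))%E 0.
Proof.
move=> s0 l0 mF F0.
pose H (h : 'cV[R]_N) := ((gl (s / lam) h)%:E * F h)%E.
have mH : measurable_fun setT (H : mcol R N -> \bar R).
  by apply: emeasurable_funM => //; apply/measurable_EFinP; exact: measurable_gl.
have H0 h : (0 <= H h)%E by rewrite mule_ge0// lee_fin gl_ge0// divr_gt0.
have sN : s != 0 by rewrite gt_eqF.
have mHs : measurable_fun setT ((fun v => H (s *: v)) : mcol R N -> \bar R).
  apply: (measurableT_comp mH (g := fun v : mcol R N => (s *: (v : 'cV[R]_N)) : mcol R N)).
  exact: measurable_col_scale.
have := Jint_scale_std sN mH H0; rewrite (gtr0_norm s0) => E.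
have -> : Jint std H 0 = ((s ^+ N)%:E * Jint std (fun v => H (s *: v)) 0)%E.
  by rewrite E muleA -EFinM divff ?mul1e// expf_neq0.
rewrite -Jint_mull//; last by rewrite exprn_ge0// ltW.
apply: eq_Jint => v; rewrite /H muleA -EFinM; congr (_%:E * _)%E.
have E1 : s / lam / s = lam^-1 by rewrite mulrAC divff// mul1r.
have E2 : s ^+ N * (s / lam) ^- N = lam^-1 ^- N.
  by rewrite -!exprVn -exprMn invfM mulrA divff// mul1r.
by rewrite /gl laplaceZ// E1 mulrA E2.
Qed.

Variables (K c M T : R).
Hypotheses (K0 : 0 <= K) (c0 : 0 < c).

(** For [w = invmx sg *m v] the square function costs [expR (3 * l1norm w)], and the squared norm of
    [w] at most [expR (2 * l1norm w)]; with [l1norm w <= N%:R * c * l1norm v] this makes the 5. The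
    extra 1 leaves [laplace 1 v], which is integrable. *)
Definition laplace_rate : R := 5 * (N%:R * c) + 1.

Lemma laplace_rate_gt0 : 0 < laplace_rate.
Proof. by rewrite /laplace_rate addr_gt0// mulr_gt0// mulr_gt0. Qed.

Local Notation lam := laplace_rate.

Lemma mulmx_norm_le (B : 'M[R]_N) (y : 'cV[R]_N) : (forall i j, `|B i j| <= c) ->
  `|B *m y| <= N%:R * c * (N%:R * `|y|).
Proof.
move=> Bc; apply: (le_trans (le_l1norm _)); apply: (le_trans (l1norm_mulmx _ Bc)).
by rewrite ler_wpM2l ?l1norm_le// mulr_ge0// ltW.
Qed.

Let KG := K * (N%:R * c * N%:R).

(** The first summand is the square function with frozen drift, the second the price of freezing
    it. *)
Definition square_function_const : R :=
  2 * (12 * KG ^+ 2 * lap_mass R n * (lam ^+ N * lap_mass R n))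
  + 32 * (K * M) ^+ 2 * (lap_mass R n * lap_mass R n) * T.

(** The matrix is absorbed into [G y = g (z0 + sg *m y)] and undone in the displacement by
    [w v = invmx sg *m v]. Base point and displacement then live in the same coordinates, and
    [square_function] applies for each fixed [v]. *)
Lemma gauss_square_function (g : 'cV[R]_N -> R) (x0 b0 : 'cV[R]_N) (sg : 'M[R]_N) (l : R) :
  measurable_fun setT (g : mcol R N -> R) ->
  (forall y y', `|g y - g y'| <= K * `|y - y'|) ->
  `|b0| <= M -> sg \in unitmx -> (forall i j, `|sg i j| <= c) ->
  (forall i j, `|invmx sg i j| <= c) -> 0 < l -> l <= T ->
  (\int[mu]_(s in `]0%R, (l / 2)%R])
    ((s ^+ 2)^-1%:E * Jint std (fun y => (gl (Num.sqrt l) y)%:E *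
      Jint std (fun h => (gl (Num.sqrt s / lam) h)%:E *
         ((diff2 g (x0 + (l - s) *: b0 + sg *m y) h) ^+ 2)%:E) 0%R) 0%R) <= square_function_const%:E)%E.
Proof.
move=> mg lipg b0M usg sgc isgc l0 lT.
have lam0 := laplace_rate_gt0.
have sl0 : 0 < Num.sqrt l by rewrite sqrtr_gt0.
have li0 : 0 < lam^-1 by rewrite invr_gt0.
pose D := `]0%R, (l / 2)%R]%classic : set R.
have mD : measurable (D : set (measurableTypeR R)) by exact: measurable_itv.
(* The drift [(l - s) *: b0] is frozen at [s = 0], so that [G] does not depend on [s]. *)
pose z0 := x0 + l *: b0.
pose G (y : 'cV[R]_N) := g (z0 + sg *m y).
pose w (v : 'cV[R]_N) := invmx sg *m v.
have mw : measurable_fun setT (fun v : mcol R N => w v : mcol R N) by exact: measurable_mulmx.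
have mG : measurable_fun setT (G : mcol R N -> R).
  apply: (measurableT_comp mg (g := fun y : mcol R N => z0 + sg *m (y : 'cV[R]_N) : mcol R N)).
  by apply: measurable_col_add => //; exact: measurable_mulmx.
have KG0 : 0 <= KG by rewrite mulr_ge0// mulr_ge0// mulr_ge0// ltW.
have lipG y y' : `|G y - G y'| <= KG * `|y - y'|.
  apply: (le_trans (lipg _ _)).
  rewrite opprD addrACA subrr add0r -mulmxBr /KG -[leRHS]mulrA ler_wpM2l//.
  by apply: (le_trans (mulmx_norm_le _ sgc)); rewrite !mulrA.
pose m := lap_mass R n.
have m0 : 0 <= m by exact: lap_mass_ge0.
pose Q (s : R) y v := gl (Num.sqrt l) y * gl lam^-1 v * ((s ^+ 2)^-1 * diff2 G y (Num.sqrt s *: w v) ^+ 2).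
have glv0 (v : 'cV[R]_N) : 0 <= gl lam^-1 v by exact: gl_ge0.
have gly0 (y : 'cV[R]_N) : 0 <= gl (Num.sqrt l) y by exact: gl_ge0.
have i20 (s : R) : 0 <= (s ^+ 2)^-1 by rewrite invr_ge0 sqr_ge0.
have Q0 s y v : 0 <= Q s y v.
  by rewrite /Q mulr_ge0// mulr_ge0// sqr_ge0.
(* Freezing the drift moves each of the three points by at most [M s]; with weights 1, 1 and 2 the
   second difference changes by at most [4 K M s]. The constant 32 is [2 * 4 ^ 2], from
   [(x + y)^2 <= 2 x^2 + 2 y^2]. *)
have dv (s : R) y v : s \in D ->
    diff2 g (x0 + (l - s) *: b0 + sg *m y) (Num.sqrt s *: v) ^+ 2 <=
    2 * diff2 G y (Num.sqrt s *: w v) ^+ 2 + 32 * (K * M) ^+ 2 * s ^+ 2.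
  rewrite inE /D /= in_itv/= => /andP[s0 _].
  pose h := Num.sqrt s *: v.
  have hE : sg *m (Num.sqrt s *: w v) = h.
    by rewrite -scalemxAr /w mulmxA mulmxV// mul1mx.
  set p := x0 + _ + _.
  have pE : p = z0 + sg *m y - s *: b0.
    by rewrite /p /z0 scalerBl; apply/matrixP => i j; rewrite !mxE; ring.
  have G1 : G (y + Num.sqrt s *: w v) = g (z0 + sg *m y + h) by rewrite /G mulmxDr hE addrA.
  have G2 : G (y - Num.sqrt s *: w v) = g (z0 + sg *m y - h) by rewrite /G mulmxBr hE addrA.
  rewrite /diff2 -/h G1 G2 -/(G y).
  have lip1 a : `|g (a - s *: b0) - g a| <= K * M * s.
    apply: (le_trans (lipg _ _)); rewrite addrAC subrr add0r normrN normrZ (gtr0_norm s0).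
    by rewrite -mulrA ler_wpM2l// mulrC ler_wpM2r// ltW.
  have := lip1 (z0 + sg *m y + h); have := lip1 (z0 + sg *m y - h); have := lip1 (z0 + sg *m y).
  have -> : z0 + sg *m y + h - s *: b0 = p + h by rewrite pE addrAC.
  have -> : z0 + sg *m y - h - s *: b0 = p - h by rewrite pE addrAC.
  rewrite -pE -/(G y) !ler_norml => /andP[a1 a2] /andP[a3 a4] /andP[a5 a6].
  set A := g (p + h) in a5 a6 *; set B := g (p - h) in a3 a4 *; set C := g p in a1 a2 *.
  set A' := g (z0 + sg *m y + h) in a5 a6 *; set B' := g (z0 + sg *m y - h) in a3 a4 *.
  set C' := G y in a1 a2 *; set e := K * M * s in a1 a2 a3 a4 a5 a6.
  have -> : 32 * (K * M) ^+ 2 * s ^+ 2 = 2 * (4 * e) ^+ 2 by rewrite /e; ring.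
  have d1 : A + B - 2 * C = (A' + B' - 2 * C') + ((A - A') + (B - B') - 2 * (C - C')) by ring.
  rewrite d1; set X := A' + B' - 2 * C'; set Y := _ - 2 * (C - C').
  have Ye : `|Y| <= 4 * e by rewrite ler_norml /Y; apply/andP; split; lra.
  have Y2 : Y ^+ 2 <= (4 * e) ^+ 2.
    rewrite -[Y ^+ 2]real_normK ?num_real// ler_pXn2r// nnegrE.
    exact: le_trans Ye.
  apply: (@le_trans _ _ (2 * X ^+ 2 + 2 * Y ^+ 2)); last by rewrite lerD2l ler_wpM2l.
  clearbody X Y.
  by rewrite -subr_ge0 (_ : _ - _ = (X - Y) ^+ 2) ?sqr_ge0//; ring.
have mgv : measurable_fun setT (gl lam^-1 : mcol R N -> R) by exact: measurable_gl.
have mgy : measurable_fun setT (gl (Num.sqrt l) : mcol R N -> R) by exact: measurable_gl.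
have mQ : measurable_fun setT (fun p : (R * mcol R N) * mcol R N => Q p.1.1 p.1.2 p.2).
  have m11 : measurable_fun setT (fun p : (R * mcol R N) * mcol R N => p.1.1) by exact: measurableT_comp.
  have m12 : measurable_fun setT (fun p : (R * mcol R N) * mcol R N => p.1.2) by exact: measurableT_comp.
  apply: measurable_funM.
    apply: measurable_funM; first exact: (measurableT_comp mgy m12).
    exact: (measurableT_comp mgv measurable_snd).
  apply: measurable_funM; first by apply: measurable_invr; exact: measurable_funX.
  apply: measurable_funX; apply: (measurable_diff2 mG m12).
  apply: measurable_col_scale; first exact: (measurableT_comp (@measurable_sqrtr R) m11).
  exact: (measurableT_comp mw measurable_snd).
pose J1 s := Jint std (fun y => Jint std (fun v => (Q s y v)%:E) 0) 0.
have J10 s : (0 <= J1 s)%E by do 2! (apply: Jint_ge0 => ?); rewrite lee_fin.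
have mQs s : measurable_fun setT (fun p : mcol R N * mcol R N => (Q s p.1 p.2)%:E).
  apply/measurable_EFinP; apply: (measurableT_comp mQ (g := fun p : mcol R N * mcol R N => ((s, p.1), p.2))).
  apply: measurable_fun_pair; last exact: measurable_snd.
  by apply: measurable_fun_pair => //; exact: measurable_fst.
have J1E s : J1 s = Jint std (fun v => Jint std (fun y => (Q s y v)%:E) 0) 0.
  by rewrite /J1 (Jint_exchange _ _ _ _ (mQs s))// => y v; rewrite lee_fin.
have step1 s : s \in D -> ((s ^+ 2)^-1%:E * Jint std (fun y => (gl (Num.sqrt l) y)%:E *
      Jint std (fun h => (gl (Num.sqrt s / lam) h)%:E *
         ((diff2 g (x0 + (l - s) *: b0 + sg *m y) h) ^+ 2)%:E) 0%R) 0%R <=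
      2%:E * J1 s + (32 * (K * M) ^+ 2 * (m * m))%:E)%E.
  move=> sD; have s0 : 0 < s by move: sD; rewrite inE /D /= in_itv/= => /andP[].
  have ss0 : 0 < Num.sqrt s by rewrite sqrtr_gt0.
  have c30 : 0 <= 32 * (K * M) ^+ 2 * s ^+ 2.
    by apply: mulr_ge0; [apply: mulr_ge0; rewrite ?sqr_ge0|exact: sqr_ge0].
  have c00 : 0 <= 32 * (K * M) ^+ 2 * s ^+ 2 * m by exact: mulr_ge0.
  pose A y := Jint std (fun v => (gl lam^-1 v * diff2 G y (Num.sqrt s *: w v) ^+ 2)%:E) 0.
  have gD0 y v : 0 <= gl lam^-1 v * diff2 G y (Num.sqrt s *: w v) ^+ 2 by rewrite mulr_ge0// sqr_ge0.
  have A0 y : (0 <= A y)%E by apply: Jint_ge0 => v; rewrite lee_fin.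
  have mgD : measurable_fun setT (fun p : mcol R N * mcol R N =>
      (gl lam^-1 p.2 * diff2 G p.1 (Num.sqrt s *: w p.2) ^+ 2)%:E).
    apply/measurable_EFinP; apply: measurable_funM; first exact: (measurableT_comp mgv measurable_snd).
    apply: measurable_funX; apply: (measurable_diff2 mG measurable_fst).
    apply: measurable_col_scale => //; exact: (measurableT_comp mw measurable_snd).
  have mA : measurable_fun setT (A : mcol R N -> \bar R).
    have gE0 y v : (0 <= (gl lam^-1 v * diff2 G y (Num.sqrt s *: w v) ^+ 2)%:E)%E by rewrite lee_fin.
    have H := @measurable_Jint R N _ (mcol R N) std
      (fun y v => (gl lam^-1 v * diff2 G y (Num.sqrt s *: w v) ^+ 2)%:E) mgD gE0.
    apply: (measurableT_comp H (g := fun y : mcol R N => (y, 0 : mcol R N))).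
    exact: measurable_fun_pair.
  have mgD1 y : measurable_fun setT ((fun v => (gl lam^-1 v * diff2 G y (Num.sqrt s *: w v) ^+ 2)%:E) : mcol R N -> \bar R).
    apply: (measurableT_comp mgD (g := fun v : mcol R N => (y : mcol R N, v))).
    exact: measurable_fun_pair.
  have mglA : measurable_fun setT ((fun y => (gl (Num.sqrt l) y)%:E * A y)%E : mcol R N -> \bar R).
    by apply: emeasurable_funM => //; exact/measurable_EFinP.
  have glA0 y : (0 <= (gl (Num.sqrt l) y)%:E * A y)%E by rewrite mule_ge0// lee_fin.
  have EJ1 : J1 s = ((s ^+ 2)^-1%:E * Jint std (fun y => (gl (Num.sqrt l) y)%:E * A y)%E 0)%E.
    rewrite -Jint_mull//; apply: eq_Jint => y; rewrite muleA -EFinM -Jint_mull//; last 2 first.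
    - by move=> v; rewrite lee_fin.
    - exact: mulr_ge0.
    by apply: eq_Jint => v; rewrite -EFinM /Q; congr EFin; ring.
  have IA y : (Jint std (fun h => (gl (Num.sqrt s / lam) h)%:E *
         ((diff2 g (x0 + (l - s) *: b0 + sg *m y) h) ^+ 2)%:E)%E 0 <=
       2%:E * A y + (32 * (K * M) ^+ 2 * s ^+ 2 * m)%:E)%E.
    have md (p : 'cV[R]_N) : measurable_fun setT ((fun h => (diff2 g p h ^+ 2)%:E) : mcol R N -> \bar R).
      apply/measurable_EFinP; apply: measurable_funX.
      exact: (measurable_diff2 mg (Y := fun=> p)).
    rewrite (@Jint_gl_scale _ _ (fun h => (diff2 g (x0 + (l - s) *: b0 + sg *m y) h ^+ 2)%:E))//; last first.
      by move=> h; rewrite lee_fin sqr_ge0.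
    have -> : ((32 * (K * M) ^+ 2 * s ^+ 2 * m)%:E =
        Jint std (fun v => (32 * (K * M) ^+ 2 * s ^+ 2)%:E * (gl lam^-1 v)%:E)%E 0)%E.
      rewrite Jint_mull ?Jint_gl//; exact/measurable_EFinP.
    rewrite /A -Jint_mull//; last by move=> v; rewrite lee_fin.
    rewrite -Jint_add//.
    - apply: le_Jint => v; first by rewrite -EFinM lee_fin mulr_ge0// sqr_ge0.
      rewrite -!EFinM -EFinD lee_fin.
      have := ler_wpM2l (glv0 v) (dv s y v sD); set X := _ ^+ 2; set Y := _ ^+ 2; move=> h; lra.
    - by apply: measurable_funeM.
    - by move=> v; rewrite -EFinM lee_fin mulr_ge0.
    - by apply: measurable_funeM; exact/measurable_EFinP.
    - by move=> v; rewrite -EFinM lee_fin mulr_ge0.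
  apply: (@le_trans _ _ ((s ^+ 2)^-1%:E * Jint std (fun y => 2%:E * ((gl (Num.sqrt l) y)%:E * A y) +
      (32 * (K * M) ^+ 2 * s ^+ 2 * m)%:E * (gl (Num.sqrt l) y)%:E) 0%R)%E).
    apply: lee_wpmul2l; first by rewrite lee_fin.
    apply: le_Jint => y.
      rewrite mule_ge0 ?lee_fin//; apply: Jint_ge0 => h.
      by rewrite mule_ge0// lee_fin ?sqr_ge0// gl_ge0// divr_gt0.
    apply: (le_trans (lee_wpmul2l _ (IA y))); first by rewrite lee_fin.
    rewrite ge0_muleDr//; last by rewrite mule_ge0.
    by rewrite [(_ * (32 * _ * _ * _)%:E)%E]muleC [(_ * (2%:E * _))%E]muleCA.
  rewrite Jint_add//; last 4 first.
  - by apply: measurable_funeM.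
  - by move=> y; rewrite mule_ge0.
  - by apply: measurable_funeM; exact/measurable_EFinP.
  - by move=> y; rewrite -EFinM lee_fin mulr_ge0.
  rewrite !Jint_mull//; last exact/measurable_EFinP.
  rewrite Jint_gl// -/m -EFinM ge0_muleDr//; last 2 first.
  - by rewrite mule_ge0//; exact: Jint_ge0.
  - by rewrite lee_fin; exact: mulr_ge0.
  rewrite EJ1 [(2%:E * (_ * _))%E]muleCA; apply: leeD => //.
  rewrite -EFinM lee_fin le_eqVlt; apply/orP; left; apply/eqP.
  by rewrite (_ : 32 * (K * M) ^+ 2 * s ^+ 2 * m * m = s ^+ 2 * (32 * (K * M) ^+ 2 * (m * m))) ?mulKf ?expf_neq0 ?gt_eqF//; ring.
(* The estimate holds for one direction at a time, with a constant growing exponentially in it. The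
   integral over [s] is therefore moved inside, and the kernel in [v] of rate [laplace_rate] absorbs
   the growth. *)
have step2 : (\int[mu]_(s in D) J1 s <= (12 * KG ^+ 2 * m * (lam ^+ N * m))%:E)%E.
  pose B s v := Jint std (fun y => (Q s y v)%:E) 0.
  have mB : measurable_fun setT (fun p : R * mcol R N => B p.1 p.2).
    have mQ' : measurable_fun setT (fun p : (R * mcol R N) * mcol R N => (Q p.1.1 p.2 p.1.2)%:E).
      apply/measurable_EFinP.
      apply: (measurableT_comp mQ (g := fun p : (R * mcol R N) * mcol R N => ((p.1.1, p.2), p.1.2))).
      apply: measurable_fun_pair; last exact: measurableT_comp.
      by apply: measurable_fun_pair; [exact: measurableT_comp|exact: measurable_snd].
    have H := measurable_Jint std (F := fun (p : R * mcol R N) y => (Q p.1 y p.2)%:E) mQ' (fun p y => Q0 _ _ _).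
    apply: (measurableT_comp H (g := fun p : R * mcol R N => (p, 0 : mcol R N))).
    exact: measurable_fun_pair.
  have B0 s v : (0 <= B s v)%E by apply: Jint_ge0 => y; rewrite lee_fin.
  under eq_integral do rewrite J1E.
  rewrite (@Jint_tonelli_in _ _ _ _ mu D std B 0 mD mB B0).
  have k00 : 0 <= 12 * KG ^+ 2 * m.
    by apply: mulr_ge0 => //; apply: mulr_ge0; rewrite ?sqr_ge0.
  have k10 : 0 <= 12 * KG ^+ 2 * m * lam ^+ N.
    by apply: mulr_ge0 => //; rewrite exprn_ge0// ltW.
  apply: (@le_trans _ _ (Jint std (fun v => (12 * KG ^+ 2 * m * lam ^+ N)%:E * (laplace 1 v)%:E)%E 0)); last first.
    rewrite Jint_mull.
    - by rewrite Jint_laplace1 -EFinM mulrA.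
    - by apply/measurable_EFinP; exact: measurable_laplace.
    - by move=> v; rewrite lee_fin expR_ge0.
    - exact: k10.
  apply: le_Jint => v; first by apply: integral_ge0 => s _.
  pose c1 := gl lam^-1 v * (Num.sqrt l) ^- N.
  have c10 : 0 <= c1 by rewrite mulr_ge0// invr_ge0 exprn_ge0// ltW.
  pose I1 s := ((s ^+ 2)^-1%:E * Jint std (fun y => (laplace (Num.sqrt l) y * diff2 G y (Num.sqrt s *: w v) ^+ 2)%:E) 0)%E.
  have mlD s : measurable_fun setT ((fun y => (laplace (Num.sqrt l) y * diff2 G y (Num.sqrt s *: w v) ^+ 2)%:E) : mcol R N -> \bar R).
    apply/measurable_EFinP; apply: measurable_funM; first exact: measurable_laplace.
    apply: measurable_funX; exact: (measurable_diff2 mG (V := fun=> Num.sqrt s *: w v)).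
  have lD0 s y : 0 <= laplace (Num.sqrt l) y * diff2 G y (Num.sqrt s *: w v) ^+ 2.
    by rewrite mulr_ge0 ?expR_ge0// sqr_ge0.
  have BE s : B s v = (c1%:E * I1 s)%E.
    rewrite /B /I1 muleA -EFinM -Jint_mull//; last 2 first.
    - by move=> y; rewrite lee_fin.
    - exact: mulr_ge0.
    by apply: eq_Jint => y; rewrite -EFinM /Q /c1 {1}/gl; congr EFin; ring.
  have I10 s : (0 <= I1 s)%E.
    by rewrite mule_ge0 ?lee_fin//; apply: Jint_ge0 => y; rewrite lee_fin.
  have c1p : 0 < c1 by rewrite /c1 /gl !mulr_gt0 ?expR_gt0 ?invr_gt0 ?exprn_gt0.
  have mI1 : measurable_fun setT I1.
    have -> : I1 = (fun s => (c1^-1)%:E * B s v)%E.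
      by apply/funext => s; rewrite BE muleA -EFinM mulVf ?mul1e// gt_eqF.
    apply: measurable_funeM.
    by apply: (measurableT_comp mB (g := fun s : R => (s, v : mcol R N))); exact: measurable_fun_pair.
  under eq_integral do rewrite BE.
  rewrite ge0_integralZl//; last by exact: measurable_funTS.
  have Zf : Jint std (fun y => (laplace (Num.sqrt l) y)%:E) 0 = (Num.sqrt l ^+ N * m)%:E.
    exact: Jint_laplace.
  have sqf := square_function mG KG0 lipG (w v) sl0 (b := l / 2).
  have {sqf} := sqf (divr_gt0 l0 (ltr0n _ 2)).
  rewrite Zf sqr_sqrtr ?(ltW l0)// => sqf.
  have {sqf} := sqf _ isT; rewrite ler_pdivrMr// => /(_ ltac:(lra)) sqf.
  apply: (le_trans (lee_wpmul2l _ sqf)); first by rewrite lee_fin.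
  rewrite -!EFinM lee_fin.
  have nw0 : 0 <= l1norm (w v) by exact: l1norm_ge0.
  have nw : l1norm (w v) <= N%:R * c * l1norm v by exact: l1norm_mulmx.
  have w2 : `|w v| ^+ 2 <= expR (2 * l1norm (w v)).
    have h : `|w v| <= expR (l1norm (w v)).
      apply: (le_trans (le_l1norm _)); apply: le_trans (expR_ge1Dx _); lra.
    rewrite expRM_natl ler_pXn2r// nnegrE//.
  have sN : Num.sqrt l ^- N * Num.sqrt l ^+ N = 1 by rewrite mulVf// expf_neq0// gt_eqF.
  have -> : c1 * (12 * expR (3 * l1norm (w v)) * KG ^+ 2 * `|w v| ^+ 2 * (Num.sqrt l ^+ N * m)) =
     12 * KG ^+ 2 * m * (gl lam^-1 v * (expR (3 * l1norm (w v)) * `|w v| ^+ 2)) * (Num.sqrt l ^- N * Num.sqrt l ^+ N).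
    by rewrite /c1; ring.
  rewrite sN mulr1 -[leRHS]mulrA ler_wpM2l//.
  rewrite /gl exprVn invrK -mulrA ler_wpM2l ?exprn_ge0 ?(ltW lam0)//.
  apply: (@le_trans _ _ (laplace lam^-1 v * (expR (3 * l1norm (w v)) * expR (2 * l1norm (w v))))).
    by rewrite ler_wpM2l ?expR_ge0// ler_wpM2l ?expR_ge0.
  rewrite /laplace -!expRD ler_expR invrK divr1 /laplace_rate.
  have := l1norm_ge0 v; nra.
have c20 : 0 <= 32 * (K * M) ^+ 2 * (m * m).
  by apply: mulr_ge0; [apply: mulr_ge0; rewrite ?sqr_ge0|exact: mulr_ge0].
have mJ1 : measurable_fun setT J1.
  have mQy : measurable_fun setT (fun p : (R * mcol R N) * mcol R N => (Q p.1.1 p.1.2 p.2)%:E).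
    exact/measurable_EFinP.
  have H1 := measurable_Jint std (F := fun (p : R * mcol R N) v => (Q p.1 p.2 v)%:E) mQy (fun p v => Q0 _ _ _).
  have H2 : measurable_fun setT (fun p : R * mcol R N => Jint std (fun v => (Q p.1 p.2 v)%:E) 0).
    apply: (measurableT_comp H1 (g := fun p : R * mcol R N => (p, 0 : mcol R N))).
    exact: measurable_fun_pair.
  have J0 s y : (0 <= Jint std (fun v => (Q s y v)%:E) 0)%E.
    by apply: Jint_ge0 => v; rewrite lee_fin.
  have H3 := measurable_Jint std (F := fun s y => Jint std (fun v => (Q s y v)%:E) 0) H2 J0.
  apply: (measurableT_comp H3 (g := fun s : R => (s, 0 : mcol R N))).
  exact: measurable_fun_pair.
apply: (@le_trans _ _ (\int[mu]_(s in D) (2%:E * J1 s + (32 * (K * M) ^+ 2 * (m * m))%:E))%E).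
  apply: le_integral_ge0 => s sD; last by apply: step1; rewrite inE.
  rewrite mule_ge0 ?lee_fin//; apply: Jint_ge0 => y; rewrite mule_ge0 ?lee_fin//.
  apply: Jint_ge0 => h; rewrite mule_ge0 ?lee_fin ?sqr_ge0// gl_ge0// divr_gt0// sqrtr_gt0.
  by move: sD; rewrite /D /= in_itv/= => /andP[].
rewrite ge0_integralD//; last 2 first.
- by move=> s _; rewrite mule_ge0.
- by apply: measurable_funeM; exact: measurable_funTS.
rewrite ge0_integralZl//; last by exact: measurable_funTS.
have muD : mu D = (l / 2)%:E.
  by rewrite /D lebesgue_measure_itv/= lte_fin divr_gt0// -EFinD subr0.
have -> : (\int[mu]_(s in D) (32 * (K * M) ^+ 2 * (m * m))%:E = (32 * (K * M) ^+ 2 * (m * m))%:E * mu D)%E.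
  exact: integral_cst.
rewrite muD.
apply: (le_trans (leeD (lee_wpmul2l _ step2) (lexx _))); first by rewrite lee_fin.
rewrite -!EFinM -EFinD lee_fin /square_function_const -/m lerD2l; apply: ler_wpM2l => //; lra.
Qed.

End gaussian_square_function.

(** * The scheme as a measurable functional *)

Section matrix_valued.
Context (d : measure_display) (S : measurableType d) (R : realType).

Definition mxmeas m n (A : S -> 'M[R]_(m, n)) : Prop :=
  forall i j, measurable_fun setT (fun s => A s i j).

Lemma mxmeas_cst m n (A : 'M[R]_(m, n)) : mxmeas (fun=> A).
Proof. by move=> i j; exact: measurable_cst. Qed.

Lemma mxmeasD m n (A B : S -> 'M[R]_(m, n)) : mxmeas A -> mxmeas B -> mxmeas (fun s => A s + B s).
Proof.
by move=> mA mB i j; under eq_fun do rewrite mxE; exact: measurable_funD.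
Qed.

Lemma mxmeasN m n (A : S -> 'M[R]_(m, n)) : mxmeas A -> mxmeas (fun s => - A s).
Proof.
by move=> mA i j; under eq_fun do rewrite mxE; exact: measurableT_comp.
Qed.

Lemma mxmeasB m n (A B : S -> 'M[R]_(m, n)) : mxmeas A -> mxmeas B -> mxmeas (fun s => A s - B s).
Proof. by move=> mA mB; apply: mxmeasD => //; exact: mxmeasN. Qed.

Lemma mxmeasZ m n (c : S -> R) (A : S -> 'M[R]_(m, n)) :
  measurable_fun setT c -> mxmeas A -> mxmeas (fun s => c s *: A s).
Proof.
by move=> mc mA i j; under eq_fun do rewrite mxE; exact: measurable_funM.
Qed.

Lemma mxmeas_tr m n (A : S -> 'M[R]_(m, n)) : mxmeas A -> mxmeas (fun s => (A s)^T).
Proof. by move=> mA i j; under eq_fun do rewrite mxE; exact: mA. Qed.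

Lemma mxmeasM m n p (A : S -> 'M[R]_(m, n)) (B : S -> 'M[R]_(n, p)) :
  mxmeas A -> mxmeas B -> mxmeas (fun s => A s *m B s).
Proof.
move=> mA mB i j; under eq_fun do rewrite mxE.
by apply: measurable_sum => k; exact: measurable_funM.
Qed.

Lemma measurable_det n (A : S -> 'M[R]_n) : mxmeas A ->
  measurable_fun setT (fun s => \det (A s)).
Proof.
move=> mA; apply: measurable_sum => p; apply: measurable_funM => //.
by apply: measurable_prod => i _; exact: mA.
Qed.

Lemma mxmeas_inv n (A : S -> 'M[R]_n) : (forall s, A s \in unitmx) -> mxmeas A ->
  mxmeas (fun s => invmx (A s)).
Proof.
move=> uA mA i j.
have E s : invmx (A s) i j =
    (\det (A s))^-1 * ((-1) ^+ (j + i) * \det (row' j (col' i (A s)))).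
  by rewrite /invmx uA !mxE.
under eq_fun do rewrite E.
apply: measurable_funM; first by apply: measurable_invr; exact: measurable_det.
apply: measurable_funM => //; apply: measurable_det => k l.
by under eq_fun do rewrite !mxE; exact: mA.
Qed.

End matrix_valued.

Lemma lipschitz_cont (R : realType) (V W : normedModType R) (f : V -> W) (K : R) :
  (forall x y, `|f x - f y| <= K * `|x - y|) -> continuous f.
Proof.
move=> lf x; apply/cvgrPdist_lt => e e0; near=> y.
apply: le_lt_trans (lf _ _) _.
apply: (@le_lt_trans _ _ ((`|K| + 1) * `|x - y|)).
  by rewrite ler_wpM2r// (le_trans (ler_norm _))// lerDl.
rewrite -ltr_pdivlMl ?ltr_wpDl//; near: y.
by apply: cvgr_dist_lt => //; rewrite mulr_gt0// invr_gt0 ltr_wpDl.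
Unshelve. all: by end_near.
Qed.

Section path_functionals.
Context (R : realType) (N : nat).
Variables (b : R -> 'cV[R]_N -> 'cV[R]_N) (sigma : R -> 'cV[R]_N -> 'M[R]_N).
Variables (T t0 : R) (x0 : 'cV[R]_N).
Hypothesis t0T : 0 <= t0 <= T.

Local Notation Tsw := (Tsw T t0).
Local Notation dT := (dT T t0).
Local Notation dW := (dW T t0).
Local Notation Xbar := (Xbar b sigma T t0 x0).

Lemma Tsw_range (tau : nat -> R) k : (forall j, 0 <= tau j) -> t0 <= Tsw tau k <= T.
Proof.
move=> tau0; elim: k => [|k /andP[IH1 IH2]] /=; first by rewrite lexx; case/andP: t0T.
rewrite (le_trans IH1) ?lerDl ?le_min ?tau0 ?subr_ge0//=.
by rewrite -lerBrDl ge_min lexx orbT.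
Qed.

Lemma Tsw_ge0 (tau : nat -> R) k : (forall j, 0 <= tau j) -> 0 <= Tsw tau k.
Proof.
by move=> tau0; have /andP[h _] := Tsw_range k tau0; apply: le_trans h; case/andP: t0T.
Qed.

Lemma Tsw_le (tau : nat -> R) k : (forall j, 0 <= tau j) -> Tsw tau k <= T.
Proof. by move=> tau0; have /andP[] := Tsw_range k tau0. Qed.

Context (d : measure_display) (S : measurableType d).
Variables (wp : S -> R -> 'cV[R]_N) (tau : S -> nat -> R).
Hypothesis mtau : forall k, measurable_fun setT (fun s => tau s k).
Hypothesis tau0 : forall s k, 0 <= tau s k.

Lemma measurable_Tsw k : measurable_fun setT (fun s => Tsw (tau s) k).
Proof.
elim: k => [|k IH] /=; first exact: measurable_cst.
apply: measurable_funD => //; apply: measurable_minr => //.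
exact: measurable_funB.
Qed.

Lemma measurable_dT k : measurable_fun setT (fun s => dT (tau s) k).
Proof.
apply: measurable_minr => //; apply: measurable_funB => //; exact: measurable_Tsw.
Qed.

Lemma mxmeas_path : (forall t, 0 <= t -> mxmeas (fun s => wp s t)) ->
  (forall s, {within `[0, +oo[, continuous (wp s)}) ->
  forall X : S -> R, measurable_fun setT X -> (forall s, 0 <= X s) -> mxmeas (fun s => wp s (X s)).
Proof.
move=> mwp cwp X mX X0 i j.
apply: (@measurable_comp_time _ _ _ (fun s t => wp s t i j)) => //.
- by move=> t t_ge0; exact: mwp.
- move=> s x; apply: (@cvg_comp _ _ _ (wp s) (fun A : 'cV[R]_N => A i j) _ _ _ (cwp s x)).
  exact: coord_continuous.
Qed.

(** Measurability in time and continuity in space are what the composition with a random time and a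
    random position requires. *)
Definition coef_regular p q (c : R -> 'cV[R]_N -> 'M[R]_(p, q)) : Prop :=
  (forall x i j, measurable_fun `[0, T] (fun t => c t x i j)) /\
  exists K : R, forall t x x', 0 <= t <= T -> `|c t x - c t x'| <= K * `|x - x'|.

Lemma mxmeas_coef p q (c : R -> 'cV[R]_N -> 'M[R]_(p, q)) (X : S -> R) (Y : S -> 'cV[R]_N) :
  coef_regular c -> measurable_fun setT X -> (forall s, 0 <= X s <= T) -> mxmeas Y ->
  mxmeas (fun s => c (X s) (Y s)).
Proof.
move=> [mc [K lc]] mX XT mY i j.
apply: (@measurable_comp_col _ _ _ _ (fun s x => c (X s) x i j)) => //.
- move=> x; apply: (@measurable_comp _ _ _ _ _ _ `[0, T]%classic (fun t => c t x i j)) => //.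
  by move=> _ [s _ <-]; rewrite /= in_itv/=; exact: XT.
- move=> s x; apply: (@continuous_comp _ _ _ (c (X s)) (fun A : 'M[R]_(p, q) => A i j)).
    apply: (@lipschitz_cont _ 'cV[R]_N 'M[R]_(p, q) _ K) => y z; exact: lc.
  exact: coord_continuous.
Qed.

Hypotheses (rb : coef_regular b) (rs : coef_regular sigma).
Variable n : nat.
Hypothesis mpath : forall k, (k <= n)%N -> mxmeas (fun s => wp s (Tsw (tau s) k)).

(** Only the path at the first [n] switching times is assumed measurable here and below. The lemmas
    can then be used on the sigma-algebra of the past as well, where later values of the path are
    not measurable. *)
Lemma mxmeas_dW k : (k <= n)%N -> mxmeas (fun s => dW (wp s) (tau s) k).
Proof.
move=> kn; apply: mxmeasB; apply: mpath => //.
exact: leq_trans (leq_pred _) kn.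
Qed.

Lemma TswT s k : 0 <= Tsw (tau s) k <= T.
Proof. by rewrite Tsw_ge0 ?Tsw_le. Qed.

Lemma mxmeas_Xbar k : (k <= n)%N -> mxmeas (fun s => Xbar (wp s) (tau s) k).
Proof.
elim: k => [|k IH] kn /=; first exact: mxmeas_cst.
have mXk := IH (ltnW kn); have mT := measurable_Tsw k; have rT s := TswT s k.
apply: mxmeasD; first apply: mxmeasD => //.
- apply: mxmeasZ; first exact: (measurable_dT k.+1).
  exact: (mxmeas_coef (X := fun s => Tsw (tau s) k)).
- apply: mxmeasM; last exact: mxmeas_dW.
  exact: (mxmeas_coef (X := fun s => Tsw (tau s) k)).
Qed.

Lemma mxmeas_bk k : (k <= n)%N -> mxmeas (fun s => bk b sigma T t0 x0 (wp s) (tau s) k).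
Proof.
move=> kn; apply: (mxmeas_coef (X := fun s => Tsw (tau s) k)) => //.
- exact: measurable_Tsw.
- by move=> s; exact: TswT.
- exact: mxmeas_Xbar.
Qed.

Lemma mxmeas_sk k : (k <= n)%N -> mxmeas (fun s => sk b sigma T t0 x0 (wp s) (tau s) k).
Proof.
move=> kn; apply: (mxmeas_coef (X := fun s => Tsw (tau s) k)) => //.
- exact: measurable_Tsw.
- by move=> s; exact: TswT.
- exact: mxmeas_Xbar.
Qed.

Lemma mxmeas_Xhat k : (k <= n)%N -> mxmeas (fun s => Xhat b sigma T t0 x0 (wp s) (tau s) k).
Proof.
move=> kn; have kn' : (k.-1 <= n)%N by exact: leq_trans (leq_pred _) kn.
apply: mxmeasB; last by apply: mxmeasM; [exact: mxmeas_sk|exact: mxmeas_dW].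
apply: mxmeasD; first exact: mxmeas_Xbar.
by apply: mxmeasZ; [exact: measurable_dT|exact: mxmeas_bk].
Qed.

Hypothesis us : forall t x, 0 <= t <= T -> sigma t x \in unitmx.

Lemma measurable_Mw k : (k <= n)%N ->
  measurable_fun setT (fun s => Mw b sigma T t0 x0 (wp s) (tau s) k).
Proof.
move=> kn; have kn' : (k.-1 <= n)%N by exact: leq_trans (leq_pred _) kn.
have kn'' : (k.-1.-1 <= n)%N by exact: leq_trans (leq_pred _) kn'.
suff H : mxmeas (fun s => (dbk b sigma T t0 x0 (wp s) (tau s) k.-1)^T *m
  ((invmx (sk b sigma T t0 x0 (wp s) (tau s) k.-1))^T *m
    ((dT (tau s) k)^-1 *: dW (wp s) (tau s) k))) by exact: H.
apply: mxmeasM; first by apply/mxmeas_tr/mxmeasB; exact: mxmeas_bk.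
apply: mxmeasM.
  apply/mxmeas_tr/mxmeas_inv; last exact: mxmeas_sk.
  by move=> s; apply: us; exact: TswT.
apply: mxmeasZ; last exact: mxmeas_dW.
by apply: measurable_invr; exact: measurable_dT.
Qed.

Lemma measurable_Vw k : (k <= n)%N ->
  measurable_fun setT (fun s => Vw b sigma T t0 x0 (wp s) (tau s) k).
Proof.
move=> kn; have kn' : (k.-1 <= n)%N by exact: leq_trans (leq_pred _) kn.
have kn'' : (k.-1.-1 <= n)%N by exact: leq_trans (leq_pred _) kn'.
have mi : mxmeas (fun s => invmx (sk b sigma T t0 x0 (wp s) (tau s) k.-1)).
  apply/mxmeas_inv; last exact: mxmeas_sk.
  by move=> s; apply: us; exact: TswT.
rewrite /Vw /frob /mxtrace; apply: measurable_sum => i; move: i {2}i => i j; move: i j.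
suff H : mxmeas (fun s => dak b sigma T t0 x0 (wp s) (tau s) k.-1 *m
  ((invmx (sk b sigma T t0 x0 (wp s) (tau s) k.-1))^T *m
    ((dT (tau s) k ^+ 2)^-1 *: (dW (wp s) (tau s) k *m (dW (wp s) (tau s) k)^T - dT (tau s) k *: 1%:M)) *m
    invmx (sk b sigma T t0 x0 (wp s) (tau s) k.-1))^T) by exact: H.
apply: mxmeasM.
  by apply: mxmeasB; apply: mxmeasM; do ?apply: mxmeas_tr; exact: mxmeas_sk.
apply: mxmeas_tr; apply: mxmeasM => //; apply: mxmeasM; first exact: mxmeas_tr.
have mdW := mxmeas_dW kn; have mdT := measurable_dT k.
apply: mxmeasZ; first by apply: measurable_invr; exact: measurable_funX.
apply: mxmeasB; first by apply: mxmeasM => //; exact: mxmeas_tr.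
by apply: mxmeasZ => //; exact: mxmeas_cst.
Qed.

End path_functionals.

(** * The number of switches *)

Section stopping_index.
Context (R : realType) (T t0 : R).

(** The right alternative is the event on which the horizon is never reached; there [NT] has its
    dummy value 0, so this event belongs to the fibre of 0. *)
Lemma NT_cases (tau : nat -> R) :
  (T <= Tsw T t0 tau (NT T t0 tau).+1 /\ forall m, (m < NT T t0 tau)%N -> Tsw T t0 tau m.+1 < T)
  \/ (NT T t0 tau = 0%N /\ forall m, Tsw T t0 tau m.+1 < T).
Proof.
rewrite /NT; case: pselect => [h|h]; [left|right].
  case: ex_minnP => m Tm mmin; split=> // j jm; rewrite ltNge; apply/negP => /mmin.
  by rewrite leqNgt jm.
by split=> // m; rewrite ltNge; apply/negP => Tm; apply: h; exists m.
Qed.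

Lemma NT_eq (tau : nat -> R) i : T <= Tsw T t0 tau i.+1 ->
  (forall m, (m < i)%N -> Tsw T t0 tau m.+1 < T) -> NT T t0 tau = i.
Proof.
move=> Ti lti; have [[TN ltN]|[_ all_lt]] := NT_cases tau; last first.
  by move: (all_lt i); rewrite ltNge Ti.
apply/eqP; rewrite eqn_leq leqNgt; apply/andP; split.
  by apply/negP => /ltN; rewrite ltNge Ti.
by rewrite leqNgt; apply/negP => /lti; rewrite ltNge TN.
Qed.

Lemma measurable_NT_fiber (d : measure_display) (S : measurableType d) (tau : S -> nat -> R) i :
  (forall k, measurable_fun setT (fun s => Tsw T t0 (tau s) k)) ->
  measurable ((fun s => NT T t0 (tau s)) @^-1` [set i]).
Proof.
move=> mT.
pose A j := [set s | T <= Tsw T t0 (tau s) j.+1].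
have mA j : measurable (A j).
  rewrite (_ : A j = (fun s => Tsw T t0 (tau s) j.+1) @^-1` `[T, +oo[); last first.
    by apply/seteqP; split=> s; rewrite /A /= in_itv/= andbT.
  by rewrite -[X in measurable X]setTI; exact: mT.
pose B := \bigcap_j ~` A j.
have mB : measurable B by apply: bigcapT_measurable => j; exact: measurableC.
have -> : (fun s => NT T t0 (tau s)) @^-1` [set i] =
   (A i `&` \bigcap_(j in `I_i) ~` A j) `|` (if i == 0%N then B else set0).
  apply/seteqP; split=> s /=.
    move=> <-; have [[TN ltN]|[-> all_lt]] := NT_cases (tau s); [left|right; rewrite eqxx].
      by split=> // j /ltN; rewrite /A/= => h; apply/negP; rewrite -ltNge.
    by rewrite /B => j _; rewrite /A /= => h; move: (all_lt j); rewrite ltNge h.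
  move=> [[TN ltN]|].
    by apply: NT_eq => // m mi; rewrite ltNge; apply/negP/ltN.
  case: eqP => // -> Bs; have [[TN _]|[//]] := NT_cases (tau s).
  by case: (Bs _ I TN).
apply: measurableU; last by case: ifP.
apply: measurableI => //; apply: bigcap_measurableType.
by move=> j _; exact: measurableC.
Qed.

End stopping_index.

(** * Gamma density *)

Section gamma_density.
Context (R : realType).
Local Notation mu := (@lebesgue_measure R).
Variables (kappa theta : R).
Hypotheses (k1 : kappa <= 1) (th0 : 0 < theta).
Local Notation f := (gamma_pdf kappa theta).
Local Notation F := (gamma_cdf kappa theta).
Hypothesis mass1 : (\int[mu]_u (f u)%:E = 1)%E.

Definition gamma_norm : R := Gamma_fun kappa * theta `^ kappa.
Local Notation Z := gamma_norm.

Lemma gamma_norm_ge0 : 0 <= Z.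
Proof.
rewrite mulr_ge0// ?powR_ge0// /Gamma_fun /Rintegral fine_ge0//.
by apply: integral_ge0 => x _; rewrite lee_fin mulr_ge0 ?powR_ge0 ?expR_ge0.
Qed.

Lemma gamma_pdf_ge0 u : 0 <= f u.
Proof.
rewrite /gamma_pdf; case: ifP => // _.
by rewrite divr_ge0 ?gamma_norm_ge0// mulr_ge0 ?powR_ge0 ?expR_ge0.
Qed.

(** Were the constant 0, the convention [0^-1 = 0] would make the density vanish, against its total
    mass 1. Positivity of the Gamma integral thus follows from the law of the waiting times. *)
Lemma gamma_norm_gt0 : 0 < Z.
Proof.
rewrite lt_neqAle gamma_norm_ge0 andbT; apply/eqP => Z0.
move: mass1; rewrite (_ : (fun u => _) = cst 0%E).
  by rewrite integral0 => /esym/eqP; rewrite onee_eq0.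
by apply/funext => u; rewrite /gamma_pdf -/Z -Z0 invr0 mulr0 if_same.
Qed.

Lemma gamma_pdfE u : 0 < u -> f u = Z^-1 * (u `^ (kappa - 1) * expR (- u / theta)).
Proof. by move=> u0; rewrite /gamma_pdf u0 -/Z mulrC. Qed.

Lemma gamma_pdf_le u : 0 < u -> f u <= Z^-1 * u `^ (kappa - 1).
Proof.
move=> u0; rewrite gamma_pdfE// ler_wpM2l ?invr_ge0 ?gamma_norm_ge0//.
by rewrite ler_piMr ?powR_ge0// -expR0 ler_expR mulNr oppr_le0 divr_ge0 ?ltW.
Qed.

Lemma gamma_pdf_lower T u : 0 < u -> u <= T ->
  Z^-1 * expR (- T / theta) * u `^ (kappa - 1) <= f u.
Proof.
move=> u0 uT; rewrite gamma_pdfE// -mulrA ler_wpM2l ?invr_ge0 ?gamma_norm_ge0//.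
rewrite mulrC ler_wpM2l ?powR_ge0// ler_expR ler_pM2r ?invr_gt0//.
by rewrite lerN2.
Qed.

Lemma measurable_gamma_pdf : measurable_fun setT f.
Proof.
have -> : f = (fun u => if u > 0 then u `^ (kappa - 1) * expR (- u / theta) / Z else 0) by [].
apply: measurable_fun_ifT => //.
  exact: measurable_fun_ltr.
apply: measurable_funM => //; apply: measurable_funM; first exact: measurable_powR.
apply: measurableT_comp => //; apply: measurable_funM => //.
Qed.

Lemma powR_mono_le (u v : R) : 0 < u -> u <= v -> v `^ (kappa - 1) <= u `^ (kappa - 1).
Proof.
move=> u0 uv; have v0 : 0 < v by exact: lt_le_trans uv.
rewrite /powR !gt_eqF// ler_expR ler_wnM2l ?subr_le0//.
by rewrite ler_ln.
Qed.

Lemma gamma_cdfE x : (gamma_cdf kappa theta x)%:E = (\int[mu]_(u in `]-oo, x]) (f u)%:E)%E.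
Proof.
rewrite /gamma_cdf /Rintegral fineK// ge0_fin_numE; last first.
  by apply: integral_ge0 => u _; rewrite lee_fin gamma_pdf_ge0.
apply: le_lt_trans (_ : (\int[mu]_u (f u)%:E < +oo)%E); last by rewrite mass1 ltry.
apply: ge0_subset_integral => //.
- by apply/measurable_EFinP; exact: measurable_gamma_pdf.
- by move=> u _; rewrite lee_fin gamma_pdf_ge0.
Qed.

Lemma measurable_gamma_cdf : measurable_fun setT F.
Proof.
apply/measurable_EFinP.
pose h (p : R * R) : \bar R := ((if p.2 <= p.1 then 1 else 0) * f p.2)%:E.
have -> : EFin \o F = (fun x => \int[mu]_u h (x, u))%E.
  apply/funext => x /=; rewrite gamma_cdfE integral_mkcond; apply: eq_integral => u _.
  rewrite patchE /h /= mem_setE in_itv/=; case: ifP => _; by rewrite ?mul1r ?mul0r.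
apply: (@measurable_fun_fubini_tonelli_F _ _ _ _ R mu h).
  apply/measurable_EFinP; apply: measurable_funM.
    apply: measurable_fun_ifT => //; apply: measurable_fun_ler.
      exact: measurable_snd.
    exact: measurable_fst.
  exact: (measurableT_comp measurable_gamma_pdf measurable_snd).
by move=> p; rewrite lee_fin mulr_ge0 ?gamma_pdf_ge0//; case: ifP.
Qed.

(** The tail beyond [T] contains the mass of []T, T + 1]], on which both factors of the density
    decrease and are bounded below by their values at [T + 1]. *)
Lemma gamma_tail T : 0 < T -> exists2 e : R, 0 < e & forall x, x <= T -> e <= 1 - F x.
Proof.
move=> T0; pose e := Z^-1 * expR (- (T + 1) / theta) * (T + 1) `^ (kappa - 1).
have e0 : 0 < e by rewrite !mulr_gt0 ?invr_gt0 ?gamma_norm_gt0 ?expR_gt0 ?powR_gt0// addr_gt0.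
exists e => // x xT; rewrite lerBrDr -lee_fin EFinD gamma_cdfE -mass1.
have mf := measurable_gamma_pdf.
have eE : (e%:E = \int[mu]_(u in `]T, (T + 1)%R]) e%:E)%E.
  have muD : mu `]T, (T + 1)%R]%classic = 1%E.
    by rewrite lebesgue_measure_itv/= lte_fin ltrDl ltr01 -EFinD addrAC subrr add0r.
  by rewrite -[LHS]mule1 -muD; exact/esym/integral_cst.
rewrite [in X in (X + _)%E]eE.
apply: (@le_trans _ _ (\int[mu]_(u in `]T, (T + 1)%R]) (f u)%:E + \int[mu]_(u in `]-oo, x]) (f u)%:E)%E).
  apply: leeD2r; apply: le_integral_ge0 => u /=; rewrite in_itv/= => /andP[u1 u2].
    by rewrite lee_fin ltW.
  have u0 : 0 < u by exact: lt_trans u1.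
  rewrite lee_fin (le_trans _ (gamma_pdf_lower u0 u2))// /e ler_wpM2l//.
    by rewrite mulr_ge0 ?expR_ge0// invr_ge0 gamma_norm_ge0.
  exact: powR_mono_le.
rewrite -ge0_integral_setU//.
- apply: ge0_subset_integral => //; first exact: measurableU.
    exact/measurable_EFinP.
  by move=> u _; rewrite lee_fin gamma_pdf_ge0.
- by apply/measurable_EFinP; exact: measurable_funTS.
- by move=> u _; rewrite lee_fin gamma_pdf_ge0.
- apply/disj_setPRL => u /=; rewrite !in_itv/= => ux /andP[Tu _].
  by move: (lt_le_trans Tu (le_trans ux xT)); rewrite ltxx.
Qed.

(* Scaling u = a v reduces to the unit interval, where the density has mass at most 1. *)
Lemma integral_power : exists2 I : R, 0 <= I & forall a, 0 < a ->
  (\int[mu]_(u in `]0%R, a]) (u `^ (kappa - 1))%:E <= (a `^ kappa * I)%:E)%E.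
Proof.
pose I0 := (\int[mu]_(u in `]0%R, 1%R]) (u `^ (kappa - 1))%:E)%E.
have c0 : 0 < Z^-1 * expR (- 1 / theta) by rewrite mulr_gt0 ?expR_gt0 ?invr_gt0 ?gamma_norm_gt0.
set c := Z^-1 * _ in c0.
have I0c : (I0 <= (c^-1)%:E)%E.
  apply: (@le_trans _ _ (\int[mu]_(u in `]0%R, 1%R]) ((c^-1)%:E * (f u)%:E))%E).
    apply: le_integral_ge0 => u; rewrite /= in_itv/= => /andP[u0 u1].
      by rewrite lee_fin powR_ge0.
    by rewrite -EFinM lee_fin ler_pdivlMl// gamma_pdf_lower.
  rewrite ge0_integralZl//; last 3 first.
  - by apply/measurable_EFinP; apply: measurable_funTS; exact: measurable_gamma_pdf.
  - by move=> u _; rewrite lee_fin gamma_pdf_ge0.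
  - by rewrite lee_fin invr_ge0 ltW.
  rewrite -[leRHS]mule1 lee_wpmul2l ?lee_fin ?invr_ge0 ?(ltW c0)// -mass1.
  apply: ge0_subset_integral => //.
    by apply/measurable_EFinP; exact: measurable_gamma_pdf.
  by move=> u _; rewrite lee_fin gamma_pdf_ge0.
exists c^-1; first by rewrite invr_ge0 ltW.
move=> a a0.
pose h (u : R) : \bar R := (if (0 < u) && (u <= a) then u `^ (kappa - 1) else 0)%:E.
have mh : measurable_fun setT h.
  apply/measurable_EFinP.
  apply: (@measurable_fun_ifT _ _ _ _ (fun u => u `^ (kappa - 1)) (fun=> 0) (fun u => (0 < u) && (u <= a))) => //.
  by apply: measurable_and; [exact: measurable_fun_ltr|exact: measurable_fun_ler].
have h0 u : (0 <= h u)%E by rewrite lee_fin; case: ifP => // _; exact: powR_ge0.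
have hE : (\int[mu]_(u in `]0%R, a]) (u `^ (kappa - 1))%:E = \int[mu]_u h u)%E.
  rewrite integral_mkcond; apply: eq_integral => u _.
  by rewrite patchE /h mem_setE in_itv/=; case: ifP.
have aN : a != 0 by rewrite gt_eqF.
have := integral_affine 0 aN mh h0; rewrite (gtr0_norm a0) => E.
have {}E : (\int[mu]_u h u = a%:E * \int[mu]_u h (a * u + 0)%R)%E.
  by rewrite E muleA -EFinM divff ?mul1e.
have hs : (\int[mu]_u h (a * u + 0)%R = (a `^ (kappa - 1))%:E * I0)%E.
  rewrite /I0 -ge0_integralZl//; last 3 first.
  - by apply/measurable_EFinP; apply: measurable_funTS; exact: measurable_powR.
  - by move=> u _; rewrite lee_fin powR_ge0.
  - by rewrite lee_fin powR_ge0.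
  rewrite [RHS]integral_mkcond; apply: eq_integral => u _.
  rewrite patchE /h mem_setE in_itv/= addr0 pmulr_rgt0// -ler_pdivlMl// mulVf//.
  case: ifP => // /andP[u0 _]; by rewrite -EFinM powRM// ltW.
rewrite hE E hs muleA -EFinM.
apply: (le_trans (lee_wpmul2l _ I0c)); first by rewrite lee_fin mulr_ge0 ?powR_ge0 ?(ltW a0).
rewrite -EFinM lee_fin -{1}(powRr1 (ltW a0)) -powRD; last by rewrite (gt_eqF a0) implybT.
by rewrite addrC subrK.
Qed.

End gamma_density.

(** * Pathwise bounds *)

Section norm_bounds.
Context (R : realType).

Lemma mx_norm_mulmx m n p (A : 'M[R]_(m, n)) (B : 'M[R]_(n, p)) :
  `|A *m B| <= n%:R * (`|A| * `|B|).
Proof.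
apply: mx_norm_ub => [|i j]; first by rewrite !mulr_ge0.
rewrite mxE (le_trans (ler_norm_sum _ _ _))//.
apply: (@le_trans _ _ (\sum_(k < n) `|A| * `|B|)); last first.
  by rewrite sumr_const card_ord mulr_natl.
by apply: ler_sum => k _; rewrite normrM ler_pM// mx_norm_entry.
Qed.

Lemma mx_norm_tr m n (A : 'M[R]_(m, n)) : `|A^T| <= `|A|.
Proof. by apply: mx_norm_ub => // i j; rewrite mxE; exact: mx_norm_entry. Qed.

Lemma mx_norm_scalar1 n : `|1%:M : 'M[R]_n| <= 1.
Proof.
by apply: mx_norm_ub => // i j; rewrite mxE; case: (i == j); rewrite ?mulr1n ?mulr0n ?normr1 ?normr0.
Qed.

Lemma dotp_le n (u v : 'cV[R]_n) : `|dotp u v| <= n%:R * (`|u| * `|v|).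
Proof.
apply: (le_trans (mx_norm_entry _ _ _)); apply: (le_trans (mx_norm_mulmx _ _)).
by rewrite ler_wpM2l// ler_wpM2r// mx_norm_tr.
Qed.

Lemma frob_le n (A B : 'M[R]_n) : `|frob A B| <= n%:R * (n%:R * (`|A| * `|B|)).
Proof.
rewrite /frob /mxtrace (le_trans (ler_norm_sum _ _ _))//.
apply: (@le_trans _ _ (\sum_(k < n) n%:R * (`|A| * `|B|))); last first.
  by rewrite sumr_const card_ord -[X in X <= _]mulr_natl.
apply: ler_sum => k _; apply: (le_trans (mx_norm_entry _ _ _)).
apply: (le_trans (mx_norm_mulmx _ _)).
by rewrite ler_wpM2l// ler_wpM2l// mx_norm_tr.
Qed.

Lemma powR_le_cst (T r p : R) : 0 < r -> r <= T -> 0 <= p -> p <= 2 -> r `^ p <= (1 + T) ^+ 2.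
Proof.
move=> r0 rT p0 p2; have T1 : 1 <= 1 + T by rewrite lerDl (le_trans _ rT)// ltW.
have rT1 : r <= 1 + T by rewrite (le_trans rT)// lerDr.
apply: (@le_trans _ _ ((1 + T) `^ p)).
  apply: ge0_ler_powR; rewrite ?nnegrE ?(ltW r0)//; lra.
rewrite -powR_mulrn ?(le_trans _ T1)//.
exact: ler_powR.
Qed.

Lemma le_powR_alpha (T r alpha : R) : 0 < r -> r <= T -> 0 < alpha <= 1 ->
  r <= (1 + T) ^+ 2 * r `^ alpha.
Proof.
move=> r0 rT /andP[a0 a1].
rewrite -{1}(powRr1 (ltW r0)) -{1}[1](subrK alpha) powRD; last by rewrite (gt_eqF r0) implybT.
by rewrite ler_wpM2r ?powR_ge0// powR_le_cst//; lra.
Qed.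

End norm_bounds.

Section pathwise.
Context (R : realType) (n : nat).
Local Notation N := n.+1.
Variables (b : R -> 'cV[R]_N -> 'cV[R]_N) (sigma : R -> 'cV[R]_N -> 'M[R]_N).
Variables (g : 'cV[R]_N -> R) (f F : R -> R) (T t0 : R) (x0 : 'cV[R]_N).
Variables (alpha kappa K M L c cf e : R).
Hypotheses (T0 : 0 < T) (t0T : 0 <= t0 <= T) (al : 0 < alpha <= 1).
Hypotheses (k0 : 0 < kappa) (kal : kappa <= alpha) (k2 : kappa <= 2^-1).
Hypotheses (K0 : 0 <= K) (M0 : 0 <= M) (L0 : 0 <= L) (c0 : 0 < c) (cf0 : 0 < cf) (e0 : 0 < e).
Hypothesis bM : forall t x, 0 <= t <= T -> `|b t x| <= M.
Hypothesis bL : forall t t' x x', 0 <= t <= T -> 0 <= t' <= T ->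
  `|b t x - b t' x'| <= L * (`|t - t'| `^ alpha + `|x - x'|).
Hypothesis aL : forall t t' x x', 0 <= t <= T -> 0 <= t' <= T ->
  `|diffusion sigma t x - diffusion sigma t' x'| <= L * (`|t - t'| `^ alpha + `|x - x'|).
Hypothesis sc : forall t x i j, 0 <= t <= T -> `|sigma t x i j| <= c.
Hypothesis ic : forall t x i j, 0 <= t <= T -> `|invmx (sigma t x) i j| <= c.
Hypothesis gK : forall y y', `|g y - g y'| <= K * `|y - y'|.
Hypothesis f_low : forall u, 0 < u -> u <= T -> cf * u `^ (kappa - 1) <= f u.
Hypothesis F_up : forall u, u <= T -> e <= 1 - F u.

Local Notation Tsw := (Tsw T t0).
Local Notation dT := (dT T t0).
Local Notation dW := (dW T t0).
Local Notation Xbar := (Xbar b sigma T t0 x0).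
Local Notation bk := (bk b sigma T t0 x0).
Local Notation sk := (sk b sigma T t0 x0).
Local Notation dbk := (dbk b sigma T t0 x0).
Local Notation dak := (dak b sigma T t0 x0).
Local Notation Mw := (Mw b sigma T t0 x0).
Local Notation Vw := (Vw b sigma T t0 x0).
Local Notation Pw := (Pw b sigma f T t0 x0).
Local Notation NT := (NT T t0).

(** The exponent 3 collects, after squaring, one power from the increment of the coefficients over
    the step and two from the polynomial weight of that step. *)
Definition wgt (r : R) (y : 'cV[R]_N) : R := (1 + `|y| ^+ 2 / r) ^+ 3.

(* Up to a factor [C ^ m], this bounds the square of the estimator when N_T = m: the antithetic
   pair leaves the second difference of [g] over the last increment. *)
Definition Phi (m : nat) (tau : nat -> R) (wp : R -> 'cV[R]_N) : R :=
  let s := T - Tsw tau m in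
  let z := wp T - wp (Tsw tau m) in
  ((Tsw tau m < T)%R)%:R * (\prod_(j < m) wgt (tau j) (dW wp tau j.+1)) *
  (wgt s z * (1 + diff2 g (Xbar wp tau m) (sk wp tau m *m z) ^+ 2 / s ^+ 2)).

Lemma Tsw_step tau j : Tsw tau j.+1 < T -> Tsw tau j.+1 = Tsw tau j + tau j /\ dT tau j.+1 = tau j.
Proof.
rewrite /dT /=; case: (leP (tau j) (T - Tsw tau j)) => h //.
by rewrite addrC subrK ltxx.
Qed.

Lemma Tsw_mono tau i j : (forall k, 0 < tau k) -> (i <= j)%N -> Tsw tau i <= Tsw tau j.
Proof.
move=> tau0; elim: j => [|j IH]; first by rewrite leqn0 => /eqP->.
rewrite leq_eqVlt => /orP[/eqP->//|]; rewrite ltnS => /IH h; apply: (le_trans h) => /=.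
by rewrite lerDl le_min (ltW (tau0 _)) subr_ge0 Tsw_le// => k; exact: ltW.
Qed.

Lemma Tsw_lt tau i j : (forall k, 0 < tau k) -> (i <= j)%N -> Tsw tau j < T -> Tsw tau i < T.
Proof. by move=> tau0 ij; apply: le_lt_trans; exact: Tsw_mono. Qed.

Lemma sigma_norm t x : 0 <= t <= T -> `|sigma t x| <= c.
Proof. by move=> tT; apply: mx_norm_ub => [|i j]; [exact: ltW|exact: sc]. Qed.

Lemma isigma_norm t x : 0 <= t <= T -> `|invmx (sigma t x)| <= c.
Proof. by move=> tT; apply: mx_norm_ub => [|i j]; [exact: ltW|exact: ic]. Qed.

(** Modulus of the coefficients over a step of length [r] with Brownian increment [y]. The
    contribution of the drift, of order [r], is absorbed by [r ^ alpha] on bounded times. *)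
Let U (r : R) (y : 'cV[R]_N) : R := r `^ alpha + `|y|.

Let U0 r y : 0 <= U r y. Proof. by rewrite addr_ge0// powR_ge0. Qed.

Lemma increment_bound : exists2 C, 0 <= C & forall tau wp j, (forall k, 0 < tau k) ->
  Tsw tau j.+1 < T ->
  `|dbk wp tau j.+1| <= C * U (tau j) (dW wp tau j.+1) /\
  `|dak wp tau j.+1| <= C * U (tau j) (dW wp tau j.+1).
Proof.
pose C := L * (1 + (1 + T) ^+ 2 * M + N%:R * c).
have C1 : 0 <= (1 + T) ^+ 2 * M by rewrite mulr_ge0// sqr_ge0.
have C2 : 0 <= N%:R * c by rewrite mulr_ge0// ltW.
have C0 : 0 <= C by rewrite mulr_ge0// !addr_ge0.
exists C => // tau wp j tau0 jT; have [TE dE] := Tsw_step jT.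
have tau0' k : 0 <= tau k by exact: ltW.
have r1 : 0 <= Tsw tau j <= T by rewrite Tsw_ge0// Tsw_le.
have r2 : 0 <= Tsw tau j.+1 <= T by rewrite Tsw_ge0// Tsw_le.
have tT : tau j <= T by case/andP: r1 => r1 _; case/andP: r2 => _; rewrite TE; lra.
have dt : `|Tsw tau j.+1 - Tsw tau j| = tau j.
  by rewrite TE addrC addKr gtr0_norm.
have dX : `|Xbar wp tau j.+1 - Xbar wp tau j| <=
    (1 + T) ^+ 2 * M * tau j `^ alpha + N%:R * c * `|dW wp tau j.+1|.
  have XE (x y z : 'cV[R]_N) : x + y + z - x = y + z by rewrite -(addrA x) [x + _]addrC addrK.
  rewrite /= XE dE (le_trans (ler_normD _ _))//; apply: lerD.
    rewrite normrZ gtr0_norm// -mulrA [M * _]mulrC mulrA.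
    by apply: ler_pM => //; [exact: le_powR_alpha|exact: bM].
  apply: (le_trans (mx_norm_mulmx _ _)); rewrite -mulrA ler_wpM2l// ler_wpM2r//.
  exact: sigma_norm.
have key : L * (tau j `^ alpha + `|Xbar wp tau j.+1 - Xbar wp tau j|) <=
    C * U (tau j) (dW wp tau j.+1).
  rewrite /C /U -mulrA ler_wpM2l//; apply: (le_trans (lerD (lexx _) dX)).
  have := mulr_ge0 C1 (normr_ge0 (dW wp tau j.+1)).
  have := mulr_ge0 C2 (powR_ge0 (tau j) alpha).
  have := normr_ge0 (dW wp tau j.+1).
  set A := _ ^+ 2 * M; set B := N%:R * c; set p := _ `^ _; set q := `|_|; nra.
split.
  by apply: le_trans (bL _ _ r2 r1) _; rewrite dt.
by apply: le_trans (aL _ _ r2 r1) _; rewrite dt.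
Qed.

Lemma weight_bound : exists2 C, 0 <= C & forall tau wp j, (forall k, 0 < tau k) ->
  Tsw tau j.+1 < T ->
  `|Mw wp tau j.+2| <= C * U (tau j) (dW wp tau j.+1) * (`|dW wp tau j.+2| / dT tau j.+2) /\
  `|Vw wp tau j.+2| <= C * U (tau j) (dW wp tau j.+1) *
     ((1 + `|dW wp tau j.+2| ^+ 2 / dT tau j.+2) / dT tau j.+2).
Proof.
have [C C0 HC] := increment_bound.
(* The first summand serves [Vw], the second [Mw]; the N's count matrix products and traces in the
   sup norm. *)
pose D := N%:R * (N%:R * (C * (N%:R * (N%:R * c * c * (1 + N%:R))))) + N%:R * (C * (N%:R * c)).
have c0' := ltW c0.
have D1 : 0 <= N%:R * (N%:R * (C * (N%:R * (N%:R * c * c * (1 + N%:R))))).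
  by rewrite !mulr_ge0// addr_ge0.
have D2 : 0 <= N%:R * (C * (N%:R * c)) by rewrite !mulr_ge0.
have D0 : 0 <= D by rewrite addr_ge0.
exists D => // tau wp j tau0 jT; have [Hb Ha] := HC tau wp j tau0 jT.
have tau0' k : 0 <= tau k by exact: ltW.
have r2 : 0 <= Tsw tau j.+1 <= T by rewrite Tsw_ge0// Tsw_le.
set r := dT tau j.+2; set y := dW wp tau j.+2; set u := U _ _.
have r0 : 0 < r by rewrite /r /dT/= lt_min tau0 subr_gt0.
have u0 : 0 <= u by exact: U0.
have iS : `|invmx (sk wp tau j.+1)| <= c by exact: isigma_norm.
have iT : `|(invmx (sk wp tau j.+1))^T| <= c by exact: le_trans (mx_norm_tr _) iS.
split.
  apply: (le_trans (dotp_le _ _)).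
  apply: (@le_trans _ _ (N%:R * (C * u * (N%:R * (c * (`|y| / r)))))).
    rewrite ler_wpM2l//; apply: ler_pM => //.
    apply: (le_trans (mx_norm_mulmx _ _)); rewrite ler_wpM2l//; apply: ler_pM => //.
    by rewrite normrZ normfV gtr0_norm// mulrC.
  have : 0 <= u * (`|y| / r) by rewrite mulr_ge0// divr_ge0// ltW.
  rewrite /D; set q := `|y| / r => q0.
  rewrite [leRHS](_ : _ = N%:R * (C * u * (N%:R * (c * q))) +
     N%:R * (N%:R * (C * (N%:R * (N%:R * c * c * (1 + N%:R))))) * (u * q)); last by ring.
  by rewrite lerDl mulr_ge0.
apply: (le_trans (frob_le _ _)).
set Q := (dT tau j.+2 ^+ 2)^-1 *: _.
have QE : `|Q| <= (1 + N%:R) * ((1 + `|y| ^+ 2 / r) / r).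
  rewrite normrZ normfV ger0_norm ?sqr_ge0//.
  apply: (@le_trans _ _ ((r ^+ 2)^-1 * (`|y| ^+ 2 + r))).
    rewrite ler_wpM2l ?invr_ge0 ?sqr_ge0//.
    apply: (le_trans (ler_normB _ _)); apply: lerD.
      apply: (le_trans (mx_norm_mulmx _ _)); rewrite mul1r expr2 ler_wpM2l//.
      exact: mx_norm_tr.
    rewrite normrZ gtr0_norm// -[leRHS]mulr1 ler_wpM2l ?(ltW r0)//.
    exact: mx_norm_scalar1.
  have -> : (r ^+ 2)^-1 * (`|y| ^+ 2 + r) = (1 + `|y| ^+ 2 / r) / r.
    by field; rewrite gt_eqF.
  by rewrite ler_peMl ?lerDl// divr_ge0 ?addr_ge0 ?divr_ge0 ?sqr_ge0 ?ltW.
apply: (@le_trans _ _ (N%:R * (N%:R * (C * u * (N%:R * (N%:R * (c * ((1 + N%:R) * ((1 + `|y| ^+ 2 / r) / r))) * c)))))).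
  rewrite ler_wpM2l// ler_wpM2l//; apply: ler_pM => //.
  apply: (le_trans (mx_norm_mulmx _ _)); rewrite ler_wpM2l//; apply: ler_pM => //.
  apply: (le_trans (mx_norm_mulmx _ _)); rewrite ler_wpM2l//; exact: ler_pM.
have : 0 <= u * ((1 + `|y| ^+ 2 / r) / r).
  by rewrite mulr_ge0// divr_ge0 ?addr_ge0 ?divr_ge0 ?sqr_ge0 ?ltW.
rewrite /D; set q := (1 + _) / r => q0.
rewrite [leRHS](_ : _ = N%:R * (N%:R * (C * u * (N%:R * (N%:R * (c * ((1 + N%:R) * q)) * c)))) +
   N%:R * (C * (N%:R * c)) * (u * q)); last by ring.
by rewrite lerDl mulr_ge0.
Qed.

Let q (r : R) (y : 'cV[R]_N) : R := `|y| ^+ 2 / r.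
Let q0 r y : 0 < r -> 0 <= q r y. Proof. by move=> r0; rewrite divr_ge0 ?sqr_ge0 ?ltW. Qed.

Lemma norm_le_quad r (y : 'cV[R]_N) : 0 < r -> r <= T -> `|y| <= (1 + T) * (1 + q r y).
Proof.
move=> r0 rT; have h : `|y| ^+ 2 = r * q r y by rewrite /q mulrC divfK// gt_eqF.
have := q0 y r0; have := normr_ge0 y; move: h; set a := `|y|; set p := q _ _ => h a0 p0.
have h1 : a <= 1 + a ^+ 2 by nra.
rewrite (le_trans h1)// h; nra.
Qed.

Lemma f_gt0 u : 0 < u -> u <= T -> 0 < f u.
Proof. by move=> u0 uT; apply: lt_le_trans (f_low u0 uT); rewrite mulr_gt0 ?powR_gt0. Qed.

(** All that one waiting time contributes: the modulus over the density comes from the weight of the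
    following step, the factor [(1 + q r y) / r] from its own. *)
Let G (r : R) y := U r y / f r * ((1 + q r y) / r).

Lemma G_ge0 r y : 0 < r -> r <= T -> 0 <= G r y.
Proof.
move=> r0 rT; rewrite /G; apply: mulr_ge0; first by rewrite divr_ge0 ?U0// ltW// f_gt0.
by rewrite divr_ge0 ?(ltW r0)// addr_ge0// q0.
Qed.

Lemma NT_succ tau m : NT tau = m.+1 -> T <= Tsw tau m.+2 /\ Tsw tau m.+1 < T.
Proof.
move=> NTm; have := NT_cases T t0 tau; rewrite NTm => -[[TN ltN]|[]//].
by split => //; exact: ltN.
Qed.

Lemma factor_bound : exists2 C, 0 <= C & forall tau wp j, (forall k, 0 < tau k) ->
  Tsw tau j.+2 < T ->
  `|Pw wp tau j.+2| <= C * (U (tau j) (dW wp tau j.+1) / f (tau j)) *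
     ((1 + q (tau j.+1) (dW wp tau j.+2)) / tau j.+1).
Proof.
have [C C0 HC] := weight_bound.
have C2 : 0 <= C * (1 + T) by rewrite mulr_ge0// addr_ge0// ltW.
exists (C * (1 + T) + C); first by rewrite addr_ge0.
move=> tau wp j tau0 jT; have jT' := Tsw_lt tau0 (leqnSn _) jT.
have tau0' k : 0 <= tau k by exact: ltW.
have [HM HV] := HC tau wp j tau0 jT'.
have [TE dE] := Tsw_step jT; have [TE' dE'] := Tsw_step jT'.
rewrite dE in HM HV.
have tT k : Tsw tau k.+1 < T -> tau k <= T.
  move=> kT; have [E _] := Tsw_step kT; have := Tsw_ge0 t0T k tau0'; move: kT; rewrite E; lra.
have f0 : 0 < f (tau j) by rewrite f_gt0// tT.
rewrite /Pw normrM normfV /= dE' (gtr0_norm f0).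
rewrite [leRHS](_ : _ = ((C * (1 + T) + C) * U (tau j) (dW wp tau j.+1) *
     ((1 + q (tau j.+1) (dW wp tau j.+2)) / tau j.+1)) / f (tau j)); last by ring.
rewrite ler_wpM2r ?invr_ge0 ?(ltW f0)//.
set Q := (1 + q _ _) / _; set u := U _ _ in HM HV *.
have u0 : 0 <= u by exact: U0.
have Q1 : `|dW wp tau j.+2| / tau j.+1 <= (1 + T) * Q.
  rewrite /Q mulrA ler_wpM2r ?invr_ge0//.
  by apply: norm_le_quad => //; exact: tT.
have -> : (C * (1 + T) + C) * u * Q = C * u * ((1 + T) * Q) + C * u * Q by ring.
apply: (le_trans (ler_normD _ _)); apply: lerD.
  by apply: (le_trans HM); rewrite ler_wpM2l// mulr_ge0.
rewrite normrM ger0_norm ?invr_ge0//; apply: le_trans HV.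
by rewrite ler_piMl// invf_le1 ?ler1n.
Qed.

(** The ratio [U / f] of the latest waiting time belongs to the factor not yet multiplied, so it is
    carried on the left along the induction; at the end the terminal factor supplies it. *)
Lemma product_bound : exists2 C, 0 <= C & forall tau wp m, (forall k, 0 < tau k) ->
  Tsw tau m.+1 < T ->
  `|\prod_(2 <= k < m.+2) Pw wp tau k| * (U (tau m) (dW wp tau m.+1) / f (tau m)) <=
  T * C ^+ m * \prod_(j < m.+1) G (tau j) (dW wp tau j.+1).
Proof.
have [C C0 HC] := factor_bound; exists C => // tau wp m tau0.
have tau0' k : 0 <= tau k by exact: ltW.
have tT k : Tsw tau k.+1 < T -> tau k <= T.
  move=> kT; have [E _] := Tsw_step kT; have := Tsw_ge0 t0T k tau0'; move: kT; rewrite E; lra.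
elim: m => [|m IH] mT.
  (* The first waiting time has no weight of its own. Completing its group to [G] costs the factor
     [T], since [r <= T * (1 + q r y)]. *)
  rewrite big_geq// normr1 mul1r expr0 mulr1 big_ord1 /G.
  have f0 : 0 < f (tau 0%N) by rewrite f_gt0// tT.
  rewrite mulrCA ler_peMr ?divr_ge0 ?(ltW f0)// mulrA ler_pdivlMr// mul1r.
  have := q0 (dW wp tau 1) (tau0 0%N); have := tT _ mT; have := tau0 0%N; nra.
have mT' := Tsw_lt tau0 (leqnSn _) mT.
have f0 : 0 < f (tau m.+1) by rewrite f_gt0// tT.
have f1 : 0 < f (tau m) by rewrite f_gt0// tT.
rewrite big_nat_recr//= normrM big_ord_recr/=.
have qq := q0 (dW wp tau m.+2) (tau0 m.+1).
apply: (@le_trans _ _ (`|\prod_(2 <= k < m.+2) Pw wp tau k| * (C * (U (tau m) (dW wp tau m.+1) / f (tau m)) *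
     ((1 + q (tau m.+1) (dW wp tau m.+2)) / tau m.+1)) * (U (tau m.+1) (dW wp tau m.+2) / f (tau m.+1)))).
  rewrite ler_wpM2r ?divr_ge0 ?(ltW f0)// ler_wpM2l//.
  exact: HC.
have -> : `|\prod_(2 <= k < m.+2) Pw wp tau k| * (C * (U (tau m) (dW wp tau m.+1) / f (tau m)) *
     ((1 + q (tau m.+1) (dW wp tau m.+2)) / tau m.+1)) * (U (tau m.+1) (dW wp tau m.+2) / f (tau m.+1)) =
  C * (`|\prod_(2 <= k < m.+2) Pw wp tau k| * (U (tau m) (dW wp tau m.+1) / f (tau m))) *
   G (tau m.+1) (dW wp tau m.+2) by rewrite /G; ring.
rewrite [leRHS](_ : _ = C * (T * C ^+ m * \prod_(j < m.+1) G (tau j) (dW wp tau j.+1)) *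
   G (tau m.+1) (dW wp tau m.+2)); last by rewrite exprS; ring.
rewrite ler_wpM2r//; last by rewrite ler_wpM2l// IH.
by rewrite G_ge0// tT.
Qed.

(* [2 kappa <= min (2 alpha, 1)] makes the singularities at small waiting times cancel. *)
Lemma square_factor : exists2 C, 0 <= C & forall r y, 0 < r -> r <= T ->
  G r y ^+ 2 <= C * wgt r y.
Proof.
pose B := (1 + T) ^+ 2; have B0 : 0 <= B by exact: sqr_ge0.
exists (2 * (B / cf ^+ 2)); first by rewrite mulr_ge0// divr_ge0// sqr_ge0.
move=> r y r0 rT; have p0 := q0 y r0; have yE : `|y| ^+ 2 = r * q r y.
  by rewrite /q mulrC divfK// gt_eqF.
(* The step length in the weight turns [1 / f] into a singularity of order [r ^- kappa] only. *)
have fr : cf * r `^ kappa <= f r * r.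
  have -> : r `^ kappa = r `^ (kappa - 1) * r.
    by rewrite -[X in _ * X](powRr1 (ltW r0)) -powRD ?subrK// (gt_eqF r0) implybT.
  by rewrite mulrA ler_wpM2r ?(ltW r0)// f_low.
have rk : 0 < r `^ kappa by rewrite powR_gt0.
have -> : G r y = U r y * (1 + q r y) / (f r * r).
  by rewrite /G invfM; ring.
rewrite expr_div_n /wgt -/(q r y).
have fr0 : 0 < cf * r `^ kappa by rewrite mulr_gt0.
apply: (@le_trans _ _ ((U r y * (1 + q r y)) ^+ 2 / (cf * r `^ kappa) ^+ 2)).
  rewrite ler_wpM2l ?sqr_ge0// lef_pV2 ?posrE ?exprn_gt0//; last exact: lt_le_trans fr.
  by rewrite ler_pXn2r ?nnegrE ?(ltW fr0)// (le_trans _ fr)// ltW.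
rewrite ler_pdivrMr ?exprn_gt0// exprMn exprMn.
(* The square of [U] is at most [2 * (r ^ (2 alpha) + r q)]. The first term is controlled by
   [r ^ (2 kappa)] because [kappa <= alpha], the second because [2 kappa <= 1]. *)
have UB : U r y ^+ 2 <= 2 * B * (r `^ kappa) ^+ 2 * (1 + q r y).
  apply: (@le_trans _ _ (2 * (r `^ alpha) ^+ 2 + 2 * (r * q r y))).
    rewrite -yE /U -subr_ge0.
    rewrite [leRHS](_ : _ = (r `^ alpha - `|y|) ^+ 2) ?sqr_ge0//; ring.
  have e1 : r `^ alpha <= (1 + T) * r `^ kappa.
    have -> : r `^ alpha = r `^ (alpha - kappa) * r `^ kappa.
      by rewrite -powRD ?subrK// (gt_eqF r0) implybT.
    rewrite ler_wpM2r ?(ltW rk)//.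
    apply: (@le_trans _ _ ((1 + T) `^ (alpha - kappa))).
      apply: ge0_ler_powR; rewrite ?nnegrE ?(ltW r0) ?subr_ge0//; lra.
    rewrite -[leRHS]powRr1; last by lra.
    apply: ler_powR; first by rewrite lerDl ltW.
    by case/andP: al => _ a1; rewrite lerBlDr (le_trans a1)// lerDl ltW.
  have e2 : r <= B * (r `^ kappa) ^+ 2.
    have -> : (r `^ kappa) ^+ 2 = r `^ (2 * kappa).
      by rewrite expr2 -powRD ?(gt_eqF r0) ?implybT// mulr_natl.
    apply: le_powR_alpha => //; rewrite mulr_gt0//=.
    by rewrite -ler_pdivlMl// mulr1.
  have e3 : (r `^ alpha) ^+ 2 <= B * (r `^ kappa) ^+ 2.
    rewrite /B -exprMn ler_pXn2r ?nnegrE ?powR_ge0// mulr_ge0 ?powR_ge0//; lra.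
  rewrite mulrDr mulr1; apply: lerD; first by rewrite -mulrA ler_wpM2l.
  rewrite [leRHS](_ : _ = 2 * (B * (r `^ kappa) ^+ 2 * q r y)); last by ring.
  by rewrite ler_wpM2l// ler_wpM2r.
apply: (le_trans (ler_wpM2r (sqr_ge0 _) UB)).
rewrite le_eqVlt; apply/orP; left; apply/eqP.
by field; rewrite gt_eqF.
Qed.

(** In the half sum of the antithetic pair, [Mw] multiplies the difference of the two terminal
    values, of order [|z|], and meets its own [|z| / s]. The larger weight [Vw], of order [1 / s],
    multiplies only their sum minus twice the centre: this is the second difference up to the drift,
    an error of order [s]. *)
Lemma terminal_bound : exists2 C, 0 <= C & forall tau wp m, (forall k, 0 < tau k) ->
  NT tau = m.+1 -> let s := T - Tsw tau m.+1 in
  let z := wp T - wp (Tsw tau m.+1) in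
  `|beta b sigma g f F T t0 x0 wp tau| <=
   C * (U (tau m) (dW wp tau m.+1) / f (tau m)) *
   ((1 + q s z) * (1 + `|diff2 g (Xbar wp tau m.+1) (sk wp tau m.+1 *m z)| / s)).
Proof.
have [C C0 HC] := weight_bound.
pose A := K * (2 * (N%:R * c)); pose B := 1 + 2 * (K * M).
have A0 : 0 <= A by rewrite !mulr_ge0// ltW.
have B0 : 1 <= B by rewrite lerDl !mulr_ge0.
have B0' : 0 <= B by lra.
exists (e^-1 * (C * (A + B))).
  by apply: mulr_ge0; [rewrite invr_ge0 ltW|apply: mulr_ge0 => //; exact: addr_ge0].
move=> tau wp m tau0 NTm; cbv zeta.
set s := T - Tsw tau m.+1; set z := wp T - wp _.
have tau0' k : 0 <= tau k by exact: ltW.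
have [TN mT] := NT_succ NTm.
have [TE dE] := Tsw_step mT.
have TT : Tsw tau m.+2 = T by apply/eqP; rewrite eq_le TN andbT Tsw_le.
have dsE : dT tau m.+2 = s.
  have E : T = Tsw tau m.+1 + dT tau m.+2 by rewrite -{1}TT.
  by rewrite /s [X in X - _]E addrC addKr.
have zE : dW wp tau m.+2 = z by rewrite /dW TT.
have s0 : 0 < s by rewrite subr_gt0.
have sT : s <= T by have := Tsw_ge0 t0T m.+1 tau0'; rewrite /s; lra.
have [] := HC tau wp m tau0 mT; rewrite zE dsE.
set u := U _ _ => HM HV.
have u0 : 0 <= u by exact: U0.
have tmT : tau m <= T.
  by have := Tsw_ge0 t0T m tau0'; move: mT; rewrite TE; lra.
have f0 : 0 < f (tau m) by rewrite f_gt0.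
have Fs : e <= 1 - F s by exact: F_up.
have F0 : 0 < 1 - F s by exact: lt_le_trans Fs.
have r2 : 0 <= Tsw tau m.+1 <= T by rewrite Tsw_ge0// Tsw_le.
set X := Xbar wp tau m.+1; set S := sk wp tau m.+1.
set bb := bk wp tau m.+1.
have X1 : Xbar wp tau m.+2 = X + s *: bb + S *m z.
  by rewrite -zE -dsE.
have X2 : Xhat b sigma T t0 x0 wp tau m.+2 = X + s *: bb - S *m z.
  by rewrite /Xhat -zE -dsE.
rewrite /beta /beta1 /beta2 NTm X1 X2 -/X dsE /= dE.
set Mm := Mw _ _ _ in HM *; set Vv := Vw _ _ _ in HV *.
set D := diff2 _ _ _.
set G1 := g (X + s *: bb + S *m z); set G2 := g (X + s *: bb - S *m z).
have bbM : `|s *: bb| <= M * s by rewrite normrZ (gtr0_norm s0) mulrC ler_wpM2r ?bM// ltW.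
have Gd : `|G1 - G2| <= A * `|z|.
  apply: (le_trans (gK _ _)).
  have -> : X + s *: bb + S *m z - (X + s *: bb - S *m z) = 2 *: (S *m z).
    by apply/matrixP => i j; rewrite !mxE; ring.
  rewrite /A -!mulrA ler_wpM2l// normrZ ger0_norm// ler_wpM2l//.
  apply: (le_trans (mx_norm_mulmx _ _)); rewrite ler_wpM2l// ler_wpM2r//.
  exact: sigma_norm.
have Gs : `|G1 + G2 - 2 * g X| <= `|D| + 2 * (K * M) * s.
  have d1 : `|G1 - g (X + S *m z)| <= K * M * s.
    apply: (le_trans (gK _ _)); rewrite -mulrA ler_wpM2l//.
    by rewrite (_ : _ - _ = s *: bb)//; apply/matrixP => i j; rewrite !mxE; ring.
  have d2 : `|G2 - g (X - S *m z)| <= K * M * s.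
    apply: (le_trans (gK _ _)); rewrite -mulrA ler_wpM2l//.
    by rewrite (_ : _ - _ = s *: bb)//; apply/matrixP => i j; rewrite !mxE; ring.
  have -> : G1 + G2 - 2 * g X = D + ((G1 - g (X + S *m z)) + (G2 - g (X - S *m z))).
    by rewrite /D /diff2; ring.
  apply: (le_trans (ler_normD _ _)); rewrite lerD2l.
  apply: (le_trans (ler_normD _ _)); lra.
have -> : 2^-1 * ((G1 - g X) / (1 - F s) * ((Mm + 2^-1 * Vv) / f (tau m)) +
     (G2 - g X) / (1 - F s) * ((- Mm + 2^-1 * Vv) / f (tau m))) =
   (1 - F s)^-1 * (2^-1 * ((G1 - G2) * Mm + (G1 + G2 - 2 * g X) * (2^-1 * Vv)) / f (tau m)).
  by ring.
rewrite !normrM !normfV (gtr0_norm F0) (gtr0_norm f0).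
rewrite [leRHS](_ : _ = e^-1 * (C * (A + B) * u *
  ((1 + q s z) * (1 + `|D| / s)) / f (tau m))); last by ring.
apply: ler_pM; rewrite ?invr_ge0 ?(ltW F0)//.
- by rewrite mulr_ge0 ?mulr_ge0 ?invr_ge0// ltW.
- by rewrite lef_pV2 ?posrE.
rewrite ler_wpM2r ?invr_ge0 ?(ltW f0)//.
have h1 : `|(G1 - G2) * Mm| <= A * (C * u) * q s z.
  rewrite normrM; apply: (le_trans (ler_pM _ _ Gd HM)) => //.
  by rewrite le_eqVlt; apply/orP; left; apply/eqP; rewrite /q; ring.
have qz := q0 z s0.
have Ds0 : 0 <= `|D| / s by rewrite divr_ge0// ltW.
have h2 : `|(G1 + G2 - 2 * g X) * (2^-1 * Vv)| <= B * (C * u) * ((1 + q s z) * (1 + `|D| / s)).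
  rewrite normrM; apply: (@le_trans _ _ ((`|D| + 2 * (K * M) * s) * (C * u * ((1 + q s z) / s)))).
    apply: ler_pM => //; apply: le_trans HV.
    by rewrite normrM ger0_norm ?invr_ge0// ler_piMl// invf_le1 ?ler1n.
  have -> : (`|D| + 2 * (K * M) * s) * (C * u * ((1 + q s z) / s)) =
     (`|D| / s + 2 * (K * M)) * ((C * u) * (1 + q s z)) by field; rewrite gt_eqF.
  rewrite [leRHS](_ : _ = (B * (1 + `|D| / s)) * ((C * u) * (1 + q s z))); last by ring.
  apply: ler_wpM2r; first by apply: mulr_ge0; [exact: mulr_ge0|exact: addr_ge0].
  rewrite /B; have : 0 <= 2 * (K * M) by rewrite !mulr_ge0.
  set k := 2 * (K * M); set dd := _ / s in Ds0 *; nra.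
apply: (@le_trans _ _ (1 * (`|(G1 - G2) * Mm| + `|(G1 + G2 - 2 * g X) * (2^-1 * Vv)|))).
  apply: ler_pM; rewrite ?invr_ge0//; last exact: ler_normD.
  by rewrite normr_nat invf_le1 ?ler1n.
rewrite mul1r; apply: (le_trans (lerD h1 h2)).
have h3 : q s z <= (1 + q s z) * (1 + `|D| / s) by nra.
have Cu : 0 <= C * u by rewrite mulr_ge0.
rewrite [leRHS](_ : _ = A * (C * u) * ((1 + q s z) * (1 + `|D| / s)) +
   B * (C * u) * ((1 + q s z) * (1 + `|D| / s))); last by ring.
by rewrite lerD2r ler_wpM2l// mulr_ge0.
Qed.

Lemma estimator_le : exists C0 C1, [/\ 0 <= C0, 0 <= C1 & forall tau wp m, (forall k, 0 < tau k) ->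
  NT tau = m.+1 ->
  estimator b sigma g f F T t0 x0 wp tau ^+ 2 <= C0 * C1 ^+ m.+1 * Phi m.+1 tau wp].
Proof.
have [Ct Ct0 Ht] := terminal_bound; have [Cp Cp0 Hp] := product_bound.
have [Cs Cs0 Hs] := square_factor.
have P0 : 0 <= 1 + Cp ^+ 2 by rewrite addr_ge0// sqr_ge0.
(* The factor [1 + Cp ^+ 2] is at least 1, so that a power [m] of it may be raised to [m.+1]. *)
exists (2 * (Ct * T) ^+ 2), ((1 + Cp ^+ 2) * Cs); split.
- by rewrite mulr_ge0// sqr_ge0.
- by rewrite mulr_ge0.
move=> tau wp m tau0 NTm.
have tau0' k : 0 <= tau k by exact: ltW.
have [_ mT] := NT_succ NTm.
rewrite /estimator NTm/= mulr1 mulr0 addr0.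
have := Ht tau wp m tau0 NTm; have := Hp tau wp m tau0 mT.
rewrite /Phi mT mul1r; set s := T - _; set z := wp T - _.
set D := diff2 _ _ _; set u := U _ _ / _; set pr := \prod_(2 <= k < m.+2) _.
have s0 : 0 < s by rewrite subr_gt0.
have qz := q0 z s0; have Ds : 0 <= `|D| / s by rewrite divr_ge0// ltW.
set V := (1 + q s z) * _ => h1 h2.
have V0 : 0 <= V by rewrite mulr_ge0// addr_ge0.
set GG := \prod_(j < m.+1) _ in h1.
have GG0 : 0 <= GG.
  apply: prodr_ge0 => j _; have jT := Tsw_lt tau0 (ltn_ord j) mT.
  have [E _] := Tsw_step jT.
  have tT : tau j <= T by have := Tsw_ge0 t0T j tau0'; move: jT; rewrite E; lra.
  exact: G_ge0.
have h3 : `|beta b sigma g f F T t0 x0 wp tau * pr| <= Ct * T * Cp ^+ m * GG * V.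
  rewrite normrM; apply: (le_trans (ler_wpM2r (normr_ge0 _) h2)).
  rewrite [leLHS](_ : _ = Ct * V * (`|pr| * u)); last by ring.
  rewrite [leRHS](_ : _ = Ct * V * (T * Cp ^+ m * GG)); last by ring.
  by rewrite ler_wpM2l// mulr_ge0.
have h4 : GG ^+ 2 <= Cs ^+ m.+1 * \prod_(j < m.+1) wgt (tau j) (dW wp tau j.+1).
  rewrite /GG -prodrXl -[in Cs ^+ _](card_ord m.+1) -prodr_const -big_split/=.
  apply: ler_prod => j _; rewrite sqr_ge0/=; apply: Hs => //.
  have jT := Tsw_lt tau0 (ltn_ord j) mT; have [E _] := Tsw_step jT.
  by have := Tsw_ge0 t0T j tau0'; move: jT; rewrite E; lra.
have h5 : V ^+ 2 <= 2 * (wgt s z * (1 + D ^+ 2 / s ^+ 2)).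
  rewrite /V exprMn [leRHS]mulrCA; apply: ler_pM; rewrite ?exprn_ge0 ?addr_ge0//.
    by rewrite /wgt -/(q s z) (exprS _ 2) ler_peMl ?sqr_ge0// lerDl.
  have -> : D ^+ 2 / s ^+ 2 = (`|D| / s) ^+ 2 by rewrite expr_div_n real_normK ?num_real.
  have := sqr_ge0 (1 - `|D| / s); set dd := `|D| / s; nra.
rewrite -[leLHS]real_normK ?num_real//.
apply: (@le_trans _ _ ((Ct * T * Cp ^+ m * GG * V) ^+ 2)).
  by rewrite ler_pXn2r ?nnegrE// (le_trans _ h3).
have h6 : (Cp ^+ m) ^+ 2 <= (1 + Cp ^+ 2) ^+ m.+1.
  have c2 := sqr_ge0 Cp.
  rewrite exprAC [leRHS]exprS -[leLHS]mul1r; apply: ler_pM; rewrite ?exprn_ge0 ?lerDl//.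
  by apply: lerXn2r; rewrite ?nnegrE ?lerDr.
have Ct2 : 0 <= (Ct * T) ^+ 2 by exact: sqr_ge0.
have -> : (Ct * T * Cp ^+ m * GG * V) ^+ 2 =
  (Ct * T) ^+ 2 * (Cp ^+ m) ^+ 2 * GG ^+ 2 * V ^+ 2 by rewrite -!exprMn.
rewrite [leRHS](_ : _ = (Ct * T) ^+ 2 * (1 + Cp ^+ 2) ^+ m.+1 *
  (Cs ^+ m.+1 * \prod_(j < m.+1) wgt (tau j) (dW wp tau j.+1)) *
  (2 * (wgt s z * (1 + D ^+ 2 / s ^+ 2)))); last by rewrite (exprMn m.+1 (1 + Cp ^+ 2)); ring.
have a1 := sqr_ge0 (Ct * T); have a2 := sqr_ge0 (Cp ^+ m).
apply: ler_pM; [|exact: sqr_ge0| |exact: h5].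
  by apply: mulr_ge0; [exact: mulr_ge0|exact: sqr_ge0].
apply: ler_pM; [exact: mulr_ge0|exact: sqr_ge0| |exact: h4].
exact: ler_wpM2l.
Qed.

Lemma estimator0_le : exists2 C, 0 <= C & forall tau wp, (forall k, 0 < tau k) ->
  NT tau = 0%N ->
  estimator b sigma g f F T t0 x0 wp tau ^+ 2 <= C * (1 + `|dW wp tau 1| ^+ 2).
Proof.
pose A := e^-1 * (`|g x0| + K * (T * M)); pose B := e^-1 * (K * (N%:R * c)).
have A0 : 0 <= A by rewrite !mulr_ge0 ?invr_ge0 ?addr_ge0 ?mulr_ge0// ltW.
have B0 : 0 <= B by rewrite !mulr_ge0 ?invr_ge0// ltW.
exists (2 * A ^+ 2 + 2 * B ^+ 2); first by rewrite addr_ge0// mulr_ge0// sqr_ge0.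
move=> tau wp tau0 NT0.
have tau0' k : 0 <= tau k by exact: ltW.
rewrite /estimator NT0/= mulr0 add0r mulr1.
have /andP[t1 t2] := t0T.
have d0 : 0 <= dT tau 1 by rewrite /dT/= le_min (tau0' 0%N) subr_ge0.
have dTT : dT tau 1 <= T by rewrite /dT/= ge_min; apply/orP; right; lra.
have Fs : e <= 1 - F (dT tau 1) by exact: F_up.
have F0 : 0 < 1 - F (dT tau 1) by exact: lt_le_trans Fs.
set y := `|dW wp tau 1|.
have y0 : 0 <= y by exact: normr_ge0.
set h := _ / _.
have hB : `|h| <= A + B * y.
  rewrite /h normrM normfV (gtr0_norm F0) mulrC.
  rewrite /A /B -mulrA -mulrDr.
  apply: ler_pM; rewrite ?invr_ge0 ?(ltW F0)//; first by rewrite lef_pV2 ?posrE.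
  have -> : g (Xbar wp tau 1) = g x0 + (g (Xbar wp tau 1) - g x0) by rewrite addrC subrK.
  apply: (le_trans (ler_normD _ _)); rewrite -[leRHS]addrA lerD2l.
  apply: (le_trans (gK _ _)); rewrite -mulrA -mulrDr ler_wpM2l//.
  have XE (u v w : 'cV[R]_N) : u + v + w - u = v + w by rewrite -(addrA u) [u + _]addrC addrK.
  rewrite /= XE; apply: (le_trans (ler_normD _ _)); apply: lerD.
    by rewrite normrZ ger0_norm//; apply: ler_pM => //; exact: bM.
  apply: (le_trans (mx_norm_mulmx _ _)); rewrite -/y -mulrA ler_wpM2l// ler_wpM2r//.
  exact: sigma_norm.
rewrite -[leLHS]real_normK ?num_real//.
apply: (@le_trans _ _ ((A + B * y) ^+ 2)).
  by rewrite ler_pXn2r ?nnegrE// (le_trans _ hB).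
have := sqr_ge0 (A - B * y); have := sqr_ge0 A; have := sqr_ge0 B.
have := mulr_ge0 (sqr_ge0 A) (sqr_ge0 y).
rewrite !sqrrB !sqrrD !exprMn; set a2 := A ^+ 2; set b2 := B ^+ 2; set y2 := y ^+ 2.
set ab := A * (B * y) => i1 i2 i3 i4; nra.
Qed.

End pathwise.

(** * Conditioning on the past *)

Section functionals.
Context (R : realType) (n : nat).
Local Notation N := n.+1.

Definition process_on (d : measure_display) (S : measurableType d)
    (tau : S -> nat -> R) (wp : S -> R -> 'cV[R]_N) : Prop :=
  [/\ forall k, measurable_fun setT (fun s => tau s k),
      forall s k, 0 <= tau s k,
      forall t, 0 <= t -> mxmeas (fun s => wp s t) &
      forall s, {within `[0, +oo[, continuous (wp s)}].

(** Quantifying over all sample spaces replaces a sigma-algebra on the space of paths: the same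
    functional is evaluated on [Om], on products of spaces, and on copies of [Om] with a smaller
    sigma-algebra. *)
Definition mfunctional (d' : measure_display) (V : measurableType d')
    (Psi : (nat -> R) -> (R -> 'cV[R]_N) -> V) : Prop :=
  forall (d : measure_display) (S : measurableType d)
    (tau : S -> nat -> R) (wp : S -> R -> 'cV[R]_N),
  process_on tau wp -> measurable_fun setT (fun s => Psi (tau s) (wp s)).

Lemma mxmeas_mcol (d : measure_display) (S : measurableType d) (X : S -> 'cV[R]_N) :
  mxmeas X -> measurable_fun setT (X : S -> mcol R N).
Proof. by move=> mX; apply/measurable_colP => i; exact: mX. Qed.

Lemma measurable_wgt (d : measure_display) (S : measurableType d) (r : S -> R) (y : S -> 'cV[R]_N) :
  measurable_fun setT r -> mxmeas y -> measurable_fun setT (fun s => wgt (r s) (y s)).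
Proof.
move=> mr my; apply: measurable_funX; apply: measurable_funD => //.
apply: measurable_funM; last exact: measurable_invr.
apply: measurable_funX.
exact: (measurableT_comp (@measurable_norm_col R n) (mxmeas_mcol my)).
Qed.

Variables (b : R -> 'cV[R]_N -> 'cV[R]_N) (sigma : R -> 'cV[R]_N -> 'M[R]_N).
Variables (g : 'cV[R]_N -> R) (f F : R -> R) (T t0 : R) (x0 : 'cV[R]_N) (K : R).
Hypotheses (t0T : 0 <= t0 <= T) (rb : coef_regular T b) (rs : coef_regular T sigma).
Hypothesis us : forall t x, 0 <= t <= T -> sigma t x \in unitmx.
Hypothesis gK : forall y y', `|g y - g y'| <= K * `|y - y'|.
Hypotheses (mf : measurable_fun setT f) (mF : measurable_fun setT F).

Lemma measurable_lipschitz : measurable_fun setT (g : mcol R N -> R).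
Proof.
apply: (@measurable_comp_col _ (mcol R N) _ _ (fun _ x => g x) (fun y => y)).
- by move=> x; exact: measurable_cst.
- by move=> _; exact: (@lipschitz_cont _ 'cV[R]_N R^o g K).
- by move=> i; exact: measurable_coord.
Qed.

Lemma measurable_g (d : measure_display) (S : measurableType d) (X : S -> 'cV[R]_N) :
  mxmeas X -> measurable_fun setT (fun s => g (X s)).
Proof. by move=> mX; exact: (measurableT_comp measurable_lipschitz (mxmeas_mcol mX)). Qed.

Section on_space.
Context (d : measure_display) (S : measurableType d).
Variables (tau : S -> nat -> R) (wp : S -> R -> 'cV[R]_N).
Hypothesis pro : process_on tau wp.

Let mtau k : measurable_fun setT (fun s => tau s k). Proof. by case: pro. Qed.
Let tau0 s k : 0 <= tau s k. Proof. by case: pro. Qed.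
Let mTsw k : measurable_fun setT (fun s => Tsw T t0 (tau s) k).
Proof. exact: measurable_Tsw. Qed.
Let mpath (X : S -> R) : measurable_fun setT X -> (forall s, 0 <= X s) -> mxmeas (fun s => wp s (X s)).
Proof. by case: pro => _ _ mwp cwp; exact: mxmeas_path. Qed.
Let mwT k : mxmeas (fun s => wp s (Tsw T t0 (tau s) k)).
Proof. by apply: mpath => // s; exact: Tsw_ge0. Qed.
Let mX k : mxmeas (fun s => Xbar b sigma T t0 x0 (wp s) (tau s) k).
Proof. exact: (mxmeas_Xbar x0 t0T mtau tau0 rb rs (fun j _ => mwT j) (leqnn k)). Qed.

Lemma measurable_Phi m :
  measurable_fun setT (fun s => Phi b sigma g T t0 x0 m (tau s) (wp s)).
Proof.
have mz : mxmeas (fun s => wp s T - wp s (Tsw T t0 (tau s) m)).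
  apply: mxmeasB; last exact: mwT.
  by apply: mpath => // s; case/andP: t0T => h1 h2; exact: le_trans h2.
have mlen : measurable_fun setT (fun s => T - Tsw T t0 (tau s) m) by exact: measurable_funB.
apply: measurable_funM; first apply: measurable_funM.
- have -> : (fun s => (Tsw T t0 (tau s) m < T)%R%:R) =
      (fun s => if Tsw T t0 (tau s) m < T then 1 else 0) :> (S -> R).
    by apply/funext => s; case: (_ < _).
  apply: measurable_fun_ifT => //; exact: measurable_fun_ltr.
- apply: measurable_prod => j _; apply: measurable_wgt => //.
  exact: (mxmeas_dW (fun j _ => mwT j) (leqnn j.+1)).
- apply: measurable_funM; first exact: measurable_wgt.
  apply: measurable_funD => //; apply: measurable_funM; last first.
    by apply: measurable_invr; exact: measurable_funX.
  apply: measurable_funX; apply: (measurable_diff2 measurable_lipschitz).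
    exact: (mxmeas_mcol (mX m)).
  apply: mxmeas_mcol; apply: mxmeasM => //.
  exact: (mxmeas_sk x0 t0T mtau tau0 rb rs (fun j _ => mwT j) (leqnn m)).
Qed.

Lemma measurable_first_step :
  measurable_fun setT (fun s => wgt (dT T t0 (tau s) 1) (dW T t0 (wp s) (tau s) 1)).
Proof. by apply: measurable_wgt; [exact: measurable_dT|exact: (mxmeas_dW (fun j _ => mwT j) (leqnn 1))]. Qed.

(** The estimator with [NT] frozen at [i], to be glued over the countably many fibres of [NT]. *)
Let est_at (i : nat) (s : S) : R :=
  let X := Xbar b sigma T t0 x0 (wp s) (tau s) in
  let M := Mw b sigma T t0 x0 (wp s) (tau s) i.+1 in
  let V := Vw b sigma T t0 x0 (wp s) (tau s) i.+1 in
  let h := Xhat b sigma T t0 x0 (wp s) (tau s) i.+1 in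
  2^-1 * ((g (X i.+1) - g (X i)) / (1 - F (dT T t0 (tau s) i.+1))
            * ((M + 2^-1 * V) / f (dT T t0 (tau s) i)) +
          (g h - g (X i)) / (1 - F (dT T t0 (tau s) i.+1))
            * ((- M + 2^-1 * V) / f (dT T t0 (tau s) i)))
  * (\prod_(2 <= k < i.+1) Pw b sigma f T t0 x0 (wp s) (tau s) k) * (1 <= i)%N%:R
  + g (X 1%N) / (1 - F (dT T t0 (tau s) 1%N)) * (i == 0%N)%:R.

Lemma measurable_estimator :
  measurable_fun setT (fun s => estimator b sigma g f F T t0 x0 (wp s) (tau s)).
Proof.
have mdT k : measurable_fun setT (fun s => dT T t0 (tau s) k) by exact: measurable_dT.
have mM k : measurable_fun setT (fun s => Mw b sigma T t0 x0 (wp s) (tau s) k).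
  exact: (measurable_Mw x0 t0T mtau tau0 rb rs (fun j _ => mwT j) us (leqnn k)).
have mV k : measurable_fun setT (fun s => Vw b sigma T t0 x0 (wp s) (tau s) k).
  exact: (measurable_Vw x0 t0T mtau tau0 rb rs (fun j _ => mwT j) us (leqnn k)).
have mfd k : measurable_fun setT (fun s => (f (dT T t0 (tau s) k))^-1).
  by apply: measurable_invr; exact: measurableT_comp.
have mFd k : measurable_fun setT (fun s => (1 - F (dT T t0 (tau s) k))^-1).
  by apply: measurable_invr; apply: measurable_funB => //; exact: measurableT_comp.
have mgX k : measurable_fun setT (fun s => g (Xbar b sigma T t0 x0 (wp s) (tau s) k)).
  exact: measurable_g.
have mgh k : measurable_fun setT (fun s => g (Xhat b sigma T t0 x0 (wp s) (tau s) k)).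
  by apply: measurable_g; exact: (mxmeas_Xhat x0 t0T mtau tau0 rb rs (fun j _ => mwT j) (leqnn k)).
have mPw k : measurable_fun setT (fun s => Pw b sigma f T t0 x0 (wp s) (tau s) k).
  by apply: measurable_funM => //; apply: measurable_funD => //; exact: measurable_funM.
apply: (@measurable_countable_case _ S R nat (fun s => NT T t0 (tau s)) est_at).
  by move=> i; exact: measurable_NT_fiber.
move=> i; rewrite /est_at; apply: measurable_funD; last first.
  by apply: measurable_funM => //; exact: measurable_funM.
apply: measurable_funM => //; apply: measurable_funM; last exact: measurable_prod.
apply: measurable_funM => //; apply: measurable_funD.
- apply: measurable_funM; first by apply: measurable_funM => //; exact: measurable_funB.
  by apply: measurable_funM => //; apply: measurable_funD => //; exact: measurable_funM.
- apply: measurable_funM; first by apply: measurable_funM => //; exact: measurable_funB.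
  apply: measurable_funM => //; apply: measurable_funD; last exact: measurable_funM.
  exact: measurableT_comp.
Qed.

End on_space.
End functionals.

(** * Independence of the path and the waiting times *)

Section independence.
Context (R : realType) (n : nat) (d : measure_display) (Om : measurableType d)
  (P : probability Om R).
Local Notation N := n.+1.
Local Notation mu := (@lebesgue_measure R).
Variables (W : R -> Om -> 'cV[R]_N) (tau : nat -> Om -> R) (kappa theta : R).
Hypotheses (hW : is_brownian P W) (htau : iid_gamma P kappa theta tau)
  (hWtau : indep_process P W tau).

Let path (w : Om) (t : R) : 'cV[R]_N := W t w.
Let wait (w : Om) (k : nat) : R := tau k w.
Let Wc (p : R * 'I_N) (w : Om) : R := W p.1 w p.2 0.

Let mW t : 0 <= t -> mxmeas (W t).
Proof. by case: hW => h _ _ _ _ t0 i j; rewrite ord1; exact: h. Qed.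

Let mWc u p : [set p : R * 'I_N | 0 <= p.1 <= u] p -> measurable_fun setT (Wc p).
Proof. by move=> /= /andP[p0 _]; exact: mW. Qed.

(** [Om] with the sigma-algebra of the path up to [u]. A deterministic [u] is enough, since the
    waiting times are fixed before the path is integrated. *)
Definition past_type (u : R) := famT [set p : R * 'I_N | 0 <= p.1 <= u] Wc.

Lemma past_path u t : 0 <= t <= u -> mxmeas (fun w : past_type u => W t w).
Proof.
move=> tu i j; rewrite ord1.
exact: (@measurable_famT _ _ _ _ _ _ (t, i)).
Qed.

Lemma increment_gauss s t : 0 <= s -> s < t -> is_gauss P (fun w => W t w - W s w) (t - s).
Proof.
move=> s0 st; have t0 : 0 <= t by rewrite (le_trans s0)// ltW.
have mI : mxmeas (fun w => W t w - W s w) by apply: mxmeasB; exact: mW.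
split; first exact: mxmeas_mcol.
move=> G mG G0; case: hW => _ _ _ _ /(_ s t s0 st)[ind law].
have := @column_law _ _ _ P N (fun i w => (W t w - W s w) i 0) (normal_pdf 0 (Num.sqrt (t - s))).
move=> /(_ (fun i => mI i 0)) H.
have mp : measurable_fun setT (normal_pdf 0 (Num.sqrt (t - s)) : R -> R) by exact: measurable_normal_pdf.
have p0 u : 0 <= normal_pdf 0 (Num.sqrt (t - s)) u by exact: normal_pdf_ge0.
rewrite -(H ind mp p0 law G mG G0); apply: eq_integral => w _; congr G.
by apply/matrixP => i j; rewrite !mxE ord1.
Qed.

(** The path up to [u] stays in the first sample, its increment after [u] is drawn from the
    second. *)
Lemma past_integral u t (Psi : past_type u * mcol R N -> \bar R) :
  0 <= u -> u <= t -> measurable_fun setT Psi -> (forall x, 0 <= Psi x)%E ->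
  (\int[P]_w Psi (w, (W t w - W u w)%R) = \int[P]_w1 \int[P]_w2 Psi (w1, (W t w2 - W u w2)%R))%E.
Proof.
move=> u0 ut mPsi Psi0; have t0 := le_trans u0 ut.
have mI : measurable_fun setT ((fun w => W t w - W u w) : Om -> mcol R N).
  by apply: mxmeas_mcol; apply: mxmeasB; exact: mW.
have mid : measurable_fun setT (fun w : Om => w : past_type u).
  by apply: measurable_id_famT; exact: mWc.
apply: (@indep_integral _ _ _ Om (past_type u) (mcol R N) R P _ _ mid mI) => // A B mA mB.
case: hW => _ _ _ /(_ u t u0 ut) ind _; apply: ind; first exact: mA.
pose Y (i : 'I_N) (w : Om) := (W t w - W u w) i 0.
have mY : measurable_fun setT ((fun w => W t w - W u w) : famT setT Y -> mcol R N).
  by apply/measurable_colP => i; exact: (@measurable_famT _ _ _ _ setT Y i).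
by have := mY measurableT B mB; rewrite setTI.
Qed.

Lemma wait_gt0 w k : 0 < wait w k. Proof. by case: htau => _ h _ _; exact: h. Qed.

Lemma path_cont w : {within `[0, +oo[, continuous (path w)}.
Proof. by case: hW => _ _ h _ _; exact: h. Qed.

Lemma process_Om : process_on wait path.
Proof.
split; [by case: htau|by move=> w k; exact/ltW/wait_gt0|exact: mW|exact: path_cont].
Qed.

Lemma process_prod (d' : measure_display) (S : measurableType d') (t : S -> nat -> R) :
  (forall k, measurable_fun setT (fun s => t s k)) -> (forall s k, 0 <= t s k) ->
  process_on (fun p : S * Om => t p.1) (fun p => path p.2).
Proof.
move=> mt t0; split.
- by move=> k; exact: (measurableT_comp (mt k) measurable_fst).
- by move=> p k; exact: t0.
- by move=> r r0 i j; exact: (measurableT_comp (mW r0 i j) measurable_snd).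
- by move=> p; exact: path_cont.
Qed.

Section functional.
Variable Psi : (nat -> R) -> (R -> 'cV[R]_N) -> \bar R.
Hypotheses (mPsi : mfunctional Psi) (Psi0 : forall t w, (0 <= Psi t w)%E).

(** Once the waiting times come from a sample of their own, the switching times are constants for
    the path, and its increments over the steps are Gaussian. *)
Lemma decouple :
  (\int[P]_w Psi (wait w) (path w) = \int[P]_w1 \int[P]_w2 Psi (wait w1) (path w2))%E.
Proof.
pose T1 := famT [set: nat] tau; pose D2 := [set p : R * 'I_N | 0 <= p.1].
pose T2 := famT D2 Wc.
have m1 : measurable_fun setT (fun w : Om => w : T1).
  by apply: measurable_id_famT => k _; case: htau.
have m2 : measurable_fun setT (fun w : Om => w : T2).
  by apply: measurable_id_famT => p /= p0; exact: mW.
apply: (@indep_integral _ _ _ Om T1 T2 R P _ _ m1 m2 _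
   (fun p : T1 * T2 => Psi (wait p.1) (path p.2))) => //.
  move=> A B mA mB; rewrite setIC muleC; apply: hWtau; first exact: mB.
  exact: mA.
apply: (mPsi (tau := fun p : T1 * T2 => wait p.1) (wp := fun p : T1 * T2 => path p.2)); split.
- move=> k; apply: (measurableT_comp (f := tau k : T1 -> R)); last exact: measurable_fst.
  exact: (@measurable_famT _ _ _ _ setT tau k).
- by move=> p k; exact/ltW/wait_gt0.
- move=> r r0 i j; rewrite ord1.
  apply: (measurableT_comp (f := Wc (r, i) : T2 -> R)); last exact: measurable_snd.
  exact: (@measurable_famT _ _ _ _ D2 Wc (r, i)).
- by move=> p; exact: path_cont.
Qed.

Lemma measurable_marginal (d' : measure_display) (S : measurableType d') (t : S -> nat -> R) :
  (forall k, measurable_fun setT (fun s => t s k)) -> (forall s k, 0 <= t s k) ->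
  measurable_fun setT (fun s => \int[P]_w Psi (t s) (path w))%E.
Proof.
move=> mt t0.
apply: (@measurable_fun_fubini_tonelli_F _ _ S Om R P (fun p => Psi (t p.1) (path p.2))) => //.
exact: (mPsi (process_prod mt t0)).
Qed.

End functional.

Lemma gamma_mass : (\int[mu]_u (gamma_pdf kappa theta u)%:E = 1)%E.
Proof.
case: htau => _ _ _ law; have := law 0%N setT measurableT.
by rewrite preimage_setT probability_setT.
Qed.

(* The absolute value and the dummy 1 keep the spliced waiting times nonnegative. *)
Definition splice (t : nat -> R) (k : nat) (u : R) (j : nat) : R :=
  if (j < k)%N then t j else if j == k then `|u| else 1.

(** Integrates out the waiting time of index [k] given the earlier ones. Since [Psi] ignores all
    later waiting times, these may be filled in arbitrarily. *)
Lemma splice_integral (Psi : (nat -> R) -> \bar R) (k : nat) :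
  (forall (d' : measure_display) (S : measurableType d') (t : S -> nat -> R),
    (forall j, measurable_fun setT (fun s => t s j)) -> (forall s j, 0 <= t s j) ->
    measurable_fun setT (fun s => Psi (t s))) ->
  (forall t, 0 <= Psi t)%E ->
  (forall t t', (forall j, (j <= k)%N -> t j = t' j) -> Psi t = Psi t') ->
  (\int[P]_w Psi (wait w) = \int[P]_w \int[mu]_u ((gamma_pdf kappa theta u)%:E * Psi (splice (wait w) k u)))%E.
Proof.
move=> mPsi Psi0 extPsi.
have mtau j : measurable_fun setT (tau j) by case: htau.
pose s := iota 0 k; pose T1 := famT [set j | j \in s] tau.
have m1 : measurable_fun setT (fun w : Om => w : T1) by exact: measurable_id_famT.
pose Phi (p : T1 * R) := Psi (splice (wait p.1) k p.2).
have m1s j : measurable_fun setT (fun w : T1 => if (j < k)%N then tau j w else 1).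
  case jk : (j < k)%N; last exact: measurable_cst.
  apply: (@measurable_famT _ _ _ _ [set j | j \in s] tau j).
  by rewrite /= mem_iota add0n jk.
have mPhi : measurable_fun setT Phi.
  apply: (mPsi _ _ (fun p : T1 * R => splice (wait p.1) k p.2)).
    move=> j; rewrite /splice.
    case jk : (j < k)%N.
      have := m1s j; rewrite jk => mj; exact: (measurableT_comp mj measurable_fst).
    case: (j == k); last exact: measurable_cst.
    by apply: measurableT_comp => //; exact: measurable_snd.
  by move=> p j; rewrite /splice; case: ifP => // _; [exact/ltW/wait_gt0|case: ifP].
have indk A B : measurable (A : set T1) -> measurable (B : set R) ->
    P ((fun w => w : T1) @^-1` A `&` tau k @^-1` B) =
    (P ((fun w => w : T1) @^-1` A) * P (tau k @^-1` B))%E.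
  move=> mA mB; case: htau => _ _ indt _.
  by apply: (mutual_indep_past mtau indt _ mB mA); rewrite mem_iota add0n ltnn.
have E := @indep_integral _ _ _ Om T1 R R P _ _ m1 (mtau k) indk Phi mPhi (fun p => Psi0 _).
transitivity (\int[P]_w Phi (w, tau k w))%E.
  apply: eq_integral => w _; apply: extPsi => j; rewrite leq_eqVlt /splice => /orP[/eqP->|->//].
  by rewrite ltnn eqxx gtr0_norm// wait_gt0.
rewrite E; apply: eq_integral => w _.
case: htau => _ _ _ law.
have mf : measurable_fun setT (gamma_pdf kappa theta) by exact: measurable_gamma_pdf.
have f0 u : 0 <= gamma_pdf kappa theta u by exact: gamma_pdf_ge0.
apply: (@density_integral _ Om R P (tau k) _ (mtau k) mf f0 (law k)
  (fun u => Psi (splice (wait w) k u))) => //.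
apply: (measurableT_comp mPhi (g := fun u : R => (w : T1, u))).
exact: measurable_fun_pair.
Qed.

End independence.

Section extensionality.
Context (R : realType) (n : nat).
Local Notation N := n.+1.
Variables (b : R -> 'cV[R]_N -> 'cV[R]_N) (sigma : R -> 'cV[R]_N -> 'M[R]_N).
Variables (g : 'cV[R]_N -> R) (T t0 : R) (x0 : 'cV[R]_N).

Lemma eq_Tsw (t t' : nat -> R) k : (forall j, (j < k)%N -> t j = t' j) ->
  Tsw T t0 t k = Tsw T t0 t' k.
Proof.
elim: k => //= k IH tt'; rewrite IH => [|j jk]; last by apply: tt'; exact: ltnW.
by rewrite tt'.
Qed.

Lemma eq_dW (t t' : nat -> R) (wp : R -> 'cV[R]_N) k : (forall j, (j < k)%N -> t j = t' j) ->
  dW T t0 wp t k = dW T t0 wp t' k.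
Proof.
move=> tt'; rewrite /dW (eq_Tsw tt') (@eq_Tsw t t' k.-1)// => j jk.
by apply: tt'; exact: leq_trans jk (leq_pred _).
Qed.

Lemma eq_Xbar (t t' : nat -> R) (wp : R -> 'cV[R]_N) k : (forall j, (j < k)%N -> t j = t' j) ->
  Xbar b sigma T t0 x0 wp t k = Xbar b sigma T t0 x0 wp t' k.
Proof.
elim: k => //= k IH tt'.
have tt k' : (k' <= k)%N -> forall j, (j < k')%N -> t j = t' j.
  by move=> kk j jk; apply: tt'; apply: (leq_trans jk); exact: leqW.
rewrite IH; last exact: tt.
rewrite (eq_dW _ (tt' : forall j, (j < k.+1)%N -> _)) /dT/=.
by rewrite (eq_Tsw (tt k (leqnn k))) tt'.
Qed.

Lemma eq_Phi (t t' : nat -> R) (wp : R -> 'cV[R]_N) k : (forall j, (j < k)%N -> t j = t' j) ->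
  Phi b sigma g T t0 x0 k t wp = Phi b sigma g T t0 x0 k t' wp.
Proof.
move=> tt'; rewrite /Phi /sk (eq_Tsw tt') (eq_Xbar _ tt'); congr (_ * _ * _).
apply: eq_bigr => j _; rewrite tt'// (@eq_dW t t')// => i ij.
by apply: tt'; exact: (leq_trans ij).
Qed.

End extensionality.

(** * The last two steps *)

Section fixed_times.
Context (R : realType) (n : nat) (d : measure_display) (Om : measurableType d)
  (P : probability Om R).
Local Notation N := n.+1.
Local Notation std := (std_basis R N).
Variables (W : R -> Om -> 'cV[R]_N) (hW : is_brownian P W).
Variables (b : R -> 'cV[R]_N -> 'cV[R]_N) (sigma : R -> 'cV[R]_N -> 'M[R]_N).
Variables (g : 'cV[R]_N -> R) (T t0 : R) (x0 : 'cV[R]_N) (K M c : R).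
Hypotheses (t0T : 0 <= t0 <= T) (rb : coef_regular T b) (rs : coef_regular T sigma).
Hypotheses (T0 : 0 < T) (K0 : 0 <= K) (c0 : 0 < c).
Hypothesis gK : forall y y', `|g y - g y'| <= K * `|y - y'|.

Let path (w : Om) (t : R) : 'cV[R]_N := W t w.
Local Notation Tsw := (Tsw T t0).
Local Notation Phi := (Phi b sigma g T t0 x0).
Local Notation Xb := (Xbar b sigma T t0 x0).

Lemma wgt_ge0 r (y : 'cV[R]_N) : 0 <= r -> 0 <= wgt r y.
Proof. by move=> r0; rewrite exprn_ge0// addr_ge0// divr_ge0 ?sqr_ge0. Qed.

Definition past_wgt (t : nat -> R) (k : nat) (w : Om) : R :=
  \prod_(j < k) wgt (t j) (dW T t0 (path w) t j.+1).

Lemma past_wgt_ge0 t k w : (forall j, 0 < t j) -> 0 <= past_wgt t k w.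
Proof. by move=> tp; apply: prodr_ge0 => j _; rewrite wgt_ge0// ltW. Qed.

Section positive_times.
Variable t : nat -> R.
Hypothesis tp : forall j, 0 < t j.

Let t_ge0 j : 0 <= t j. Proof. exact/ltW. Qed.

Lemma past_mpath k j : (j <= k)%N -> mxmeas (fun w : past_type W (Tsw t k) => path w (Tsw t j)).
Proof.
by move=> jk; apply: past_path; rewrite Tsw_ge0//=; exact: Tsw_mono.
Qed.

Lemma past_dW k j : (j <= k)%N ->
  mxmeas (fun w : past_type W (Tsw t k) => dW T t0 (path w) t j).
Proof. by move=> jk; exact: (mxmeas_dW (tau := fun=> t) (past_mpath (k := k)) jk). Qed.

Lemma past_Xbar k : mxmeas (fun w : past_type W (Tsw t k) => Xb (path w) t k).
Proof.
exact: (mxmeas_Xbar x0 t0T (tau := fun=> t) (fun=> measurable_cst _) (fun _ => t_ge0) rb rs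
  (past_mpath (k := k)) (leqnn k)).
Qed.

Lemma past_bk k : mxmeas (fun w : past_type W (Tsw t k) => bk b sigma T t0 x0 (path w) t k).
Proof.
exact: (mxmeas_bk x0 t0T (tau := fun=> t) (fun=> measurable_cst _) (fun _ => t_ge0) rb rs
  (past_mpath (k := k)) (leqnn k)).
Qed.

Lemma past_sk k : mxmeas (fun w : past_type W (Tsw t k) => sk b sigma T t0 x0 (path w) t k).
Proof.
exact: (mxmeas_sk x0 t0T (tau := fun=> t) (fun=> measurable_cst _) (fun _ => t_ge0) rb rs
  (past_mpath (k := k)) (leqnn k)).
Qed.

Lemma measurable_past_wgt k j : (j <= k)%N ->
  measurable_fun setT (past_wgt t j : past_type W (Tsw t k) -> R).
Proof.
move=> jk; apply: measurable_prod => i _; apply: measurable_wgt => //.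
by apply: past_dW; exact: leq_trans jk.
Qed.

End positive_times.

Lemma measurable_past_wgt_Om t k : (forall j, 0 < t j) ->
  measurable_fun setT (past_wgt t k).
Proof.
move=> tp; apply: measurable_prod => j _; apply: measurable_wgt => //.
case: hW => mW _ _ _ _.
have t_ge0 i : 0 <= t i by exact/ltW.
by apply: mxmeasB => i i'; rewrite ord1; apply: mW; exact: Tsw_ge0.
Qed.

(** The newest increment is independent of the past weights and its weight has a moment independent
    of the step length, by scaling; each step costs the same constant. *)
Lemma past_moment : exists2 C : R, 0 <= C & forall t k, (forall j, 0 < t j) -> Tsw t k < T ->
  (\int[P]_w (past_wgt t k w)%:E <= (C ^+ k)%:E)%E.
Proof.
have [C C0 HC] := gauss_moment P n; exists C => // t k tp.
have t_ge0 j : 0 <= t j by exact/ltW.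
elim: k => [|k IH] kT.
  under eq_integral do rewrite /past_wgt big_ord0.
  have -> : (\int[P]_(_ in setT) 1%:E = 1%:E * P setT)%E by exact: integral_cst.
  by rewrite probability_setT mule1 expr0.
have [TE _] := Tsw_step kT; have {}IH := IH (Tsw_lt t0T tp (leqnSn _) kT).
have S0 := Tsw_ge0 t0T k t_ge0.
have SS : Tsw t k < Tsw t k.+1 by rewrite TE ltrDl.
pose Psi (p : past_type W (Tsw t k) * mcol R N) : \bar R := (past_wgt t k p.1 * wgt (t k) p.2)%:E.
have mPsi : measurable_fun setT Psi.
  apply/measurable_EFinP; apply: measurable_funM.
    exact: (measurableT_comp (measurable_past_wgt tp (leqnn k)) measurable_fst).
  apply: measurable_wgt => // i j; rewrite ord1.
  exact: (measurableT_comp (@measurable_coord R N i) measurable_snd).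
have Psi0 p : (0 <= Psi p)%E.
  by rewrite lee_fin mulr_ge0 ?past_wgt_ge0// wgt_ge0.
have E := past_integral hW S0 (ltW SS) mPsi Psi0.
have -> : (\int[P]_w (past_wgt t k.+1 w)%:E = \int[P]_w Psi (w, (W (Tsw t k.+1) w - W (Tsw t k) w)%R))%E.
  by apply: eq_integral => w _; rewrite /past_wgt big_ord_recr.
rewrite E; have G := increment_gauss hW S0 SS.
have rE : Tsw t k.+1 - Tsw t k = t k by rewrite TE addrC addKr.
rewrite rE in G.
have mI : measurable_fun setT (fun w => wgt (t k) (W (Tsw t k.+1) w - W (Tsw t k) w)).
  by apply: measurable_wgt => // i j; rewrite ord1; case: G => /measurable_colP.
apply: (@le_trans _ _ (\int[P]_w (C%:E * (past_wgt t k w)%:E))%E).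
  apply: le_integral_ge0 => w _; first by apply: integral_ge0 => w2 _; exact: Psi0.
  have -> : (\int[P]_w2 Psi (w, (W (Tsw t k.+1) w2 - W (Tsw t k) w2)%R) =
      (past_wgt t k w)%:E * \int[P]_w2 (wgt (t k) (W (Tsw t k.+1) w2 - W (Tsw t k) w2))%:E)%E.
    rewrite -ge0_integralZl//.
    - exact/measurable_EFinP.
    - by move=> w2 _; rewrite lee_fin wgt_ge0.
    - by rewrite lee_fin past_wgt_ge0.
  rewrite muleC lee_wpmul2r ?lee_fin ?past_wgt_ge0//.
  exact: HC.
rewrite ge0_integralZl//; last 2 first.
- by apply/measurable_EFinP; exact: measurable_past_wgt_Om.
- by move=> w _; rewrite lee_fin past_wgt_ge0.
by rewrite exprS EFinM lee_wpmul2l ?lee_fin.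
Qed.

Local Notation lam := (laplace_rate n c).

Let lam0 : 0 < lam. Proof. exact: laplace_rate_gt0. Qed.

Lemma gl_nneg (L : R) (y : 'cV[R]_N) : 0 <= L -> 0 <= gl L y.
Proof. by move=> L0; rewrite mulr_ge0 ?expR_ge0// invr_ge0 exprn_ge0. Qed.

(** Mean square of the second difference of [g] at [x], with a Laplace displacement of scale
    [Num.sqrt s / lam] in place of the last diffusion increment. *)
Definition osc (s : R) (x : 'cV[R]_N) : \bar R :=
  Jint std (fun h => (gl (Num.sqrt s / lam) h)%:E * ((diff2 g x h) ^+ 2)%:E)%E 0.

Let gls0 s (y : 'cV[R]_N) : 0 <= gl (Num.sqrt s / lam) y.
Proof. by apply: gl_nneg; rewrite divr_ge0 ?sqrtr_ge0// ltW. Qed.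

Lemma osc_ge0 s x : (0 <= osc s x)%E.
Proof. by apply: Jint_ge0 => h; rewrite mule_ge0// lee_fin ?sqr_ge0. Qed.

Let mg : measurable_fun setT (g : mcol R N -> R). Proof. exact: measurable_lipschitz gK. Qed.

Let mdiff x : measurable_fun setT ((fun h => diff2 g x h ^+ 2) : mcol R N -> R).
Proof. by apply: measurable_funX; exact: (measurable_diff2 mg (Y := fun=> x)). Qed.

Lemma measurable_osc (d' : measure_display) (S : measurableType d') (s : S -> R) (x : S -> 'cV[R]_N) :
  measurable_fun setT s -> mxmeas x -> measurable_fun setT (fun p => osc (s p) (x p)).
Proof.
move=> ms mx.
have mgl : measurable_fun setT (fun p : S * mcol R N => gl (Num.sqrt (s p.1) / lam) p.2).
  have mL : measurable_fun setT (fun p : S * mcol R N => Num.sqrt (s p.1) / lam).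
    apply: measurable_funM => //; apply: (measurableT_comp (@measurable_sqrtr R)).
    exact: (measurableT_comp ms measurable_fst).
  apply: measurable_funM; first by apply: measurable_invr; exact: measurable_funX.
  apply: (measurableT_comp (@measurable_expR R)); apply: measurableT_comp => //.
  apply: measurable_funM; last exact: measurable_invr.
  exact: (measurableT_comp (@measurable_l1norm R N) measurable_snd).
have mF : measurable_fun setT (fun p : S * mcol R N =>
    ((gl (Num.sqrt (s p.1) / lam) p.2)%:E * ((diff2 g (x p.1) p.2) ^+ 2)%:E)%E).
  apply: emeasurable_funM; first exact/measurable_EFinP.
  apply/measurable_EFinP; apply: measurable_funX; apply: (measurable_diff2 mg).
    exact: (measurableT_comp (mxmeas_mcol mx) measurable_fst).
  exact: measurable_snd.
have F0 p h : (0 <= (gl (Num.sqrt (s p) / lam) h)%:E * ((diff2 g (x p) h) ^+ 2)%:E)%E.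
  by rewrite mule_ge0// lee_fin ?sqr_ge0.
have H := @measurable_Jint R N _ S std _ mF F0.
apply: (measurableT_comp H (g := fun p : S => (p, 0 : mcol R N))).
exact: measurable_fun_pair.
Qed.

Lemma osc_le : exists2 C : R, 0 <= C & forall s x, 0 < s -> (osc s x <= (C * s)%:E)%E.
Proof.
pose m := lap_mass R n; have m0 : 0 <= m by exact: lap_mass_ge0.
pose C := 4 * K ^+ 2 * (16 * (lam ^+ 2)^-1 * 2 ^+ N * m).
have C0 : 0 <= C.
  have h1 := sqr_ge0 K; have h2 : 0 <= (lam ^+ 2)^-1 by rewrite invr_ge0 sqr_ge0.
  have h3 : 0 <= 2 ^+ N :> R by exact: exprn_ge0.
  by rewrite mulr_ge0// ?mulr_ge0.
exists C => // s x s0; have [L LE] : exists L, L = Num.sqrt s / lam by eexists.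
have L0 : 0 < L by rewrite LE divr_gt0 ?sqrtr_gt0.
have L20 : 0 < 2 * L by rewrite mulr_gt0.
have L2 : L ^+ 2 = s / lam ^+ 2 by rewrite LE expr_div_n sqr_sqrtr// ltW.
have cst0 : 0 <= 4 * K ^+ 2 * (16 * L ^+ 2 * 2 ^+ N).
  have h1 := sqr_ge0 K; have h2 := sqr_ge0 L.
  have h3 : 0 <= 2 ^+ N :> R by exact: exprn_ge0.
  apply: mulr_ge0; first exact: mulr_ge0.
  by apply: mulr_ge0 => //; exact: mulr_ge0.
apply: (@le_trans _ _ (Jint std (fun h => (4 * K ^+ 2 * (16 * L ^+ 2 * 2 ^+ N))%:E * (gl (2 * L) h)%:E)%E 0)).
  apply: le_Jint => h; first by rewrite mule_ge0// lee_fin ?sqr_ge0.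
  rewrite -!EFinM lee_fin -LE.
  have D : diff2 g x h ^+ 2 <= 4 * K ^+ 2 * `|h| ^+ 2.
    have d1 : `|g (x + h) - g x| <= K * `|h| by apply: (le_trans (gK _ _)); rewrite addrAC subrr add0r.
    have d2 : `|g (x - h) - g x| <= K * `|h|.
      by apply: (le_trans (gK _ _)); rewrite addrAC subrr add0r normrN.
    have -> : diff2 g x h = (g (x + h) - g x) + (g (x - h) - g x) by rewrite /diff2; ring.
    have -> : 4 * K ^+ 2 * `|h| ^+ 2 = (K * `|h| + K * `|h|) ^+ 2 by ring.
    rewrite -[leLHS]real_normK ?num_real// ler_pXn2r ?nnegrE ?addr_ge0 ?mulr_ge0//.
    by apply: (le_trans (ler_normD _ _)); exact: lerD.
  (* Half of the exponential decay pays for the square of [h], which doubles the scale of the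
     kernel; [2 ^+ N] restores its normalisation. *)
  have hl : `|h| ^+ 2 * gl L h <= 16 * L ^+ 2 * 2 ^+ N * gl (2 * L) h.
    rewrite /gl /laplace exprMn.
    set a := l1norm h; have a0 : 0 <= a by exact: l1norm_ge0.
    have ha : `|h| <= a by exact: le_l1norm.
    have e1 : a / L / 4 <= expR (a / L / 4) by apply: le_trans (expR_ge1Dx _); lra.
    have e2 : `|h| ^+ 2 <= 16 * L ^+ 2 * expR (a / L / 2).
      have -> : expR (a / L / 2) = expR (a / L / 4) ^+ 2.
        by rewrite -expRM_natl; congr expR; field; rewrite gt_eqF.
      have -> : 16 * L ^+ 2 * expR (a / L / 4) ^+ 2 = (4 * L * expR (a / L / 4)) ^+ 2 by ring.
      rewrite ler_pXn2r ?nnegrE ?mulr_ge0 ?expR_ge0 ?(ltW L0)//.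
      apply: (le_trans ha); rewrite -ler_pdivrMl ?mulr_gt0//.
      by apply: le_trans e1; rewrite le_eqVlt; apply/orP; left; apply/eqP; field; rewrite gt_eqF.
    have e3 : expR (- (a / (2 * L))) = expR (a / L / 2) * expR (- (a / L)).
      by rewrite -expRD; congr expR; field; rewrite gt_eqF.
    rewrite e3.
    have p0 : 0 <= L ^- N * expR (- (a / L)) by rewrite mulr_ge0 ?expR_ge0// invr_ge0 exprn_ge0// ltW.
    apply: (le_trans (ler_wpM2r p0 e2)).
    rewrite le_eqVlt; apply/orP; left; apply/eqP.
    have t2 : 2 ^+ N != 0 :> R by rewrite expf_neq0.
    have tL : L ^+ N != 0 by rewrite expf_neq0// gt_eqF.
    by field; rewrite t2 tL.
  have := gls0 s h; rewrite -LE mulrC => gl0; apply: (le_trans (ler_wpM2r gl0 D)).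
  rewrite [leLHS](_ : _ = (4 * K ^+ 2) * (`|h| ^+ 2 * gl L h)); last by ring.
  rewrite [leRHS](_ : _ = (4 * K ^+ 2) * (16 * L ^+ 2 * 2 ^+ N * gl (2 * L) h)); last by ring.
  by rewrite ler_wpM2l// mulr_ge0// sqr_ge0.
rewrite Jint_mull//; last 2 first.
- by apply/measurable_EFinP; exact: measurable_gl.
- by move=> h; rewrite lee_fin gl_nneg// ltW.
rewrite Jint_gl// -EFinM lee_fin L2 /C -/m.
by rewrite le_eqVlt; apply/orP; left; apply/eqP; ring.
Qed.

(** By [gauss_linear] the kernel obtained in the variable [A *m X] has the same rate for all
    admissible matrices. The average over the last increment is then bounded by [osc], which no
    longer involves the matrix of that step. *)
Lemma terminal_step : exists2 C : R, 0 <= C & forall (X : Om -> 'cV[R]_N) s x (A : 'M[R]_N),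
  is_gauss P X s -> 0 < s -> A \in unitmx -> (forall i j, `|A i j| <= c) ->
  (forall i j, `|invmx A i j| <= c) ->
  (\int[P]_w (wgt s (X w) * (1 + diff2 g x (A *m X w) ^+ 2 / s ^+ 2))%:E <=
   C%:E * (1 + ((s ^+ 2)^-1)%:E * osc s x))%E.
Proof.
have [C C0 HC] := gauss_linear P n lam0 c0.
pose m := lap_mass R n; have m0 : 0 <= m by exact: lap_mass_ge0.
exists (C * (1 + m)); first by rewrite mulr_ge0// addr_ge0.
move=> X s x A gX s0 uA Ac iAc.
pose H (h : 'cV[R]_N) : \bar R := (1 + diff2 g x h ^+ 2 / s ^+ 2)%:E.
have i0 : 0 <= (s ^+ 2)^-1 by rewrite invr_ge0 sqr_ge0.
have H0 h : (0 <= H h)%E by rewrite lee_fin addr_ge0// mulr_ge0// sqr_ge0.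
have mH : measurable_fun setT (H : mcol R N -> \bar R).
  by apply/measurable_EFinP; apply: measurable_funD => //; apply: measurable_funM.
have := HC X s A H gX s0 uA Ac iAc mH H0.
under eq_integral do rewrite -EFinM.
move=> h; apply: (le_trans h).
rewrite EFinM -muleA lee_wpmul2l ?lee_fin//.
have mgl L : measurable_fun setT ((fun y => (gl L y)%:E) : mcol R N -> \bar R).
  by apply/measurable_EFinP; exact: measurable_gl.
have -> : Jint std (fun y => (gl (Num.sqrt s / lam) y)%:E * H y)%E 0 =
    (m%:E + ((s ^+ 2)^-1)%:E * osc s x)%E.
  rewrite -Jint_mull//; last 2 first.
  - apply: emeasurable_funM => //; exact/measurable_EFinP.
  - by move=> y; rewrite mule_ge0// lee_fin ?sqr_ge0.
  rewrite -(@Jint_gl R n (Num.sqrt s / lam)) ?divr_gt0 ?sqrtr_gt0//.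
  rewrite -Jint_add//.
  - by apply: eq_Jint => y; rewrite -!EFinM -EFinD; congr EFin; ring.
  - by move=> y; rewrite lee_fin.
  - apply: measurable_funeM; apply: emeasurable_funM => //; exact/measurable_EFinP.
  - by move=> y; rewrite !mule_ge0// lee_fin ?sqr_ge0.
have J0 := osc_ge0 s x; have m1 : 0 <= 1 + m by rewrite addr_ge0.
rewrite ge0_muleDr ?lee_fin// ?mule_ge0//; apply: leeD.
  by rewrite mule1 lee_fin lerDr.
by rewrite -[leLHS]mul1e lee_wpmul2r ?mule_ge0// lee_fin lerDl.
Qed.

(* If [r <= l / 2], the last step [l - r] is comparable to [l] and the Lipschitz bound on [osc]
   suffices; otherwise the cancellation has to be kept for the integral over [r]. *)
Definition two_step (C r l : R) (x b0 : 'cV[R]_N) (A : 'M[R]_N) : \bar R :=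
  if r <= l / 2 then (C / l)%:E
  else (C%:E * (1 + (((l - r) ^+ 2)^-1)%:E *
    Jint std (fun y => (gl (Num.sqrt l) y)%:E * osc (l - r) (x + r *: b0 + A *m y)) 0))%E.

(** Replaces a scale varying with the waiting time [r] by the fixed scale of the remaining time [l],
    as needed to integrate over [r] afterwards; the two scales differ by a factor at most 2. *)
Lemma gl_compare (r l : R) (y : 'cV[R]_N) : 0 < r -> r <= l -> l <= 4 * r ->
  gl (Num.sqrt r) y <= 2 ^+ N * gl (Num.sqrt l) y.
Proof.
move=> r0 rl lr; have l0 : 0 < l by exact: lt_le_trans rl.
have sr : 0 < Num.sqrt r by rewrite sqrtr_gt0.
have sl : 0 < Num.sqrt l by rewrite sqrtr_gt0.
have s1 : Num.sqrt r <= Num.sqrt l by exact: ler_wsqrtr.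
have s2 : Num.sqrt l <= 2 * Num.sqrt r.
  rewrite -(@ler_pXn2r _ 2) ?nnegrE ?mulr_ge0 ?sqrtr_ge0// exprMn.
  by rewrite (sqr_sqrtr (ltW r0)) (sqr_sqrtr (ltW l0)) -natrX.
rewrite /gl mulrA; apply: ler_pM; rewrite ?expR_ge0 ?invr_ge0 ?exprn_ge0 ?sqrtr_ge0//.
  rewrite -[leLHS]mul1r ler_pdivrMr ?exprn_gt0// mulrAC ler_pdivlMr ?exprn_gt0// mul1r -exprMn.
  by rewrite ler_pXn2r ?nnegrE ?mulr_ge0 ?sqrtr_ge0.
rewrite ler_expR lerN2 ler_wpM2l ?l1norm_ge0// lef_pV2 ?posrE//.
Qed.

(** Here the kernel stays in the variable of the Brownian increment and the matrix remains visible,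
    because the square function estimate handles the matrix itself. *)
Lemma second_step : exists2 C : R, 0 <= C & forall (X : Om -> 'cV[R]_N) r s x b0 (A : 'M[R]_N),
  is_gauss P X r -> 0 < r -> 0 < s -> r + s <= T ->
  (\int[P]_w ((wgt r (X w))%:E * (1 + ((s ^+ 2)^-1)%:E * osc s (x + r *: b0 + A *m X w)%R)) <=
   two_step C r (r + s) x b0 A)%E.
Proof.
have [C1 C10 H1] := gauss_moment P n; have [C2 C20 H2] := osc_le.
pose m := lap_mass R n; have m0 : 0 <= m by exact: lap_mass_ge0.
pose Ca := 2 * (T + C2) * C1; pose Cd := (12 ^+ 3 * expR (1 ^+ 2) / 1) ^+ N : R.
have Cd0 : 0 <= Cd by rewrite exprn_ge0// divr_ge0// mulr_ge0 ?expR_ge0 ?exprn_ge0.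
pose Cb := Cd * (2 ^+ N * (1 + m)).
have t2 : 0 <= 2 ^+ N :> R by exact: exprn_ge0.
have Ca0 : 0 <= Ca.
  by apply: mulr_ge0 => //; apply: mulr_ge0 => //; apply: addr_ge0 => //; exact: ltW.
have m1 : 0 <= 1 + m by rewrite addr_ge0.
have Cb0 : 0 <= Cb by apply: mulr_ge0 => //; exact: mulr_ge0.
exists (Ca + Cb); first exact: addr_ge0.
move=> X r s x b0 A gX r0 s0 rsT; set l := r + s.
have l0 : 0 < l by exact: addr_gt0.
have i0 : 0 <= (s ^+ 2)^-1 by rewrite invr_ge0 sqr_ge0.
have mX : mxmeas X by case: gX => /measurable_colP h _ i j; rewrite ord1; exact: h.
rewrite /two_step; case: ifPn => rl.
  (* A short step [r] leaves [s >= l / 2]; the bound [osc <= C2 s] then turns [s ^- 2] into [1 / s],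
     hence into a multiple of [1 / l]. *)
  have sl : l <= 2 * s by move: rl; rewrite /l; lra.
  have hb y : (1 + ((s ^+ 2)^-1)%:E * osc s y <= (2 * (T + C2) / l)%:E)%E.
    apply: (@le_trans _ _ (1 + ((s ^+ 2)^-1)%:E * (C2 * s)%:E)%E).
      by apply: leeD => //; rewrite lee_wpmul2l ?lee_fin// H2.
    rewrite -EFinM -EFinD lee_fin ler_pdivlMr// mulrDl mul1r.
    have -> : (s ^+ 2)^-1 * (C2 * s) * l = C2 * (l / s) by field; rewrite gt_eqF.
    have ls : l / s <= 2 by rewrite ler_pdivrMr.
    have := ler_wpM2l C20 ls; rewrite -/l in rsT; lra.
  apply: (@le_trans _ _ (\int[P]_w ((2 * (T + C2) / l)%:E * (wgt r (X w))%:E))%E).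
    apply: le_integral_ge0 => w _.
      by rewrite mule_ge0 ?lee_fin ?wgt_ge0 ?(ltW r0)// adde_ge0// mule_ge0 ?lee_fin ?osc_ge0.
    by rewrite muleC lee_wpmul2r ?lee_fin ?wgt_ge0 ?(ltW r0).
  have k0 : 0 <= 2 * (T + C2) / l.
    apply: divr_ge0; last exact: ltW.
    by apply: mulr_ge0 => //; apply: addr_ge0 => //; exact: ltW.
  rewrite ge0_integralZl//; last 2 first.
  - by apply/measurable_EFinP; exact: measurable_wgt.
  - by move=> w _; rewrite lee_fin wgt_ge0// ltW.
  apply: (le_trans (lee_wpmul2l _ (H1 X r gX r0))); first by rewrite lee_fin.
  rewrite -EFinM lee_fin mulrAC -/Ca ler_wpM2r ?invr_ge0 ?(ltW l0)// lerDl//.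
have ls : l - r = s by rewrite /l addrC addKr.
rewrite ls.
pose H (y : 'cV[R]_N) := (1 + ((s ^+ 2)^-1)%:E * osc s (x + r *: b0 + A *m y)%R)%E.
have mo : measurable_fun setT ((fun y => osc s (x + r *: b0 + A *m y)) : mcol R N -> \bar R).
  apply: (@measurable_osc _ (mcol R N)) => //; apply: mxmeasD; first exact: mxmeas_cst.
  apply: mxmeasM; first exact: mxmeas_cst.
  by move=> i j; rewrite ord1; exact: measurable_coord.
have mH : measurable_fun setT (H : mcol R N -> \bar R).
  by apply: emeasurable_funD => //; exact: measurable_funeM.
have H0 y : (0 <= H y)%E by rewrite adde_ge0// mule_ge0 ?lee_fin ?osc_ge0.
apply: (le_trans (gauss_dominate gX r0 ltr01 mH H0)); rewrite -/Cd divr1.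
have sl0 : 0 < Num.sqrt l by rewrite sqrtr_gt0.
have mgl L : measurable_fun setT ((fun y => (gl L y)%:E) : mcol R N -> \bar R).
  by apply/measurable_EFinP; exact: measurable_gl.
have gll0 (y : 'cV[R]_N) : 0 <= gl (Num.sqrt l) y by rewrite gl_nneg// ltW.
set J := Jint std (fun y => _ * osc _ _)%E 0.
have J0 : (0 <= J)%E by apply: Jint_ge0 => y; rewrite mule_ge0 ?lee_fin ?osc_ge0.
have JH : Jint std (fun y => (gl (Num.sqrt l) y)%:E * H y)%E 0 = (m%:E + ((s ^+ 2)^-1)%:E * J)%E.
  rewrite -Jint_mull//; last 2 first.
  - exact: emeasurable_funM.
  - by move=> y; rewrite mule_ge0 ?lee_fin ?osc_ge0.
  rewrite -(@Jint_gl R n (Num.sqrt l))// -Jint_add//.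
  - apply: eq_Jint => y; rewrite /H ge0_muleDr ?mule1 ?mule_ge0 ?lee_fin ?osc_ge0//.
    by rewrite muleCA.
  - by apply: measurable_funeM; exact: emeasurable_funM.
  - by move=> y; rewrite !mule_ge0 ?lee_fin ?osc_ge0.
apply: (@le_trans _ _ (Cd%:E * Jint std (fun y => (2 ^+ N)%:E * ((gl (Num.sqrt l) y)%:E * H y)) 0)%E).
  rewrite lee_wpmul2l ?lee_fin//; apply: le_Jint => y.
    by rewrite mule_ge0// lee_fin gl_nneg// sqrtr_ge0.
  rewrite muleA -EFinM lee_wpmul2r// lee_fin; apply: gl_compare => //; rewrite /l ?lerDl ?(ltW s0)//.
  by move: rl; rewrite -ltNge /l; lra.
rewrite Jint_mull//; last 2 first.
- exact: emeasurable_funM.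
- by move=> y; rewrite mule_ge0 ?lee_fin.
rewrite JH muleA -EFinM.
apply: (@le_trans _ _ ((Cd * 2 ^+ N)%:E * ((1 + m)%:E * (1 + ((s ^+ 2)^-1)%:E * J)))%E).
  rewrite lee_wpmul2l ?lee_fin ?mulr_ge0// ge0_muleDr ?mule1 ?mule_ge0//; apply: leeD.
    by rewrite lee_fin lerDr.
  by rewrite -[leLHS]mul1e lee_wpmul2r ?mule_ge0// lee_fin lerDl.
rewrite muleA -EFinM -mulrA -/Cb lee_wpmul2r ?adde_ge0 ?mule_ge0//.
by rewrite lee_fin lerDr.
Qed.

End fixed_times.

Lemma mxmeas_fst (d1 d2 : measure_display) (S1 : measurableType d1) (S2 : measurableType d2)
    (R : realType) m n (X : S1 -> 'M[R]_(m, n)) : mxmeas X -> mxmeas (fun p : S1 * S2 => X p.1).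
Proof. by move=> mX i j; exact: (measurableT_comp (mX i j) measurable_fst). Qed.

(** * Integration of the last waiting time *)

Section second_moment.
Context (R : realType) (n : nat) (d : measure_display) (Om : measurableType d)
  (P : probability Om R).
Local Notation N := n.+1.
Local Notation mu := (@lebesgue_measure R).
Local Notation std := (std_basis R N).
Variables (W : R -> Om -> 'cV[R]_N) (hW : is_brownian P W).
Variables (b : R -> 'cV[R]_N -> 'cV[R]_N) (sigma : R -> 'cV[R]_N -> 'M[R]_N).
Variables (g : 'cV[R]_N -> R) (T t0 : R) (x0 : 'cV[R]_N) (K M c : R).
Hypotheses (t0T : 0 <= t0 <= T) (rb : coef_regular T b) (rs : coef_regular T sigma).
Hypotheses (T0 : 0 < T) (K0 : 0 <= K) (c0 : 0 < c).
Hypothesis bM : forall t x, 0 <= t <= T -> `|b t x| <= M.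
Hypothesis us : forall t x, 0 <= t <= T -> sigma t x \in unitmx.
Hypothesis sc : forall t x i j, 0 <= t <= T -> `|sigma t x i j| <= c.
Hypothesis ic : forall t x i j, 0 <= t <= T -> `|invmx (sigma t x) i j| <= c.
Hypothesis gK : forall y y', `|g y - g y'| <= K * `|y - y'|.

Let path (w : Om) (t : R) : 'cV[R]_N := W t w.
Local Notation Tsw := (Tsw T t0).
Local Notation Phi := (Phi b sigma g T t0 x0).
Local Notation Xb := (Xbar b sigma T t0 x0).
Local Notation bb := (bk b sigma T t0 x0).
Local Notation ss := (sk b sigma T t0 x0).
Local Notation oscg := (osc g c).
Local Notation two_step := (two_step g c).
Local Notation past_wgt := (past_wgt W T t0).

Let mg : measurable_fun setT (g : mcol R N -> R). Proof. exact: measurable_lipschitz gK. Qed.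

Let osc0 s x : (0 <= oscg s x)%E. Proof. exact: osc_ge0. Qed.

Let gl_ge (L : R) (y : 'cV[R]_N) : 0 <= gl (Num.sqrt L) y. Proof. by apply: gl_nneg; rewrite sqrtr_ge0. Qed.

Lemma two_step_ge0 C r l x b0 A : 0 <= C -> 0 < l -> (0 <= two_step C r l x b0 A)%E.
Proof.
move=> C0 l0; rewrite /two_step; case: ifP => _; first by rewrite lee_fin divr_ge0// ltW.
rewrite mule_ge0 ?lee_fin// adde_ge0// mule_ge0 ?lee_fin ?invr_ge0 ?sqr_ge0//.
by apply: Jint_ge0 => y; rewrite mule_ge0 ?lee_fin.
Qed.

Lemma two_stepZ C C' r l x b0 A : (C%:E * two_step C' r l x b0 A = two_step (C * C') r l x b0 A)%E.
Proof. by rewrite /two_step; case: ifP => _; rewrite ?muleA -EFinM// mulrA. Qed.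

(** At fixed switching times the last increment is averaged given the path up to the last switch,
    then the increment before it given the path up to the previous one. The earlier increments enter
    only through their weights and through the coefficients at the previous switch. *)
Lemma Phi_two_step : exists2 C : R, 0 <= C & forall t k, (forall j, 0 < t j) -> Tsw t k.+1 < T ->
  (\int[P]_w (Phi k.+1 t (path w))%:E <=
   \int[P]_w ((past_wgt t k w)%:E *
     two_step C (t k) (T - Tsw t k) (Xb (path w) t k) (bb (path w) t k) (ss (path w) t k)))%E.
Proof.
have [C1 C10 H1] := terminal_step P c0 gK.
have [C2 C20 H2] := second_step P T0 K0 c0 gK.
exists (C1 * C2); first exact: mulr_ge0.
move=> t k tp kT; have t_ge0 j : 0 <= t j by exact/ltW.
have [TE _] := Tsw_step kT.
have S0 := Tsw_ge0 t0T k t_ge0; have S1 := Tsw_ge0 t0T k.+1 t_ge0.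
have SS : Tsw t k < Tsw t k.+1 by rewrite TE ltrDl.
pose s := T - Tsw t k.+1; have s0 : 0 < s by rewrite subr_gt0.
have i0 : 0 <= (s ^+ 2)^-1 by rewrite invr_ge0 sqr_ge0.
have lE : T - Tsw t k = t k + s by rewrite /s TE; ring.
have rS1 : 0 <= Tsw t k.+1 <= T by rewrite S1 ltW.
have rS0 : 0 <= Tsw t k <= T by rewrite S0 (le_trans (ltW SS)) ?ltW.
have mpt u : 0 <= u -> mxmeas (W u).
  by case: hW => h _ _ _ _ u0 i j; rewrite ord1; exact: h.
have pX k' : mxmeas (fun w : past_type W (Tsw t k') => Xb (path w) t k') by exact: past_Xbar.
have pb k' : mxmeas (fun w : past_type W (Tsw t k') => bb (path w) t k') by exact: past_bk.
have ps k' : mxmeas (fun w : past_type W (Tsw t k') => ss (path w) t k') by exact: past_sk.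
pose Psi1 (p : past_type W (Tsw t k.+1) * mcol R N) : \bar R :=
  (past_wgt t k.+1 p.1 * (wgt s p.2 *
    (1 + diff2 g (Xb (path p.1) t k.+1) (ss (path p.1) t k.+1 *m p.2) ^+ 2 / s ^+ 2)))%:E.
have Psi10 p : (0 <= Psi1 p)%E.
  rewrite lee_fin mulr_ge0 ?past_wgt_ge0// mulr_ge0 ?wgt_ge0 ?(ltW s0)//.
  by rewrite addr_ge0// mulr_ge0// sqr_ge0.
have mcoord i j : measurable_fun setT (fun y : mcol R N => (y : 'cV[R]_N) i j).
  by rewrite ord1; exact: measurable_coord.
have mPsi1 : measurable_fun setT Psi1.
  apply/measurable_EFinP; apply: measurable_funM.
    have mp : measurable_fun setT (past_wgt t k.+1 : past_type W (Tsw t k.+1) -> R).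
      exact: measurable_past_wgt.
    exact: (measurableT_comp mp measurable_fst).
  have m2 : mxmeas (fun p : past_type W (Tsw t k.+1) * mcol R N => (p.2 : 'cV[R]_N)).
    by move=> i j; exact: (measurableT_comp (mcoord i j) measurable_snd).
  apply: measurable_funM; first exact: measurable_wgt.
  apply: measurable_funD => //; apply: measurable_funM => //; apply: measurable_funX.
  apply: (measurable_diff2 mg).
    apply: mxmeas_mcol.
    exact: (mxmeas_fst (pX k.+1)).
  apply: mxmeas_mcol; apply: mxmeasM => //.
  exact: (mxmeas_fst (ps k.+1)).
have E1 := past_integral hW S1 (ltW kT) mPsi1 Psi10.
have -> : (\int[P]_w (Phi k.+1 t (path w))%:E =
    \int[P]_w Psi1 (w, (W T w - W (Tsw t k.+1) w)%R))%E.
  by apply: eq_integral => w _; rewrite /Phi kT mul1r.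
rewrite E1; have G1 := increment_gauss hW S1 kT; rewrite -/s in G1.
have mz : mxmeas (fun w => W T w - W (Tsw t k.+1) w) by apply: mxmeasB; apply: mpt => //; exact: ltW.
pose Q w := (1 + ((s ^+ 2)^-1)%:E * oscg s (Xb (path w) t k.+1))%E.
have Q0 w : (0 <= Q w)%E by rewrite adde_ge0// mule_ge0 ?lee_fin.
apply: (@le_trans _ _ (\int[P]_w ((past_wgt t k.+1 w)%:E * (C1%:E * Q w)))%E).
  apply: le_integral_ge0 => w _; first by apply: integral_ge0 => w2 _; exact: Psi10.
  have -> : (\int[P]_w2 Psi1 (w, (W T w2 - W (Tsw t k.+1) w2)%R) = (past_wgt t k.+1 w)%:E *
     \int[P]_w2 (wgt s (W T w2 - W (Tsw t k.+1) w2) * (1 + diff2 g (Xb (path w) t k.+1)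
       (ss (path w) t k.+1 *m (W T w2 - W (Tsw t k.+1) w2)) ^+ 2 / s ^+ 2))%:E)%E.
    rewrite -ge0_integralZl//.
    - apply/measurable_EFinP; apply: measurable_funM; first exact: measurable_wgt.
      apply: measurable_funD => //; apply: measurable_funM => //; apply: measurable_funX.
      apply: (measurable_diff2 mg); first exact: measurable_cst.
      by apply: mxmeas_mcol; apply: mxmeasM => //; exact: mxmeas_cst.
    - move=> w2 _; rewrite lee_fin mulr_ge0 ?wgt_ge0 ?(ltW s0)//.
      by rewrite addr_ge0// mulr_ge0// sqr_ge0.
    - by rewrite lee_fin past_wgt_ge0.
  rewrite lee_wpmul2l ?lee_fin ?past_wgt_ge0//.
  by apply: H1 => //; [exact: us|move=> i j; exact: sc|move=> i j; exact: ic].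
pose next (w : Om) (y : 'cV[R]_N) := Xb (path w) t k + t k *: bb (path w) t k + ss (path w) t k *m y.
pose Psi2 (p : past_type W (Tsw t k) * mcol R N) : \bar R :=
  ((past_wgt t k p.1)%:E * (C1%:E * ((wgt (t k) p.2)%:E *
     (1 + ((s ^+ 2)^-1)%:E * oscg s (next p.1 p.2)))))%E.
have inner0 w y : (0 <= (wgt (t k) y)%:E * (1 + ((s ^+ 2)^-1)%:E * oscg s (next w y)))%E.
  by rewrite mule_ge0 ?lee_fin ?wgt_ge0// adde_ge0// mule_ge0 ?lee_fin.
have Psi20 p : (0 <= Psi2 p)%E.
  by rewrite /Psi2 mule_ge0 ?lee_fin ?past_wgt_ge0// mule_ge0 ?lee_fin.
have mPsi2 : measurable_fun setT Psi2.
  have m2 : mxmeas (fun p : past_type W (Tsw t k) * mcol R N => (p.2 : 'cV[R]_N)).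
    by move=> i j; exact: (measurableT_comp (mcoord i j) measurable_snd).
  apply: emeasurable_funM.
    apply/measurable_EFinP.
    have mp : measurable_fun setT (past_wgt t k : past_type W (Tsw t k) -> R).
      exact: measurable_past_wgt.
    exact: (measurableT_comp mp measurable_fst).
  apply: measurable_funeM; apply: emeasurable_funM.
    by apply/measurable_EFinP; exact: measurable_wgt.
  apply: emeasurable_funD => //; apply: measurable_funeM; apply: (measurable_osc c0 gK) => //.
  apply: mxmeasD; first apply: mxmeasD.
  - exact: (mxmeas_fst (pX k)).
  - apply: mxmeasZ => //.
    exact: (mxmeas_fst (pb k)).
  - apply: mxmeasM => //.
    exact: (mxmeas_fst (ps k)).
have E2 := past_integral hW S0 (ltW SS) mPsi2 Psi20.
have -> : (\int[P]_w ((past_wgt t k.+1 w)%:E * (C1%:E * Q w)) =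
    \int[P]_w Psi2 (w, (W (Tsw t k.+1) w - W (Tsw t k) w)%R))%E.
  apply: eq_integral => w _.
  have XE : Xb (path w) t k.+1 = next w (W (Tsw t k.+1) w - W (Tsw t k) w).
    by rewrite /next; have [_ <-] := Tsw_step kT.
  have PE : past_wgt t k.+1 w = past_wgt t k w * wgt (t k) (W (Tsw t k.+1) w - W (Tsw t k) w).
    by rewrite /past_wgt big_ord_recr.
  by rewrite /Psi2 /Q PE XE EFinM -!muleA; congr (_ * _)%E; rewrite muleCA.
rewrite E2; have G2 := increment_gauss hW S0 SS.
have rE : Tsw t k.+1 - Tsw t k = t k by rewrite TE addrC addKr.
rewrite rE in G2.
have my : mxmeas (fun w => W (Tsw t k.+1) w - W (Tsw t k) w) by apply: mxmeasB; exact: mpt.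
apply: le_integral_ge0 => w _; first by apply: integral_ge0 => w2 _; exact: Psi20.
have mi : measurable_fun setT (fun w2 => ((wgt (t k) (W (Tsw t k.+1) w2 - W (Tsw t k) w2)%R)%:E *
    (1 + ((s ^+ 2)^-1)%:E * oscg s (next w (W (Tsw t k.+1) w2 - W (Tsw t k) w2)%R)))%E).
  apply: emeasurable_funM; first by apply/measurable_EFinP; exact: measurable_wgt.
  apply: emeasurable_funD => //; apply: measurable_funeM; apply: (measurable_osc c0 gK) => //.
  apply: mxmeasD; first exact: mxmeas_cst.
  by apply: mxmeasM => //; exact: mxmeas_cst.
have -> : (\int[P]_w2 Psi2 (w, (W (Tsw t k.+1) w2 - W (Tsw t k) w2)%R) = (past_wgt t k w)%:E *
   (C1%:E * \int[P]_w2 ((wgt (t k) (W (Tsw t k.+1) w2 - W (Tsw t k) w2)%R)%:E *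
    (1 + ((s ^+ 2)^-1)%:E * oscg s (next w (W (Tsw t k.+1) w2 - W (Tsw t k) w2)%R)))))%E.
  rewrite -ge0_integralZl// -ge0_integralZl//.
  - exact: measurable_funeM.
  - by move=> w2 _; rewrite mule_ge0 ?lee_fin.
  - by rewrite lee_fin past_wgt_ge0.
rewrite lee_wpmul2l ?lee_fin ?past_wgt_ge0// -two_stepZ lee_wpmul2l ?lee_fin//.
by rewrite lE; apply: H2 => //; rewrite -lE; move: S0; lra.
Qed.

Section waiting_density.
Variables (f : R -> R) (kappa cu I : R).
Hypotheses (mf : measurable_fun setT f) (f0 : forall u, 0 <= f u) (cu0 : 0 <= cu) (I0 : 0 <= I).
Hypotheses (k0 : 0 < kappa) (k1 : kappa <= 1).
Hypothesis f_le : forall u, 0 < u -> f u <= cu * u `^ (kappa - 1).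
Hypothesis f_neg : forall u, u <= 0 -> f u = 0.
Hypothesis int_pow : forall a, 0 < a ->
  (\int[mu]_(u in `]0%R, a]) (u `^ (kappa - 1))%:E <= (a `^ kappa * I)%:E)%E.

Lemma half_power (l : R) : 0 < l -> (l / 2) `^ (kappa - 1) <= 2 * l `^ (kappa - 1).
Proof.
move=> l0; rewrite powRM ?invr_ge0 ?(ltW l0)// mulrC ler_wpM2r ?powR_ge0//.
rewrite -powR_inv1// -powRrM mulN1r opprB -[leRHS]powRr1//.
by apply: ler_powR; [rewrite ler1n|rewrite lerBlDr lerDl ltW].
Qed.

(** For [u <= l / 2], the factor [1 / l] meets the integral of [u ^ (kappa - 1)], of order
    [l ^ kappa]. For [u > l / 2], the density is at most a multiple of [l ^ (kappa - 1)] and leaves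
    the integral; what remains, in [s = l - u], is the square function estimate. *)
Lemma two_step_integral C : 0 <= C -> exists2 C' : R, 0 <= C' &
  forall l x b0 (A : 'M[R]_N), 0 < l -> l <= T -> `|b0| <= M -> A \in unitmx ->
  (forall i j, `|A i j| <= c) -> (forall i j, `|invmx A i j| <= c) ->
  (\int[mu]_(u in `]0%R, l[) ((f u)%:E * two_step C u l x b0 A) <= (C' * l `^ (kappa - 1))%:E)%E.
Proof.
move=> C0; pose cc := square_function_const n K c M T.
have cc0 : 0 <= cc.
  have m0 := lap_mass_ge0 R n; have l0 := ltW (laplace_rate_gt0 n c0).
  rewrite /cc /square_function_const; apply: addr_ge0.
    apply: mulr_ge0 => //; apply: mulr_ge0; last first.
      by apply: mulr_ge0 => //; exact: exprn_ge0.
    by apply: mulr_ge0 => //; apply: mulr_ge0 => //; exact: sqr_ge0.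
  apply: mulr_ge0; last exact: ltW.
  by apply: mulr_ge0; [apply: mulr_ge0 => //; exact: sqr_ge0|exact: mulr_ge0].
have T0' := ltW T0.
have CC0 : 0 <= cu * C * I + 2 * cu * C * (T + cc).
  by apply: addr_ge0; [apply: mulr_ge0 => //; exact: mulr_ge0|
    apply: mulr_ge0; [apply: mulr_ge0 => //; exact: mulr_ge0|exact: addr_ge0]].
exists (cu * C * I + 2 * cu * C * (T + cc)) => // l x b0 A l0 lT b0M uA Ac iAc.
have l2T : l / 2 <= T by lra.
have muD : mu `]0%R, (l / 2)%R]%classic = (l / 2)%:E.
  by rewrite lebesgue_measure_itv/= lte_fin divr_gt0// -EFinD subr0.
pose J s := Jint std (fun y => (gl (Num.sqrt l) y)%:E * oscg s (x + (l - s) *: b0 + A *m y)%R)%E 0.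
have J0 s : (0 <= J s)%E by apply: Jint_ge0 => y; rewrite mule_ge0 ?lee_fin.
pose h s := (1 + ((s ^+ 2)^-1)%:E * J s)%E.
have i0 (s : R) : 0 <= (s ^+ 2)^-1 by rewrite invr_ge0 sqr_ge0.
have h0 s : (0 <= h s)%E by rewrite adde_ge0// mule_ge0 ?lee_fin.
have mJ : measurable_fun setT J.
  have mF : measurable_fun setT (fun p : R * mcol R N =>
      ((gl (Num.sqrt l) p.2)%:E * oscg p.1 (x + (l - p.1) *: b0 + A *m (p.2 : 'cV[R]_N))%R)%E).
    apply: emeasurable_funM.
      apply/measurable_EFinP.
      exact: (measurableT_comp (@measurable_gl R n (Num.sqrt l)) measurable_snd).
    apply: (measurable_osc c0 gK); first exact: measurable_fst.
    apply: mxmeasD; first apply: mxmeasD.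
    - exact: mxmeas_cst.
    - apply: mxmeasZ; last exact: mxmeas_cst.
      by apply: measurable_funB => //; exact: measurable_fst.
    - apply: mxmeasM; first exact: mxmeas_cst.
      by move=> i j; rewrite ord1; exact: (measurableT_comp (@measurable_coord R N i) measurable_snd).
  have F0 (s : R) y : (0 <= (gl (Num.sqrt l) y)%:E * oscg s (x + (l - s) *: b0 + A *m y)%R)%E.
    by rewrite mule_ge0 ?lee_fin.
  have H := @measurable_Jint R N _ R std _ mF F0.
  apply: (measurableT_comp H (g := fun s : R => (s, 0 : mcol R N))).
  exact: measurable_fun_pair.
have ms2 : measurable_fun setT (fun s : R => ((s ^+ 2)^-1)%:E).
  by apply/measurable_EFinP; apply: measurable_invr; exact: measurable_funX.
have mh : measurable_fun setT h.
  by apply: emeasurable_funD => //; exact: emeasurable_funM.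
pose G (s : R) := if (0 < s) && (s <= l / 2) then h s else 0%E.
have G0 s : (0 <= G s)%E by rewrite /G; case: ifP.
have mG : measurable_fun setT G.
  apply: (@measurable_fun_ifT _ _ _ _ h (fun=> 0%E) (fun s : R => (0 < s) && (s <= l / 2))) => //.
  by apply: measurable_and; [exact: measurable_fun_ltr|exact: measurable_fun_ler].
pose c2 := 2 * cu * l `^ (kappa - 1) * C.
have c20 : 0 <= c2.
  by apply: mulr_ge0 => //; apply: mulr_ge0; [exact: mulr_ge0|exact: powR_ge0].
pose c1 := cu * C / l.
have c10 : 0 <= c1 by apply: divr_ge0; [exact: mulr_ge0|exact: ltW].
have mGl : measurable_fun setT (fun u : R => G (l - u)).
  by apply: (measurableT_comp mG (g := fun u : R => l - u)); exact: measurable_funB.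
have mpow : measurable_fun setT (fun u : R => (u `^ (kappa - 1))%:E).
  by apply/measurable_EFinP; exact: measurable_powR.
apply: (@le_trans _ _ (\int[mu]_(u in `]0%R, l[) (c1%:E * (u `^ (kappa - 1))%:E + c2%:E * G (l - u)%R))%E).
  apply: le_integral_ge0 => u; rewrite /= in_itv/= => /andP[u0 ul].
    by rewrite mule_ge0 ?lee_fin ?two_step_ge0.
  have up : 0 <= u `^ (kappa - 1) by exact: powR_ge0.
  rewrite /two_step; case: ifPn => hu.
    rewrite -EFinM -[leLHS]adde0; apply: leeD; last by rewrite mule_ge0.
    rewrite -EFinM lee_fin /c1.
    apply: (le_trans (ler_wpM2r _ (f_le u0))); first by apply: divr_ge0 => //; exact: ltW.
    by rewrite le_eqVlt; apply/orP; left; apply/eqP; ring.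
  rewrite -[leLHS]add0e; apply: leeD; first by rewrite -EFinM lee_fin mulr_ge0.
  have lu : l / 2 < u by rewrite ltNge.
  have -> : G (l - u) = h (l - u).
    by rewrite /G subr_gt0 ul/= ifT//; lra.
  have -> : h (l - u) = (1 + (((l - u) ^+ 2)^-1)%:E * Jint std (fun y => (gl (Num.sqrt l) y)%:E *
     oscg (l - u) (x + u *: b0 + A *m y)%R) 0)%E.
    by rewrite /h /J (_ : l - (l - u) = u)//; ring.
  rewrite muleA -EFinM lee_wpmul2r//.
    rewrite adde_ge0// mule_ge0 ?lee_fin//.
    by apply: Jint_ge0 => y; rewrite mule_ge0 ?lee_fin.
  rewrite lee_fin /c2 ler_wpM2r//; apply: (le_trans (f_le u0)).
  rewrite [2 * cu]mulrC -mulrA ler_wpM2l//; apply: le_trans (half_power l0).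
  by apply: powR_mono_le => //; [exact: divr_gt0|exact: ltW].
rewrite ge0_integralD//; last 4 first.
- by move=> u _; rewrite -EFinM lee_fin mulr_ge0 ?powR_ge0.
- by apply: measurable_funTS; exact: measurable_funeM.
- by move=> u _; rewrite mule_ge0.
- by apply: measurable_funTS; exact: measurable_funeM.
rewrite !ge0_integralZl//; last 3 first.
- exact: measurable_funTS.
- exact: measurable_funTS.
- by move=> u _; rewrite lee_fin powR_ge0.
have i1 : (\int[mu]_(u in `]0%R, l[) (u `^ (kappa - 1))%:E <= (l `^ kappa * I)%:E)%E.
  apply: le_trans (int_pow l0); apply: ge0_subset_integral => //.
  - exact: measurable_funTS.
  - by move=> u _; rewrite lee_fin powR_ge0.
  - by apply: subset_itvl; rewrite bnd_simp.
have i2 : (\int[mu]_(u in `]0%R, l[) G (l - u)%R <= (T + cc)%:E)%E.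
  apply: (@le_trans _ _ (\int[mu]_u G (l - u)%R)%E).
    by apply: ge0_subset_integral.
  have nz : -1 != 0 :> R by rewrite oppr_eq0 oner_eq0.
  have := integral_affine l nz mG G0; rewrite normrN1 invr1 mul1e => E.
  have -> : (\int[mu]_u G (l - u)%R = \int[mu]_u G (-1 * u + l)%R)%E.
    by apply: eq_integral => u _; rewrite mulN1r addrC.
  rewrite E.
  have -> : (\int[mu]_u G u = \int[mu]_(s in `]0%R, (l / 2)%R]) h s)%E.
    rewrite [RHS]integral_mkcond; apply: eq_integral => u _.
    by rewrite patchE mem_setE in_itv/= /G; case: ifP.
  pose D := `]0%R, (l / 2)%R]%classic : set R.
  have mD : measurable (D : set (measurableTypeR R)) by exact: measurable_itv.
  pose q s := (((s ^+ 2)^-1)%:E * J s)%E.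
  have q0 s : (0 <= q s)%E by rewrite mule_ge0 ?lee_fin.
  have mq : measurable_fun D q by apply: measurable_funTS; exact: emeasurable_funM.
  have -> : (\int[mu]_(s in D) h s = \int[mu]_(s in D) 1 + \int[mu]_(s in D) q s)%E.
    transitivity (\int[mu]_(s in D) (cst 1%E s + q s))%E; first by [].
    apply: ge0_integralD; [exact: mD|by []|exact: measurable_cst|by []|exact: mq].
  rewrite EFinD; apply: leeD; last first.
    have cb := gauss_square_function K0 c0 x mg gK b0M uA Ac iAc l0 lT.
    move: cb; rewrite -/cc /q /J /osc => cb.
    exact: cb.
  have -> : (\int[mu]_(s in `]0%R, (l / 2)%R]) 1 = 1 * mu `]0%R, (l / 2)%R]%classic)%E.
    exact: integral_cst.
  by rewrite muD mul1e lee_fin.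
apply: (le_trans (leeD (lee_wpmul2l _ i1) (lee_wpmul2l _ i2))); rewrite ?lee_fin//.
have lk : l `^ kappa = l `^ (kappa - 1) * l.
  by rewrite -[X in _ * X](powRr1 (ltW l0)) -powRD ?subrK// (gt_eqF l0) implybT.
rewrite lk /c1 /c2 le_eqVlt; apply/orP; left; apply/eqP.
by field; rewrite gt_eqF.
Qed.

(** Tonelli puts the integral over the last waiting time inside the one over the path. For each
    past, position, drift and matrix are then constants, as the square function requires, and only
    the moment of the past weights remains. *)
Lemma inner_bound : exists2 D : R, 0 <= D & forall t k, (forall j, 0 < t j) -> Tsw t k < T ->
  (\int[mu]_u ((f u)%:E * \int[P]_w (Phi k.+1 (splice t k u) (path w))%:E) <=
   (D ^+ k.+1 * (T - Tsw t k) `^ (kappa - 1))%:E)%E.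
Proof.
have [C C0 HC] := Phi_two_step; have [C' C'0 HC'] := two_step_integral C0.
have [Cm Cm0 HCm] := past_moment hW t0T.
have D0 : 0 <= Cm + C' by exact: addr_ge0.
exists (Cm + C') => // t k tp kT; have t_ge0 j : 0 <= t j by exact/ltW.
pose l := T - Tsw t k; have l0 : 0 < l by rewrite subr_gt0.
have lT : l <= T by have := Tsw_ge0 t0T k t_ge0; rewrite /l; lra.
pose a w := past_wgt t k w.
have a0 w : 0 <= a w by exact: past_wgt_ge0.
have ma : measurable_fun setT a by exact: (measurable_past_wgt_Om hW t0T k tp).
pose ts u w := two_step C u l (Xb (path w) t k) (bb (path w) t k) (ss (path w) t k).
have ts0 u w : (0 <= ts u w)%E by exact: two_step_ge0.
have mpt j : mxmeas (fun w => path w (Tsw t j)).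
  by case: hW => h _ _ _ _ i i'; rewrite ord1; apply: h; exact: Tsw_ge0.
have mX : mxmeas (fun w => Xb (path w) t k).
  exact: (mxmeas_Xbar x0 t0T (tau := fun=> t) (fun=> measurable_cst _) (fun _ => t_ge0) rb rs
    (fun j _ => mpt j) (leqnn k)).
have mb : mxmeas (fun w => bb (path w) t k).
  exact: (mxmeas_bk x0 t0T (tau := fun=> t) (fun=> measurable_cst _) (fun _ => t_ge0) rb rs
    (fun j _ => mpt j) (leqnn k)).
have ms : mxmeas (fun w => ss (path w) t k).
  exact: (mxmeas_sk x0 t0T (tau := fun=> t) (fun=> measurable_cst _) (fun _ => t_ge0) rb rs
    (fun j _ => mpt j) (leqnn k)).
have mts : measurable_fun setT (fun p : R * Om => ts p.1 p.2).
  pose J (p : R * Om) := Jint std (fun y => (gl (Num.sqrt l) y)%:E *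
    oscg (l - p.1) (Xb (path p.2) t k + p.1 *: bb (path p.2) t k + ss (path p.2) t k *m y)%R)%E 0.
  have mJ : measurable_fun setT J.
    have mF : measurable_fun setT (fun p : (R * Om) * mcol R N => ((gl (Num.sqrt l) p.2)%:E *
       oscg (l - p.1.1) (Xb (path p.1.2) t k + p.1.1 *: bb (path p.1.2) t k +
          ss (path p.1.2) t k *m (p.2 : 'cV[R]_N))%R)%E).
      have m11 : measurable_fun setT (fun p : (R * Om) * mcol R N => p.1.1) by exact: measurableT_comp.
      have m12 : measurable_fun setT (fun p : (R * Om) * mcol R N => p.1.2) by exact: measurableT_comp.
      apply: emeasurable_funM.
        apply/measurable_EFinP.
        exact: (measurableT_comp (@measurable_gl R n (Num.sqrt l)) measurable_snd).
      apply: (measurable_osc c0 gK); first exact: measurable_funB.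
      apply: mxmeasD; first apply: mxmeasD.
      - by move=> i j; exact: (measurableT_comp (mX i j) m12).
      - apply: mxmeasZ => // i j; exact: (measurableT_comp (mb i j) m12).
      - apply: mxmeasM => i j; first exact: (measurableT_comp (ms i j) m12).
        by rewrite ord1; exact: (measurableT_comp (@measurable_coord R N i) measurable_snd).
    have F0 (p : R * Om) y : (0 <= (gl (Num.sqrt l) y)%:E *
       oscg (l - p.1) (Xb (path p.2) t k + p.1 *: bb (path p.2) t k + ss (path p.2) t k *m y)%R)%E.
      by rewrite mule_ge0 ?lee_fin.
    have H := @measurable_Jint R N _ (R * Om)%type std _ mF F0.
    apply: (measurableT_comp H (g := fun p : R * Om => (p, 0 : mcol R N))).
    exact: measurable_fun_pair.
  apply: (@measurable_fun_ifT _ _ _ _ (fun=> (C / l)%:E)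
    (fun p : R * Om => (C%:E * (1 + (((l - p.1) ^+ 2)^-1)%:E * J p))%E)
    (fun p : R * Om => p.1 <= l / 2)) => //.
    by apply: measurable_fun_ler => //; exact: measurable_fst.
  apply: measurable_funeM; apply: emeasurable_funD => //; apply: emeasurable_funM => //.
  apply/measurable_EFinP; apply: measurable_invr; apply: measurable_funX.
  by apply: measurable_funB => //; exact: measurable_fst.
(* Nothing is lost outside []0, l[]: the density vanishes for [u <= 0], and for [u >= l] the next
   switching time is truncated to [T], where the indicator in [Phi] is 0. *)
pose f' u := if (0 < u) && (u < l) then f u else 0.
have f'0 u : 0 <= f' u by rewrite /f'; case: ifP.
have mf' : measurable_fun setT f'.
  apply: (@measurable_fun_ifT _ _ _ _ f (fun=> 0) (fun u : R => (0 < u) && (u < l))) => //.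
  by apply: measurable_and; exact: measurable_fun_ltr.
pose H (p : R * Om) := ((f' p.1)%:E * ((a p.2)%:E * ts p.1 p.2))%E.
have H0 p : (0 <= H p)%E by rewrite mule_ge0 ?lee_fin// mule_ge0 ?lee_fin.
have maR : measurable_fun setT (fun p : R * Om => (a p.2)%:E).
  by apply/measurable_EFinP; exact: (measurableT_comp ma measurable_snd).
have mfR : measurable_fun setT (fun p : R * Om => (f' p.1)%:E).
  by apply/measurable_EFinP; exact: (measurableT_comp mf' measurable_fst).
have mats : measurable_fun setT (fun p : R * Om => ((a p.2)%:E * ts p.1 p.2)%E).
  exact: emeasurable_funM.
have mH : measurable_fun setT H by exact: emeasurable_funM.
have Phi0 t' w : (forall j, 0 <= t' j) -> 0 <= Phi k.+1 t' (path w).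
  move=> tp'; rewrite /Phi; case: (ltP (Tsw t' k.+1) T) => h; last by rewrite !mul0r.
  rewrite mul1r; apply: mulr_ge0; first by apply: prodr_ge0 => j _; exact: wgt_ge0.
  apply: mulr_ge0; first by rewrite wgt_ge0// subr_ge0 ltW.
  by rewrite addr_ge0// divr_ge0 ?sqr_ge0.
have sp0 u j : 0 <= splice t k u j by rewrite /splice; case: ifP => // _; case: ifP.
have spt u j : (j < k)%N -> splice t k u j = t j by rewrite /splice => ->.
have spk u : splice t k u k = `|u| by rewrite /splice ltnn eqxx.
have TE u : Tsw (splice t k u) k = Tsw t k by apply: eq_Tsw => j; exact: spt.
apply: (@le_trans _ _ (\int[mu]_u \int[P]_w H (u, w))%E).
  apply: le_integral_ge0 => u _.
    by rewrite mule_ge0 ?lee_fin//; apply: integral_ge0 => w _; rewrite lee_fin Phi0.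
  have [u0|u0] := leP u 0.
    by rewrite f_neg// mul0e; apply: integral_ge0 => w _; exact: H0.
  have [lu|ul] := leP l u.
    have T1 : Tsw (splice t k u) k.+1 = T.
      rewrite /= TE spk gtr0_norm//; have /min_idPr -> : T - Tsw t k <= u by [].
      by rewrite addrC subrK.
    rewrite (_ : (\int[P]_w _)%E = 0%E) ?mule0; first by apply: integral_ge0 => w _; exact: H0.
    by under eq_integral do rewrite /Phi T1 ltxx !mul0r; rewrite integral0.
  have spp j : 0 < splice t k u j.
    rewrite /splice; case: ifP => // _; case: ifP => // _.
    by rewrite normr_gt0 gt_eqF.
  have T1 : Tsw (splice t k u) k.+1 < T.
    rewrite /= TE spk gtr0_norm//; have /min_idPl -> : u <= T - Tsw t k by exact: ltW.
    by move: ul; rewrite /l; lra.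
  have f'E : f' u = f u by rewrite /f' u0 ul.
  have -> : (\int[P]_w H (u, w) = (f u)%:E * \int[P]_w ((a w)%:E * ts u w))%E.
    rewrite -ge0_integralZl//.
    - by apply: eq_integral => w _; rewrite /H /= f'E.
    - exact: (measurableT_comp mats (measurable_pair1 u)).
    - by move=> w _; rewrite mule_ge0 ?lee_fin.
    - by rewrite lee_fin.
  apply: lee_wpmul2l; first by rewrite lee_fin.
  apply: (le_trans (HC _ _ spp T1)).
  rewrite le_eqVlt; apply/orP; left; apply/eqP; apply: eq_integral => w _.
  have XE : Xb (path w) (splice t k u) k = Xb (path w) t k.
    by apply: eq_Xbar => j; exact: spt.
  congr (_ * _)%E.
    congr EFin; apply: eq_bigr => j _; rewrite spt//; congr (wgt _ _); apply: eq_dW => i ij.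
    by rewrite spt//; exact: leq_trans ij (ltn_ord j).
  have bE : bb (path w) (splice t k u) k = bb (path w) t k by rewrite /bk XE TE.
  have sE : ss (path w) (splice t k u) k = ss (path w) t k by rewrite /sk XE TE.
  by rewrite bE sE XE TE spk gtr0_norm.
have -> : (\int[mu]_u \int[P]_w H (u, w) = \int[P]_w \int[mu]_u H (u, w))%E.
  exact: (@fubini_tonelli _ _ (measurableTypeR R) Om R mu P H mH H0).
have kl0 : 0 <= C' * l `^ (kappa - 1) by rewrite mulr_ge0 ?powR_ge0.
apply: (@le_trans _ _ (\int[P]_w ((C' * l `^ (kappa - 1))%:E * (a w)%:E))%E).
  apply: le_integral_ge0 => w _; first by apply: integral_ge0 => u _; exact: H0.
  have mtw : measurable_fun setT (fun u => ts u w).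
    exact: (measurableT_comp mts (measurable_pair2 w)).
  have mf'E : measurable_fun setT (fun u : R => (f' u)%:E) by exact/measurable_EFinP.
  have -> : (\int[mu]_u H (u, w) = (a w)%:E * \int[mu]_u ((f' u)%:E * ts u w))%E.
    rewrite -ge0_integralZl//.
    - by apply: eq_integral => u _; rewrite /H /= muleCA.
    - exact: emeasurable_funM.
    - by move=> u _; rewrite mule_ge0 ?lee_fin.
    - by rewrite lee_fin.
  rewrite muleC lee_wpmul2r ?lee_fin//.
  have -> : (\int[mu]_u ((f' u)%:E * ts u w) = \int[mu]_(u in `]0%R, l[) ((f u)%:E * ts u w))%E.
    rewrite [RHS]integral_mkcond; apply: eq_integral => u _.
    by rewrite patchE mem_setE in_itv/= /f'; case: ifP => // _; rewrite mul0e.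
  have rT : 0 <= Tsw t k <= T by rewrite Tsw_ge0//= ltW.
  by apply: HC' => //; [exact: bM|exact: us|move=> i j; exact: sc|move=> i j; exact: ic].
rewrite ge0_integralZl//; last 2 first.
- exact/measurable_EFinP.
- by move=> w _; rewrite lee_fin.
apply: (le_trans (lee_wpmul2l _ (HCm t k tp kT))); first by rewrite lee_fin.
rewrite -EFinM lee_fin -/l mulrAC ler_wpM2r ?powR_ge0// exprS; apply: ler_pM => //.
- exact: exprn_ge0.
- by rewrite lerDr.
- by apply: lerXn2r; rewrite ?nnegrE// lerDl.
Qed.

End waiting_density.

End second_moment.

(** * Summation over the number of switches *)

Section singular_convolution.
Context (R : realType).
Local Notation mu := (@lebesgue_measure R).
Variables (f : R -> R) (kappa cu I T : R).
Hypotheses (f0 : forall u, 0 <= f u) (cu0 : 0 <= cu) (I0 : 0 <= I).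
Hypotheses (k0 : 0 < kappa) (k1 : kappa <= 1) (T0 : 0 < T).
Hypothesis f_le : forall u, 0 < u -> f u <= cu * u `^ (kappa - 1).
Hypothesis int_pow : forall a, 0 < a ->
  (\int[mu]_(u in `]0%R, a]) (u `^ (kappa - 1))%:E <= (a `^ kappa * I)%:E)%E.

(** The singular kernel left by the last waiting time, with an exponential weight in the remaining
    time. The value 0 at [l = 0] accounts for paths that have already reached the horizon. *)
Definition tilt (lam l : R) : R := if 0 < l then l `^ (kappa - 1) * expR (lam * l) else 0.

Lemma tilt_ge0 lam l : 0 <= tilt lam l.
Proof. by rewrite /tilt; case: ifP => // _; rewrite mulr_ge0 ?powR_ge0 ?expR_ge0. Qed.

Let mpow : measurable_fun setT (fun u : R => (u `^ (kappa - 1))%:E).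
Proof. by apply/measurable_EFinP; exact: measurable_powR. Qed.

Let pow0 (u : R) : 0 <= u `^ (kappa - 1). Proof. exact: powR_ge0. Qed.

Lemma integral_power_reflect l : 0 < l ->
  (\int[mu]_(u in `]0%R, l[) ((l - u) `^ (kappa - 1))%:E <= (l `^ kappa * I)%:E)%E.
Proof.
move=> l0.
pose G (s : R) : \bar R := (if (0 < s) && (s <= l) then s `^ (kappa - 1) else 0)%:E.
have G0 s : (0 <= G s)%E by rewrite lee_fin; case: ifP.
have mG : measurable_fun setT G.
  apply/measurable_EFinP.
  apply: (@measurable_fun_ifT _ _ _ _ (fun u => u `^ (kappa - 1)) (fun=> 0) (fun u => (0 < u) && (u <= l))) => //.
  by apply: measurable_and; [exact: measurable_fun_ltr|exact: measurable_fun_ler].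
apply: le_trans (int_pow l0).
have -> : (\int[mu]_(u in `]0%R, l]) (u `^ (kappa - 1))%:E = \int[mu]_u G u)%E.
  rewrite integral_mkcond; apply: eq_integral => u _.
  by rewrite patchE mem_setE in_itv/= /G; case: ifP.
have nz : -1 != 0 :> R by rewrite oppr_eq0 oner_eq0.
have := integral_affine l nz mG G0; rewrite normrN1 invr1 mul1e => <-.
apply: (@le_trans _ _ (\int[mu]_(u in `]0%R, l[) G (-1 * u + l)%R)%E).
  apply: le_integral_ge0 => u; rewrite /= in_itv/= => /andP[u0 ul]; first by rewrite lee_fin.
  have -> : -1 * u + l = l - u by ring.
  by rewrite /G subr_gt0 ul lerBlDr lerDl (ltW u0).
apply: ge0_subset_integral => //.
apply: (measurableT_comp mG (g := fun u : R => -1 * u + l)).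
by apply: measurable_funD => //; exact: measurable_funM.
Qed.

(* Splitting at [l / 2] separates the two singularities; the small-scale part is small because
   [int_pow] tends to 0 with [a], the rest because of the exponential weight. *)
Lemma tilt_convolution q : 0 < q -> exists2 lam, 0 <= lam & forall l, 0 < l -> l <= T ->
  (\int[mu]_(u in `]0%R, l[) (f u * tilt lam (l - u))%:E <= (q * tilt lam l)%:E)%E.
Proof.
(* The final factor is [8 * cu * I * eta], which this [A] brings below [q]. Then [del] is the scale
   at which [del ^ kappa = eta], and [lam] makes the exponential weight negligible beyond it. *)
move=> q0; pose A := 8 * cu * I + 1.
have A0 : 0 < A by rewrite ltr_wpDl// mulr_ge0// mulr_ge0.
pose eta := q / A; have eta0 : 0 < eta by rewrite divr_gt0.
pose del := eta `^ kappa^-1; have del0 : 0 < del by rewrite powR_gt0.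
have delk : del `^ kappa = eta by rewrite /del -powRrM mulVf ?powRr1 ?(ltW eta0)// gt_eqF.
have Tk : 0 < T `^ kappa by rewrite powR_gt0.
pose lam := 2 * (T `^ kappa / eta) / del.
have lam0 : 0 < lam by rewrite divr_gt0// mulr_gt0// divr_gt0.
(* With [x = T ^ kappa / eta] this is [x <= expR x], which is why [lam] carries this quotient. *)
have small : expR (- (lam * del / 2)) * T `^ kappa <= eta.
  have -> : lam * del / 2 = T `^ kappa / eta by rewrite /lam; field; rewrite !gt_eqF.
  set x := _ / eta; have x0 : 0 < x by rewrite divr_gt0.
  have -> : T `^ kappa = eta * x by rewrite /x mulrC divfK// gt_eqF.
  rewrite mulrCA -[leRHS]mulr1 ler_wpM2l ?(ltW eta0)// expRN mulrC ler_pdivrMr ?expR_gt0// mul1r.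
  by apply: le_trans (expR_ge1Dx _); rewrite lerDr.
exists lam; first exact: ltW.
move=> l l0 lT.
have tl : tilt lam l = l `^ (kappa - 1) * expR (lam * l) by rewrite /tilt l0.
pose c2 := 2 * cu * tilt lam l; have c20 : 0 <= c2.
  by apply: mulr_ge0; [exact: mulr_ge0|exact: tilt_ge0].
pose e (u : R) := expR (- (lam * u)).
have e0 u : 0 <= e u by exact: expR_ge0.
have me : measurable_fun setT e.
  by apply: (measurableT_comp (@measurable_expR R)); apply: measurableT_comp => //; exact: measurable_funM.
have mr : measurable_fun setT (fun u : R => ((l - u) `^ (kappa - 1))%:E).
  apply/measurable_EFinP; apply: (measurableT_comp (@measurable_powR R _) (g := fun u : R => l - u)).
  exact: measurable_funB.
apply: (@le_trans _ _ (\int[mu]_(u in `]0%R, l[) (c2%:E * ((e u * u `^ (kappa - 1))%:E +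
    (e (l / 2))%:E * ((l - u) `^ (kappa - 1))%:E)))%E).
  apply: le_integral_ge0 => u; rewrite /= in_itv/= => /andP[u0 ul].
    by rewrite lee_fin mulr_ge0 ?tilt_ge0.
  have lu : 0 < l - u by rewrite subr_gt0.
  have -> : (c2%:E * ((e u * u `^ (kappa - 1))%:E + (e (l / 2))%:E * ((l - u) `^ (kappa - 1))%:E) =
      (c2 * (e u * u `^ (kappa - 1) + e (l / 2) * (l - u) `^ (kappa - 1)))%:E)%E by [].
  rewrite lee_fin /tilt lu.
  apply: (le_trans (ler_wpM2r _ (f_le u0))); first by rewrite mulr_ge0 ?expR_ge0.
  have eE : expR (lam * (l - u)) = expR (lam * l) * e u.
    by rewrite -expRD; congr expR; ring.
  rewrite eE /c2 tl.
  set p := u `^ _; set r := (l - u) `^ _; set L := l `^ _; set E := expR (lam * l).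
  have E0 : 0 <= E by exact: expR_ge0.
  have p0 : 0 <= p by exact: pow0.
  have r0 : 0 <= r by exact: pow0.
  have L0 : 0 <= L by exact: pow0.
  (* The power away from its singularity is at most [2 L]. The decay [e u] is kept where [u] may be
     small; in the other half it is bounded by its value at [l / 2]. *)
  have key : p * r * e u <= 2 * L * (e u * p + e (l / 2) * r).
    have [ul2|ul2] := leP u (l / 2).
      have r1 : r <= 2 * L.
        apply: le_trans (half_power k0 l0); apply: (powR_mono_le k1); first exact: divr_gt0.
        by move: ul2; lra.
      have h1 : p * e u * r <= p * e u * (2 * L) by rewrite ler_wpM2l// mulr_ge0.
      have h2 : 0 <= 2 * L * (e (l / 2) * r) by rewrite mulr_ge0// ?mulr_ge0.
      by move: h1 h2; lra.
    have p1 : p <= 2 * L.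
      by apply: le_trans (half_power k0 l0); apply: (powR_mono_le k1) => //; [exact: divr_gt0|exact: ltW].
    have e1 : e u <= e (l / 2) by rewrite ler_expR lerN2 ler_wpM2l ?(ltW lam0)// ltW.
    have h1 : r * (p * e u) <= r * ((2 * L) * e (l / 2)) by rewrite ler_wpM2l// ler_pM.
    have h2 : 0 <= 2 * L * (e u * p) by rewrite mulr_ge0// ?mulr_ge0.
    by move: h1 h2; lra.
  have cE : 0 <= cu * E by exact: mulr_ge0.
  have := ler_wpM2l cE key; lra.
have m1 : measurable_fun setT (fun u : R => (e u * u `^ (kappa - 1))%:E).
  by apply/measurable_EFinP; apply: measurable_funM => //; exact: measurable_powR.
have m2 : measurable_fun setT (fun u : R => ((e (l / 2))%:E * ((l - u) `^ (kappa - 1))%:E)%E).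
  exact: measurable_funeM.
have n1 u : (0 <= (e u * u `^ (kappa - 1))%:E)%E by rewrite lee_fin mulr_ge0.
have n2 u : (0 <= (e (l / 2))%:E * ((l - u) `^ (kappa - 1))%:E)%E by rewrite -EFinM lee_fin mulr_ge0.
rewrite ge0_integralZl//; last 2 first.
- by apply: measurable_funTS; exact: emeasurable_funD.
- by move=> u _; rewrite adde_ge0.
rewrite ge0_integralD//; last 2 first.
- exact: measurable_funTS.
- exact: measurable_funTS.
have i1 : (\int[mu]_(u in `]0%R, l[) (e u * u `^ (kappa - 1))%:E <= (2 * eta * I)%:E)%E.
  have ed : expR (- (lam * del)) * T `^ kappa <= eta.
    apply: le_trans small; rewrite ler_wpM2r ?(ltW Tk)// ler_expR lerN2 ler_piMr//.
      by rewrite mulr_ge0 ?ltW.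
    by rewrite invf_le1 ?ler1n.
  (* Below [del] the power has a small integral by itself; above, the decay [e u <= e del] beats the
     integral up to [T]. *)
  pose h1 (u : R) : \bar R := (if u <= del then u `^ (kappa - 1) else 0)%:E.
  have mh1 : measurable_fun setT h1.
    apply/measurable_EFinP; apply: (@measurable_fun_ifT _ _ _ _ (fun u => u `^ (kappa - 1)) (fun=> 0) (fun u => u <= del)) => //.
    exact: measurable_fun_ler.
  have h10 u : (0 <= h1 u)%E by rewrite lee_fin; case: ifP.
  apply: (@le_trans _ _ (\int[mu]_(u in `]0%R, T]) (h1 u + (e del)%:E * (u `^ (kappa - 1))%:E))%E).
    apply: (@le_trans _ _ (\int[mu]_(u in `]0%R, T]) (e u * u `^ (kappa - 1))%:E)%E).
      apply: ge0_subset_integral => //; first exact: measurable_funTS.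
      by apply: subset_itvl; rewrite bnd_simp.
    apply: le_integral_ge0 => u; rewrite /= in_itv/= => /andP[u0 _]; first exact: n1.
    rewrite -EFinM -EFinD lee_fin; have [ud|ud] := leP u del.
      rewrite -[leLHS]addr0; apply: lerD; last exact: mulr_ge0.
      by rewrite ler_piMl// -expR0 ler_expR oppr_le0 mulr_ge0 ?ltW.
    by rewrite add0r ler_wpM2r// ler_expR lerN2 ler_wpM2l ?(ltW lam0)// ltW.
  rewrite ge0_integralD//; last 3 first.
  - exact: measurable_funTS.
  - by move=> u _; rewrite -EFinM lee_fin mulr_ge0.
  - by apply: measurable_funTS; exact: measurable_funeM.
  rewrite ge0_integralZl//; last 3 first.
  - exact: measurable_funTS.
  - by move=> u _; rewrite lee_fin.
  - by rewrite lee_fin.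
  have h1i : (\int[mu]_(u in `]0%R, T]) h1 u <= (eta * I)%:E)%E.
    rewrite -delk; apply: le_trans (int_pow del0).
    rewrite integral_mkcond [leRHS]integral_mkcond; apply: le_integral_ge0 => u _.
      by rewrite patchE; case: ifP.
    rewrite !patchE !mem_setE !in_itv/= /h1.
    by case: (0 < u) => //=; case: (u <= T); case: (u <= del); rewrite lee_fin.
  apply: (le_trans (leeD h1i (lee_wpmul2l _ (int_pow T0)))); first by rewrite lee_fin.
  rewrite -EFinM -EFinD lee_fin mulrA; have := ler_wpM2r I0 ed; rewrite /e; lra.
have i2 : ((e (l / 2))%:E * \int[mu]_(u in `]0%R, l[) ((l - u) `^ (kappa - 1))%:E <= (2 * eta * I)%:E)%E.
  apply: (le_trans (lee_wpmul2l _ (integral_power_reflect l0))); first by rewrite lee_fin.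
  rewrite -EFinM lee_fin mulrA ler_wpM2r//.
  (* For short [l] the factor [l ^ kappa] is itself below [eta]; for long [l] the decay at [l / 2]
     is small. *)
  have [ld|ld] := leP l del.
    apply: (@le_trans _ _ (1 * eta)); last by rewrite mul1r; move: eta0; lra.
    apply: ler_pM => //; first exact: powR_ge0.
      by rewrite -expR0 ler_expR oppr_le0 (mulr_ge0 (ltW lam0))// divr_ge0 ?(ltW l0).
    rewrite -delk; apply: ge0_ler_powR => //; rewrite ?nnegrE.
    - exact: ltW.
    - exact: ltW.
    - exact: ltW.
  apply: (@le_trans _ _ (expR (- (lam * del / 2)) * T `^ kappa)); last by move: small eta0; lra.
  apply: ler_pM => //; first exact: powR_ge0.
    by rewrite ler_expR lerN2 mulrA ler_wpM2r// ler_wpM2l// ltW.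
  apply: ge0_ler_powR => //; rewrite ?nnegrE.
  - exact: ltW.
  - exact: ltW.
  - exact: ltW.
rewrite ge0_integralZl//; last 3 first.
- exact: measurable_funTS.
- by move=> u _; rewrite lee_fin.
- by rewrite lee_fin.
apply: (le_trans (lee_wpmul2l _ (leeD i1 i2))); first by rewrite lee_fin.
rewrite -EFinD -EFinM lee_fin /c2.
have -> : 2 * cu * tilt lam l * (2 * eta * I + 2 * eta * I) = (8 * cu * I * eta) * tilt lam l by ring.
rewrite ler_wpM2r ?tilt_ge0// /eta mulrCA -[leRHS]mulr1 ler_wpM2l ?(ltW q0)//.
by rewrite ler_pdivrMr// mul1r /A lerDl.
Qed.

End singular_convolution.

Lemma integral_prob_cst (R : realType) (d : measure_display) (Om : measurableType d)
    (P : probability Om R) (x : \bar R) : (\int[P]_w x = x)%E.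
Proof.
transitivity (x * P setT)%E; first exact: integral_cst.
by rewrite probability_setT mule1.
Qed.

(** * Second moment of the estimator *)

Section estimator_moment.
Context (R : realType) (n : nat) (d : measure_display) (Om : measurableType d)
  (P : probability Om R).
Local Notation N := n.+1.
Local Notation mu := (@lebesgue_measure R).
Variables (W : R -> Om -> 'cV[R]_N) (tau : nat -> Om -> R) (kappa theta : R).
Hypotheses (hW : is_brownian P W) (htau : iid_gamma P kappa theta tau)
  (hWtau : indep_process P W tau).
Variables (b : R -> 'cV[R]_N -> 'cV[R]_N) (sigma : R -> 'cV[R]_N -> 'M[R]_N).
Variables (g : 'cV[R]_N -> R) (T t0 : R) (x0 : 'cV[R]_N) (alpha K M L c : R).
Hypotheses (t0T : 0 <= t0 <= T) (rb : coef_regular T b) (rs : coef_regular T sigma).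
Hypotheses (T0 : 0 < T) (al : 0 < alpha <= 1) (K0 : 0 <= K) (M0 : 0 <= M) (L0 : 0 <= L) (c0 : 0 < c).
Hypotheses (k0 : 0 < kappa) (kal : kappa <= alpha) (k2 : kappa <= 2^-1) (th0 : 0 < theta).
Hypothesis bM : forall t x, 0 <= t <= T -> `|b t x| <= M.
Hypothesis bL : forall t t' x x', 0 <= t <= T -> 0 <= t' <= T ->
  `|b t x - b t' x'| <= L * (`|t - t'| `^ alpha + `|x - x'|).
Hypothesis aL : forall t t' x x', 0 <= t <= T -> 0 <= t' <= T ->
  `|diffusion sigma t x - diffusion sigma t' x'| <= L * (`|t - t'| `^ alpha + `|x - x'|).
Hypothesis us : forall t x, 0 <= t <= T -> sigma t x \in unitmx.
Hypothesis sc : forall t x i j, 0 <= t <= T -> `|sigma t x i j| <= c.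
Hypothesis ic : forall t x i j, 0 <= t <= T -> `|invmx (sigma t x) i j| <= c.
Hypothesis gK : forall y y', `|g y - g y'| <= K * `|y - y'|.

Let path (w : Om) (t : R) : 'cV[R]_N := W t w.
Let wait (w : Om) (k : nat) : R := tau k w.
Local Notation Tsw := (Tsw T t0).
Local Notation Phi := (Phi b sigma g T t0 x0).
Local Notation f := (gamma_pdf kappa theta).
Local Notation F := (gamma_cdf kappa theta).
Local Notation Z := (gamma_norm kappa theta).
Local Notation tilt := (tilt kappa).

Let k1 : kappa <= 1. Proof. by rewrite (le_trans k2)// invf_le1 ?ler1n. Qed.
Let mass : (\int[mu]_u (f u)%:E = 1)%E. Proof. exact: gamma_mass htau. Qed.
Let Z0 : 0 < Z. Proof. exact: gamma_norm_gt0 mass. Qed.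
Let Zi0 : 0 <= Z^-1. Proof. by rewrite invr_ge0 ltW. Qed.
Let mf : measurable_fun setT f. Proof. exact: measurable_gamma_pdf. Qed.
Let f0 u : 0 <= f u. Proof. exact: gamma_pdf_ge0. Qed.
Let f_le u : 0 < u -> f u <= Z^-1 * u `^ (kappa - 1). Proof. exact: gamma_pdf_le. Qed.
Let f_neg u : u <= 0 -> f u = 0. Proof. by rewrite /gamma_pdf leNgt => /negbTE ->. Qed.
Let wait0 w k : 0 < wait w k. Proof. by case: htau => _ h _ _; exact: h. Qed.
Let wait_ge0 w k : 0 <= wait w k. Proof. exact/ltW. Qed.
Let mtau k : measurable_fun setT (tau k). Proof. by case: htau. Qed.

Lemma Phi_ge0 m t wp : (forall j, 0 <= t j) -> 0 <= Phi m t wp.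
Proof.
move=> tp; rewrite /Phi; case: (ltP (Tsw t m) T) => h; last by rewrite !mul0r.
rewrite mul1r; apply: mulr_ge0; first by apply: prodr_ge0 => j _; exact: wgt_ge0.
apply: mulr_ge0; first by rewrite wgt_ge0// subr_ge0 ltW.
by rewrite addr_ge0// divr_ge0 ?sqr_ge0.
Qed.

Lemma measurable_tilt lam : measurable_fun setT (tilt lam : R -> R).
Proof.
apply: measurable_fun_ifT => //; first exact: measurable_fun_ltr.
apply: measurable_funM; first exact: measurable_powR.
by apply: measurableT_comp => //; exact: measurable_funM.
Qed.

(** The most recent waiting time is integrated first, the earlier ones being fixed: given the
    remaining time, this is one convolution and gains a factor [q]. A waiting time exceeding the
    remaining time contributes 0. *)
Lemma tilt_decay q : 0 < q -> exists lam, 0 <= lam /\ forall k,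
  (\int[P]_w (tilt lam (T - Tsw (wait w) k))%:E <= (q ^+ k * tilt lam (T - t0))%:E)%E.
Proof.
move=> q0; have [I I0 int_pow] := integral_power th0 mass.
have [lam lam0 conv] := tilt_convolution f0 Zi0 I0 k0 k1 T0 f_le int_pow q0.
exists lam; split=> //; elim=> [|k IH].
  have -> : (\int[P]_w (tilt lam (T - Tsw (wait w) 0))%:E = (tilt lam (T - t0))%:E)%E.
    by rewrite -[RHS](integral_prob_cst P).
  by rewrite expr0 mul1r.
pose Psi (t : nat -> R) := (tilt lam (T - Tsw t k.+1))%:E.
have mPsi (d' : measure_display) (S : measurableType d') (t : S -> nat -> R) :
    (forall j, measurable_fun setT (fun s => t s j)) -> (forall s j, 0 <= t s j) ->
    measurable_fun setT (fun s => Psi (t s)).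
  move=> mt t_ge0; apply/measurable_EFinP; apply: (measurableT_comp (measurable_tilt lam)).
  by apply: measurable_funB => //; exact: measurable_Tsw.
have Psi0 t : (0 <= Psi t)%E by rewrite lee_fin tilt_ge0.
have extPsi t t' : (forall j, (j <= k)%N -> t j = t' j) -> Psi t = Psi t'.
  by move=> tt'; rewrite /Psi (@eq_Tsw _ _ _ t t').
have E := splice_integral htau mPsi Psi0 extPsi.
have -> : (\int[P]_w (tilt lam (T - Tsw (wait w) k.+1))%:E = \int[P]_w Psi (wait w))%E by [].
rewrite E; apply: (@le_trans _ _ (\int[P]_w (q%:E * (tilt lam (T - Tsw (wait w) k))%:E))%E).
  apply: le_integral_ge0 => w _.
    by apply: integral_ge0 => u _; apply: mule_ge0; [rewrite lee_fin|exact: Psi0].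
  pose l := T - Tsw (wait w) k.
  have lT : l <= T by have := Tsw_ge0 t0T k (wait_ge0 w); rewrite /l; lra.
  have l0 : 0 <= l by rewrite subr_ge0 Tsw_le.
  have TE u : T - Tsw (splice (wait w) k u) k.+1 = l - Num.min `|u| l.
    have TE : Tsw (splice (wait w) k u) k = Tsw (wait w) k.
      by apply: eq_Tsw => j jk; rewrite /splice jk.
    by rewrite /= TE /splice ltnn eqxx -/l /l; ring.
  rewrite -EFinM -/l.
  move: l0; rewrite le_eqVlt => /orP[/eqP l0|l0].
    rewrite (_ : (\int[mu]_u _)%E = 0%E) ?lee_fin ?mulr_ge0 ?tilt_ge0 ?(ltW q0)//.
    under eq_integral => u _.
      rewrite /Psi TE -l0 (min_idPr (normr_ge0 u)) subrr /tilt ltxx mule0; over.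
    exact: integral0.
  apply: le_trans (conv l l0 lT); rewrite [leRHS]integral_mkcond; apply: le_integral_ge0 => u _.
    by apply: mule_ge0; [rewrite lee_fin|exact: Psi0].
  rewrite patchE mem_setE in_itv/= /Psi TE.
  have [u0|u0] := leP u 0; first by rewrite f_neg// mul0e.
  have [ul|lu] := ltP u l; first by rewrite gtr0_norm//; have /min_idPl -> : u <= l by exact: ltW.
  rewrite gtr0_norm//; have /min_idPr -> : l <= u by [].
  by rewrite subrr /tilt ltxx mule0.
rewrite ge0_integralZl//; last 3 first.
- apply/measurable_EFinP; apply: (measurableT_comp (measurable_tilt lam)).
  by apply: measurable_funB => //; exact: (measurable_Tsw _ _ (tau := wait)).
- by move=> w _; rewrite lee_fin tilt_ge0.
- by rewrite lee_fin ltW.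
apply: (le_trans (lee_wpmul2l _ IH)); first by rewrite lee_fin ltW.
by rewrite -EFinM lee_fin mulrA -exprS.
Qed.

Let process : process_on wait path. Proof. exact: (process_Om hW htau). Qed.

(** Every [lam >= 0] is allowed because the exponential weight is at least 1; its choice must wait
    until [D] is known. The absolute value makes the integrand nonnegative for all arguments, as
    [decouple] demands. *)
Lemma Phi_moment : exists2 D, 0 <= D & forall lam k, 0 <= lam ->
  (\int[P]_w (`|Phi k.+1 (wait w) (path w)|)%:E <=
   (D ^+ k.+1)%:E * \int[P]_w (tilt lam (T - Tsw (wait w) k))%:E)%E.
Proof.
have [I I0 int_pow] := integral_power th0 mass.
have [D D0 HD] := inner_bound hW x0 t0T rb rs T0 K0 c0 bM us sc ic gK mf f0 Zi0 I0 k0 k1 f_le f_neg int_pow.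
exists D => // lam k lam0.
pose Psi t wp := (`|Phi k.+1 t wp|)%:E.
have Psi0 t wp : (0 <= Psi t wp)%E by rewrite lee_fin.
have mPsi : mfunctional Psi.
  move=> d' S t wp pr; apply/measurable_EFinP; apply: measurableT_comp => //.
  exact: (measurable_Phi x0 t0T rb rs gK pr).
have -> : (\int[P]_w (`|Phi k.+1 (wait w) (path w)|)%:E = \int[P]_w Psi (wait w) (path w))%E by [].
rewrite (decouple hW htau hWtau mPsi Psi0).
pose Psi1 t := (\int[P]_w Psi t (path w))%E.
have Psi10 t : (0 <= Psi1 t)%E by apply: integral_ge0.
have mPsi1 (d' : measure_display) (S : measurableType d') (t : S -> nat -> R) :
    (forall j, measurable_fun setT (fun s => t s j)) -> (forall s j, 0 <= t s j) ->
    measurable_fun setT (fun s => Psi1 (t s)).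
  by move=> mt t_ge0; exact: (measurable_marginal hW mPsi Psi0).
have ext t t' : (forall j, (j <= k)%N -> t j = t' j) -> Psi1 t = Psi1 t'.
  by move=> tt'; apply: eq_integral => w _; rewrite /Psi (@eq_Phi _ _ _ _ _ _ _ _ t t').
rewrite (splice_integral htau mPsi1 Psi10 ext).
rewrite -ge0_integralZl//; last 3 first.
- apply/measurable_EFinP; apply: (measurableT_comp (measurable_tilt lam)).
  by apply: measurable_funB => //; exact: (measurable_Tsw _ _ (tau := wait)).
- by move=> w _; rewrite lee_fin tilt_ge0.
- by rewrite lee_fin exprn_ge0.
apply: le_integral_ge0 => w _.
  by apply: integral_ge0 => u _; rewrite mule_ge0 ?lee_fin.
have sp0 u j : 0 <= splice (wait w) k u j by rewrite /splice; case: ifP => // _; case: ifP.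
have PE u : Psi1 (splice (wait w) k u) = (\int[P]_w2 (Phi k.+1 (splice (wait w) k u) (path w2))%:E)%E.
  by apply: eq_integral => w2 _; rewrite /Psi ger0_norm// Phi_ge0.
under eq_integral do rewrite PE.
rewrite -EFinM; have [TT|TT] := leP T (Tsw (wait w) k).
  rewrite (_ : (\int[mu]_u _)%E = 0%E).
    by rewrite lee_fin mulr_ge0 ?exprn_ge0// tilt_ge0.
  have T1 u : Tsw (splice (wait w) k u) k.+1 = T.
    have TE : Tsw (splice (wait w) k u) k = T.
      have -> : Tsw (splice (wait w) k u) k = Tsw (wait w) k.
        by apply: eq_Tsw => j jk; rewrite /splice jk.
      by apply/eqP; rewrite eq_le TT Tsw_le.
    by rewrite /= TE subrr; have /min_idPr -> : 0 <= splice (wait w) k u k; rewrite ?addr0.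
  under eq_integral => u _.
    rewrite (_ : (\int[P]_w2 _)%E = 0%E); last first.
      by under eq_integral do rewrite /Phi T1 ltxx !mul0r; rewrite integral0.
    rewrite mule0; over.
  exact: integral0.
apply: (le_trans (HD (wait w) k (wait0 w) TT)).
rewrite lee_fin ler_wpM2l ?exprn_ge0// /tilt subr_gt0 TT.
rewrite ler_peMr ?powR_ge0// -expR0 ler_expR mulr_ge0// subr_ge0 ltW//.
Qed.

Lemma Phi_series C1 : 0 <= C1 -> exists2 B, 0 <= B & forall k,
  (\int[P]_w (C1 ^+ k.+1 * `|Phi k.+1 (wait w) (path w)|)%:E <= (B / (2 ^ k.+1)%:R)%:E)%E.
Proof.
move=> C10; have [D D0 HD] := Phi_moment.
have CD0 : 0 <= C1 * D by exact: mulr_ge0.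
(* Makes [C1 * D * q <= 1 / 2]: the contraction outweighs the growth of both constants and leaves a
   geometric series of ratio 1/2. *)
pose q := (2 * (C1 * D + 1))^-1.
have A0 : 0 < 2 * (C1 * D + 1) by rewrite mulr_gt0// ltr_wpDl.
have q0 : 0 < q by rewrite invr_gt0.
have [lam [lam0 Hlam]] := tilt_decay q0.
pose B := 2 * (C1 * D) * tilt lam (T - t0).
have B0 : 0 <= B by apply: mulr_ge0; [exact: mulr_ge0|exact: tilt_ge0].
exists B => // k.
have C1k : 0 <= C1 ^+ k.+1 by exact: exprn_ge0.
have mPhi : measurable_fun setT (fun w => (`|Phi k.+1 (wait w) (path w)|)%:E).
  apply/measurable_EFinP; apply: measurableT_comp => //.
  exact: (measurable_Phi x0 t0T rb rs gK process).
under eq_integral do rewrite EFinM.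
rewrite ge0_integralZl//.
apply: (le_trans (lee_wpmul2l _ (HD lam k lam0))); first by rewrite lee_fin.
rewrite muleA -EFinM.
have CDk : 0 <= C1 ^+ k.+1 * D ^+ k.+1 by rewrite mulr_ge0// exprn_ge0.
apply: (le_trans (lee_wpmul2l _ (Hlam k))); first by rewrite lee_fin.
rewrite -EFinM lee_fin /B.
have qk : (C1 * D * q) ^+ k <= (2^-1) ^+ k.
  apply: lerXn2r; rewrite ?nnegrE ?invr_ge0 ?mulr_ge0 ?(ltW q0)//.
  rewrite /q ler_pdivrMr// mulrA mulVf// mul1r lerDl//.
have tl := tilt_ge0 kappa lam (T - t0).
have -> : C1 ^+ k.+1 * D ^+ k.+1 * (q ^+ k * tilt lam (T - t0)) =
   (C1 * D * tilt lam (T - t0)) * (C1 * D * q) ^+ k by rewrite !exprMn !exprS; ring.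
have -> : 2 * (C1 * D) * tilt lam (T - t0) / (2 ^ k.+1)%:R =
   (C1 * D * tilt lam (T - t0)) * 2^-1 ^+ k.
  by rewrite natrX exprVn exprS; field; rewrite expf_neq0.
by rewrite ler_wpM2l// mulr_ge0.
Qed.

Lemma first_step_moment : exists2 C, 0 <= C &
  (\int[P]_w (`|wgt (dT T t0 (wait w) 1) (dW T t0 (path w) (wait w) 1)|)%:E <= C%:E)%E.
Proof.
have [C C0 HC] := gauss_moment P n.
exists (1 + C); first by rewrite addr_ge0.
pose Psi t wp := (`|wgt (dT T t0 t 1) (dW T t0 (wp : R -> 'cV[R]_N) t 1)|)%:E.
have Psi0 t wp : (0 <= Psi t wp)%E by rewrite lee_fin.
have mPsi : mfunctional Psi.
  move=> d' S t wp pr; apply/measurable_EFinP; apply: measurableT_comp => //.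
  exact: (measurable_first_step t0T pr).
rewrite (decouple hW htau hWtau mPsi Psi0).
have -> : ((1 + C)%:E = \int[P]_(w in setT) (1 + C)%:E)%E.
  by rewrite integral_prob_cst.
apply: le_integral_ge0 => w _; first by apply: integral_ge0.
have /andP[t1 t2] := t0T.
pose r := dT T t0 (wait w) 1.
have r0 : 0 <= r by rewrite /r /dT/= le_min wait_ge0 subr_ge0.
have TE : Tsw (wait w) 1 = t0 + r by [].
(* The first step is empty when [t0 = T]; then [wgt] equals 1 by the convention [0^-1 = 0], whence
   the 1 in the constant. *)
rewrite /Psi -/r; move: r0; rewrite le_eqVlt => /orP[/eqP r0|r0].
  under eq_integral => w2 _.
    rewrite -r0 /wgt invr0 mulr0 addr0 expr1n normr1; over.
  by rewrite integral_prob_cst lee_fin lerDl.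
have tr : t0 < t0 + r by rewrite ltrDl.
have := increment_gauss hW t1 tr; rewrite [X in is_gauss _ _ X]addrC addKr => G.
apply: (le_trans _ (_ : (C%:E <= _)%E)); last by rewrite lee_fin lerDr.
apply: le_trans (HC _ r G r0); apply: le_integral_ge0 => w2 _; first by rewrite lee_fin.
rewrite lee_fin /dW TE /= ger0_norm ?wgt_ge0 ?(ltW r0)//.
Qed.

Lemma second_moment_finite :
  (\int[P]_w (estimator b sigma g f F T t0 x0 (path w) (wait w) ^+ 2)%:E < +oo)%E.
Proof.
have [e e0 F_up] := gamma_tail k1 th0 mass T0.
have cf0 : 0 < Z^-1 * expR (- T / theta) by rewrite mulr_gt0 ?invr_gt0 ?expR_gt0.
have f_low u : 0 < u -> u <= T -> Z^-1 * expR (- T / theta) * u `^ (kappa - 1) <= f u.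
  by move=> u0 uT; exact: gamma_pdf_lower.
have [C0 [C1 [C00 C10 HS]]] := estimator_le x0 T0 t0T al k0 kal k2 K0 M0 L0 c0 cf0 e0 bM bL aL sc ic gK f_low F_up.
have [Ca Ca0 HZ] := estimator0_le f x0 T0 t0T K0 M0 c0 e0 bM sc gK F_up.
have [Cw Cw0 Hw] := first_step_moment.
have [B B0 HB] := Phi_series C10.
pose Y w := estimator b sigma g f F T t0 x0 (path w) (wait w).
pose v w := `|wgt (dT T t0 (wait w) 1) (dW T t0 (path w) (wait w) 1)|.
have v0 w : 0 <= v w by exact: normr_ge0.
pose a k w := (C1 ^+ k.+1 * `|Phi k.+1 (wait w) (path w)|)%:E.
have a0 k w : (0 <= a k w)%E by rewrite lee_fin mulr_ge0// exprn_ge0.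
have ma k : measurable_fun setT (a k).
  apply/measurable_EFinP; apply: measurable_funM => //; apply: measurableT_comp => //.
  exact: (measurable_Phi x0 t0T rb rs gK process).
have mv : measurable_fun setT v.
  by apply: measurableT_comp => //; exact: (measurable_first_step t0T process).
have CT0 : 0 <= Ca * (1 + T) by rewrite mulr_ge0// addr_ge0// ltW.
have S0 w : (0 <= \sum_(k <oo) a k w)%E by apply: nneseries_ge0 => k _ _; exact: a0.
(* Each sample uses a single term of the series, or the separate bound when [NT] is 0. Bounding by
   the sum of all terms avoids integrating over the events [NT = m] one by one. *)
apply: (@le_lt_trans _ _ (\int[P]_w ((Ca * (1 + T))%:E * (1 + v w)%:E + C0%:E * \sum_(k <oo) a k w))%E).
  apply: le_integral_ge0 => w _; first by rewrite lee_fin sqr_ge0.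
  have v1 : 0 <= 1 + v w by rewrite addr_ge0.
  case E : (NT T t0 (wait w)) => [|m].
    apply: (@le_trans _ _ ((Ca * (1 + T))%:E * (1 + v w)%:E)%E); last first.
      by rewrite leeDl// mule_ge0.
    rewrite -EFinM lee_fin; apply: (le_trans (HZ (wait w) (path w) (wait0 w) E)).
    rewrite -mulrA ler_wpM2l//.
    pose r := dT T t0 (wait w) 1; pose y := dW T t0 (path w) (wait w) 1.
    have /andP[t1 t2] := t0T.
    have r0 : 0 <= r by rewrite /r /dT/= le_min wait_ge0 subr_ge0.
    have rT : r <= T by rewrite /r /dT/= ge_min; apply/orP; right; lra.
    have yv : `|y| ^+ 2 <= T * v w.
      move: r0; rewrite le_eqVlt => /orP[/eqP r0|r0].
        have -> : y = 0.
          have TE : Tsw (wait w) 1 = t0 + r by [].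
          by rewrite /y /dW TE -r0 addr0 subrr.
        by rewrite normr0 expr0n mulr_ge0// ltW.
      have q0 : 0 <= `|y| ^+ 2 / r by rewrite divr_ge0 ?sqr_ge0 ?ltW.
      have vE : `|y| ^+ 2 / r <= v w.
        rewrite /v -/r -/y ger0_norm ?wgt_ge0 ?(ltW r0)// /wgt.
        set x := _ / r in q0 *.
        apply: (@le_trans _ _ (1 + x)); first by rewrite lerDr.
        by rewrite exprS ler_peMr ?addr_ge0// exprn_ege1// lerDl.
      have -> : `|y| ^+ 2 = r * (`|y| ^+ 2 / r) by rewrite mulrC divfK// gt_eqF.
      by apply: ler_pM => //; exact: ltW.
    have := ltW T0; have := v0 w; rewrite -/y; move: yv; set yy := `|y| ^+ 2; move=> h1 h2 h3; lra.
  apply: (@le_trans _ _ (C0%:E * \sum_(k <oo) a k w)%E); last first.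
    by rewrite leeDr// mule_ge0 ?lee_fin.
  apply: (@le_trans _ _ (C0%:E * a m w)%E).
    rewrite -EFinM lee_fin mulrA; apply: (le_trans (HS (wait w) (path w) m (wait0 w) E)).
    by rewrite ler_wpM2l ?ler_norm// mulr_ge0// exprn_ge0.
  rewrite lee_wpmul2l ?lee_fin//.
  apply: le_trans (nneseries_lim_ge m.+1 (fun k _ _ => a0 k w)).
  by rewrite big_nat_recr//= leeDr// sume_ge0.
have mS : measurable_fun setT (fun w => \sum_(k <oo) a k w)%E.
  exact: ge0_emeasurable_sum.
rewrite ge0_integralD//; last 4 first.
- by move=> w _; rewrite -EFinM lee_fin mulr_ge0// addr_ge0.
- by apply: measurable_funeM; apply/measurable_EFinP; exact: measurable_funD.
- by move=> w _; rewrite mule_ge0 ?lee_fin.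
- exact: measurable_funeM.
rewrite !ge0_integralZl//; last 2 first.
- by apply/measurable_EFinP; exact: measurable_funD.
- by move=> w _; rewrite lee_fin addr_ge0.
have i1 : (\int[P]_w (1 + v w)%:E <= (1 + Cw)%:E)%E.
  under eq_integral do rewrite EFinD.
  rewrite ge0_integralD//; last 2 first.
  - by move=> w _; rewrite lee_fin.
  - exact/measurable_EFinP.
  by rewrite integral_prob_cst EFinD; apply: leeD.
have i2 : (\int[P]_w (\sum_(k <oo) a k w) <= B%:E)%E.
  rewrite integral_nneseries//.
  apply: le_trans (epsilon_trick0 xpredT B0); apply: lee_nneseries => k _; last exact: HB.
  by move=> _; exact: integral_ge0.
apply: (@le_lt_trans _ _ ((Ca * (1 + T))%:E * (1 + Cw)%:E + C0%:E * B%:E)%E).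
  by apply: leeD; apply: lee_wpmul2l; rewrite ?lee_fin.
by rewrite -!EFinM -EFinD ltry.
Qed.

Lemma measurable_sample : measurable_fun setT
  (fun w => estimator b sigma g f F T t0 x0 (path w) (wait w)).
Proof.
apply: (measurable_estimator x0 t0T rb rs us gK mf _ process).
exact: measurable_gamma_cdf mass.
Qed.

End estimator_moment.

(** * Finite variance from the second moment, and consequences of ellipticity *)

Lemma finite_variance_second_moment (R : realType) (d : measure_display) (Om : measurableType d)
    (P : probability Om R) (Y : Om -> R) : measurable_fun setT Y ->
  (\int[P]_w (Y w ^+ 2)%:E < +oo)%E -> finite_variance P Y.
Proof.
move=> mY Y2.
have mY2 : measurable_fun setT (fun w => (Y w ^+ 2)%:E).
  by apply/measurable_EFinP; exact: measurable_funX.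
have Y20 w : (0 <= (Y w ^+ 2)%:E)%E by rewrite lee_fin sqr_ge0.
(* Both [|Y|] and the square of [Y - m] lie below [2 Y^2 + a], with [a = 1] and [a = 2 m^2]
   respectively. *)
have bound (a : R) : 0 <= a -> (\int[P]_w (2%:E * (Y w ^+ 2)%:E + a%:E) < +oo)%E.
  move=> a0; rewrite ge0_integralD//; last 2 first.
  - by move=> w _; rewrite mule_ge0.
  - exact: measurable_funeM.
  rewrite ge0_integralZl// integral_prob_cst.
  by rewrite lte_add_pinfty ?ltry// lte_mul_pinfty.
split=> //.
- apply/integrableP; split; first exact/measurable_EFinP.
  apply: le_lt_trans (bound 1 ler01); apply: le_integral_ge0 => w _ //=.
  rewrite -EFinM -EFinD lee_fin; have := sqr_ge0 (`|Y w| - 1).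
  rewrite -[Y w ^+ 2]real_normK ?num_real//; have := sqr_ge0 `|Y w|.
  by rewrite sqrrB1; lra.
- rewrite /variance unlock /covariance.
  set m := fine _.
  have : (\int[P]_w (((Y w - m) ^+ 2)%:E) < +oo)%E.
    apply: le_lt_trans (bound (2 * m ^+ 2) _); last by rewrite mulr_ge0// sqr_ge0.
    apply: le_integral_ge0 => w _; first by rewrite lee_fin sqr_ge0.
    rewrite -EFinM -EFinD lee_fin; have := sqr_ge0 (Y w + m); rewrite sqrrD sqrrB; lra.
  by rewrite unlock.
Qed.

Section ellipticity.
Context (R : realType) (n : nat).

Lemma norm_le_sqr (x : R) : `|x| <= 1 + x ^+ 2.
Proof. by rewrite -[x ^+ 2]real_normK ?num_real//; have := sqr_ge0 (`|x| - 1); rewrite sqrrB1; have := normr_ge0 x; lra. Qed.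

Lemma dot_self (v : 'cV[R]_n) : (v^T *m v) 0 0 = \sum_i v i 0 ^+ 2.
Proof. by rewrite mxE; apply: eq_bigr => i _; rewrite mxE expr2. Qed.

Lemma loewner_quadratic (A : 'M[R]_n) (eps : R) (v : 'cV[R]_n) :
  loewner_ge (A *m A^T) (eps *: 1%:M) ->
  eps * (\sum_i v i 0 ^+ 2) <= \sum_i (A^T *m v) i 0 ^+ 2.
Proof.
move=> /(_ v); rewrite -!dot_self trmx_mul trmxK mulmxBr mulmxBl -!mulmxA.
by rewrite -scalemxAl mul1mx -scalemxAr !mxE subr_ge0.
Qed.

Lemma elliptic_unit (A : 'M[R]_n) (eps : R) : 0 < eps ->
  loewner_ge (A *m A^T) (eps *: 1%:M) -> A \in unitmx.
Proof.
move=> eps0 ell; rewrite unitmxE unitfE; apply/negP => /eqP/eqP/det0P[v v0 vA].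
have := loewner_quadratic v^T ell.
have -> : A^T *m v^T = 0 by rewrite -trmx_mul vA trmx0.
rewrite [X in _ <= X]big1; last by move=> i _; rewrite mxE expr0n.
rewrite pmulr_rle0// => h.
have s0 : \sum_i v^T i 0 ^+ 2 = 0.
  by apply/eqP; rewrite eq_le h sumr_ge0// => i _; exact: sqr_ge0.
move/eqP: v0; apply; apply/matrixP => i j; rewrite ord1 [RHS]mxE.
have := psumr_eq0P (fun k _ => sqr_ge0 (v^T k 0)) s0 (i := j) isT.
by move/eqP; rewrite expf_eq0/= mxE => /eqP.
Qed.

(** Test ellipticity on a row of the inverse: [A^T] sends it to a basis vector, so its squared
    length is at most [eps^-1]. *)
Lemma elliptic_inverse (A : 'M[R]_n) (eps : R) : 0 < eps ->
  loewner_ge (A *m A^T) (eps *: 1%:M) -> forall i j, `|invmx A i j| <= 1 + eps^-1.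
Proof.
move=> eps0 ell i j; have uA := elliptic_unit eps0 ell.
have := loewner_quadratic (row i (invmx A))^T ell.
have -> : A^T *m (row i (invmx A))^T = (row i 1%:M)^T by rewrite -trmx_mul -row_mul mulVmx.
have -> : \sum_k (row i (1%:M : 'M[R]_n))^T k 0 ^+ 2 = 1.
  rewrite (bigD1 i)//= !mxE eqxx expr1n big1 ?addr0// => k ki.
  by rewrite !mxE eq_sym (negbTE ki) expr0n.
move=> h; apply: (le_trans (norm_le_sqr _)); rewrite lerD2l -(ler_pM2l eps0) mulfV ?gt_eqF//.
apply: le_trans h; rewrite ler_wpM2l ?(ltW eps0)// (bigD1 j)//= !mxE lerDl.
by rewrite sumr_ge0// => k _; exact: sqr_ge0.
Qed.

(** The diagonal entries of [A *m A^T] are the squared lengths of the rows of [A]. *)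
Lemma entry_le_diffusion (A : 'M[R]_n) (M : R) : `|A *m A^T| <= M ->
  forall i j, `|A i j| <= 1 + M.
Proof.
move=> AM i j; apply: (le_trans (norm_le_sqr _)); rewrite lerD2l.
apply: le_trans AM; apply: le_trans (mx_norm_entry _ i i).
rewrite ger0_norm mxE; last by apply: sumr_ge0 => k _; rewrite mxE -expr2 sqr_ge0.
rewrite (bigD1 j)//= mxE -expr2 lerDl sumr_ge0// => k _.
by rewrite mxE -expr2 sqr_ge0.
Qed.

End ellipticity.

Lemma dist_le_sum (R : realType) (V : normedZmodType R) (x y z : V) (H L p q : R) :
  0 <= p -> 0 <= q -> `|x - y| <= H * p -> `|y - z| <= L * q ->
  `|x - z| <= (`|H| + `|L|) * (p + q).
Proof.
move=> p0 q0 xy yz; rewrite -(subrK y x) -addrA.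
apply: (le_trans (ler_normD _ _)); apply: (le_trans (lerD xy yz)).
have h1 := ler_wpM2r p0 (ler_norm H); have h2 := ler_wpM2r q0 (ler_norm L).
have h3 := mulr_ge0 (normr_ge0 H) q0; have h4 := mulr_ge0 (normr_ge0 L) p0.
by rewrite mulrDl !mulrDr; lra.
Qed.

Theorem proposition4p1
  (R : realType) (d : nat) (hd : (0 < d)%N)
  (dd : measure_display) (Omega : measurableType dd) (P : probability Omega R)
  (T : R) (hT : 0 < T)
  (b : R -> 'cV[R]_d -> 'cV[R]_d) (sigma : R -> 'cV[R]_d -> 'M[R]_d)
  (hSDE : usual_lipschitz T b sigma)
  (g : 'cV[R]_d -> R)
  (t0 : R) (ht0 : 0 <= t0 <= T) (x0 : 'cV[R]_d)
  (W : R -> Omega -> 'cV[R]_d) (hW : is_brownian P W)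
  (kappa theta : R) (hkappa : 0 < kappa) (htheta : 0 < theta)
  (tau : nat -> Omega -> R) (htau : iid_gamma P kappa theta tau)
  (hWtau : indep_process P W tau)
  (a := diffusion sigma)
  (h_i : exists2 eps0 : R, 0 < eps0 &
     forall t x, 0 <= t <= T -> loewner_ge (a t x) (eps0 *: 1%:M))
  (h_ii : exists L : R, forall t x x', 0 <= t <= T ->
     `|b t x - b t x'| + `|a t x - a t x'| <= L * `|x - x'|)
  (alpha : R) (halpha : 0 < alpha <= 1)
  (h_iii : exists H : R, forall t t' x, 0 <= t <= T -> 0 <= t' <= T ->
     `|b t x - b t' x| + `|a t x - a t' x| <= H * `|t - t'| `^ alpha)
  (h_iv : exists M : R, forall t x, 0 <= t <= T ->
     `|b t x| <= M /\ `|a t x| <= M)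
  (hg_lip : exists K : R, K.-lipschitz g)
  (hg_C2 : C2 g)
  (h_vi : kappa <= Num.min alpha 2^-1) :
  finite_variance P (fun w : Omega =>
    estimator b sigma g (gamma_pdf kappa theta) (gamma_cdf kappa theta)
      T t0 x0 (fun t => W t w) (fun k => tau k w)).
Proof.
destruct d as [|n]; first by [].
have [mb ms [Kl Kl_le] _] := hSDE.
have rb : coef_regular T b.
  split; first by move=> x i j; rewrite ord1; exact: mb.
  by exists Kl => t x x' tT; apply: le_trans (Kl_le t x x' tT); rewrite lerDl.
have rs : coef_regular T sigma.
  split; first by move=> x i j; exact: ms.
  by exists Kl => t x x' tT; apply: le_trans (Kl_le t x x' tT); rewrite lerDr.
have [eps e0 ell] := h_i; have [L L_le] := h_ii; have [H H_le] := h_iii.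
have [M M_le] := h_iv; have [K K_lip] := hg_lip.
have M0 : 0 <= M.
  have T0T : 0 <= T <= T by rewrite lexx ltW.
  by apply: le_trans (M_le T x0 T0T).1.
(* One constant for both sides of ellipticity: entries of [sigma] are at most [1 + M], those of its
   inverse at most [1 + eps^-1]. *)
pose c := 1 + M + eps^-1.
have ei : 0 < eps^-1 by rewrite invr_gt0.
have c0 : 0 < c by rewrite /c -addrA ltr_pwDl// addr_ge0// ltW.
have sc t x i j : 0 <= t <= T -> `|sigma t x i j| <= c.
  move=> tT; apply: le_trans (entry_le_diffusion (M_le t x tT).2 i j) _.
  by rewrite /c lerDl ltW.
have ic t x i j : 0 <= t <= T -> `|invmx (sigma t x) i j| <= c.
  move=> tT; apply: le_trans (elliptic_inverse e0 (ell t x tT) i j) _.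
  by rewrite /c addrAC lerDl.
have us t x : 0 <= t <= T -> sigma t x \in unitmx.
  by move=> tT; exact: elliptic_unit e0 (ell t x tT).
have gK y y' : `|g y - g y'| <= `|K| * `|y - y'|.
  apply: (le_trans (K_lip (y, y') (conj I I))).
  by rewrite ler_wpM2r// ler_norm.
have bL t t' x x' : 0 <= t <= T -> 0 <= t' <= T ->
    `|b t x - b t' x'| <= (`|H| + `|L|) * (`|t - t'| `^ alpha + `|x - x'|).
  move=> tT tT'; apply: (@dist_le_sum _ _ _ (b t' x)); rewrite ?powR_ge0//.
    by apply: le_trans (H_le t t' x tT tT'); rewrite lerDl.
  by apply: le_trans (L_le t' x x' tT'); rewrite lerDl.
have aL t t' x x' : 0 <= t <= T -> 0 <= t' <= T ->
    `|diffusion sigma t x - diffusion sigma t' x'| <=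
    (`|H| + `|L|) * (`|t - t'| `^ alpha + `|x - x'|).
  move=> tT tT'; apply: (@dist_le_sum _ _ _ (diffusion sigma t' x)); rewrite ?powR_ge0//.
    by apply: le_trans (H_le t t' x tT tT'); rewrite lerDr.
  by apply: le_trans (L_le t' x x' tT'); rewrite lerDr.
have HL0 : 0 <= `|H| + `|L| by rewrite addr_ge0.
move: h_vi; rewrite le_min => /andP[kal k2].
apply: finite_variance_second_moment.
  exact: (measurable_sample hW htau x0 ht0 rb rs us gK).
exact: (second_moment_finite hW htau hWtau x0 ht0 rb rs hT halpha (normr_ge0 K) M0 HL0 c0
  hkappa kal k2 htheta (fun t x tT => (M_le t x tT).1) bL aL us sc ic gK).
Qed.
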